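(* Let $p\ge3$ be an odd integer, let $\alpha\in(0,\frac{1}{p-2})$, and let $\varphi$ be operator data of Wigner-von Neumann type satisfying the uniform $L^p$ condition for this $p$ and the $\alpha$-type decay condition for this $\alpha$. Then the set of energies $E\in\mathbb{R}$ for which there exists an unbounded solution $U$ of $\Lambda_\varphi U=EU$ on $(0,\infty)$ has Hausdorff dimension at most $(p-2)\alpha$, and $\mathbb{R}$ is the essential support of the absolutely continuous spectrum of $\Lambda_\varphi$ (for every boundary condition $\omega$).
   Context: For $\gamma:(0,\infty)\to\mathbb{C}$, $\mathrm{Var}(\gamma,(0,\infty))$ is the supremum of $\sum_{j=1}^k|\gamma(x_j)-\gamma(x_{j-1})|$ over $k\in\mathbb{N}$ and $0<x_0<\dots<x_k$. $\varphi$ is of Wigner-von Neumann type (with parameters $p$ odd, $p\ge3$, and $\alpha\in(0,\frac1{p-2})$) if $\varphi(x)=\sum_{j=1}^\infty c_je^{-i\phi_jx}\gamma_j(x)$ with $c_j\in\mathbb{C}$, $\phi_j\in\mathbb{R}$, $\gamma_j:(0,\infty)\to\mathbb{C}$ such that: $\sup_j\mathrm{Var}(\gamma_j,(0,\infty))<\infty$; $\sup_j\int_0^\infty|\gamma_j(t)|^p\,dt<\infty$ (uniform $L^p$ condition); $\sum_j|c_j|^\alpha<\infty$ ($\alpha$-type decay of coefficients). $$\Lambda_\varphi=\begin{pmatrix}i&0\\0&-i\end{pmatrix}\frac{d}{dx}+\begin{pmatrix}0&\varphi(x)\\\overline{\varphi(x)}&0\end{pmatrix},$$ realized as a self-adjoint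 operator $\Lambda_\varphi^\omega$ on $L^2((0,\infty),\mathbb{C}^2)$ with domain $\{f\in H^1((0,\infty),\mathbb{C}^2):(\omega\ \ \overline\omega)f(0)=0\}$, $\omega\in\mathbb{C}$, $|\omega|=1$. That $\mathbb{R}$ is the essential support of the absolutely continuous spectrum means that the absolutely continuous part of a maximal spectral measure is mutually absolutely continuous with Lebesgue measure on $\mathbb{R}$. *)

(* Defs.v *)
From mathcomp Require Import all_boot all_order all_algebra.
From mathcomp Require Import all_classical all_reals all_analysis.
From mathcomp Require Import complex.
Import Order.TTheory GRing.Theory Num.Theory.
Import numFieldNormedType.Exports.

Set Implicit Arguments.
Unset Strict Implicit.
Unset Printing Implicit Defensive.

Local Open Scope classical_set_scope.
Local Open Scope ring_scope.
Local Open Scope complex_scope.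

Local Notation leb := (@lebesgue_measure _).
Local Notation cmod := Normc.normc.

Section Hausdorff.
Context {R : realType}.
Implicit Types (A S : set R) (s delta : R).

(* 0 is thrown in so that the empty set has diameter 0 rather than -oo. *)
Definition ediam A : \bar R :=
  ereal_sup (0%E |` [set (`|x.1 - x.2|)%:E | x in A `*` A]).

(* diam(A)^s; 0 `^ 0 = 1, so the empty set is treated apart to make the
   0-dimensional measure the counting measure. *)
Definition hausdorff_gauge s A : \bar R :=
  if `[< A = set0 >] then 0%E else (ediam A `^ s)%E.

Definition hausdorff_premeasure s delta S : \bar R :=
  ereal_inf [set (\sum_(0 <= n <oo) hausdorff_gauge s (B n))%E
            | B in [set B : (set R)^nat |
                S `<=` \bigcup_n B n /\
                forall n, (ediam (B n) <= delta%:E)%E]].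

Definition hausdorff_measure s S : \bar R :=
  ereal_sup [set hausdorff_premeasure s delta S | delta in [set d | 0 < d]].

Definition hausdorff_dim S : \bar R :=
  ereal_inf [set s%:E | s in [set s | 0 <= s /\ hausdorff_measure s S = 0%E]].

End Hausdorff.

Section WignerVonNeumann.
Context {R : realType}.

Definition variation_pos (g : R -> R[i]) : \bar R :=
  ereal_sup [set v | exists (k : nat) (x : nat -> R),
    [/\ 0 < x 0%N,
        forall j, (j < k)%N -> x j < x j.+1 &
        v = (\sum_(j < k) cmod (g (x j.+1) - g (x j)))%:E]].

(* The functions phi and gamma j are only constrained on the half-line x > 0. *)
Definition wigner_von_neumann (p : nat) (alpha : R) (phi : R -> R[i]) : Prop :=
  exists (c : nat -> R[i]) (theta : nat -> R) (gamma : nat -> R -> R[i]),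
    [/\ forall x, 0 < x ->
          (fun n => cmod (phi x - \sum_(j < n)
              c j * (cos (theta j * x) -i* sin (theta j * x)) * gamma j x))
            @ \oo --> (0 : R),
        (ereal_sup (range (fun j => variation_pos (gamma j))) < +oo)%E,
        (ereal_sup (range (fun j =>
           \int[leb]_(t in `]0%R, +oo[) (cmod (gamma j t) ^+ p)%:E)) < +oo)%E &
        (\sum_(0 <= j <oo) (cmod (c j) `^ alpha)%:E < +oo)%E].

End WignerVonNeumann.

Section Dirac.
Context {R : realType}.
Local Notation C2 := 'cV[R[i]]_2.
Implicit Types (f g h u U D : R -> C2) (v w : C2) (phi : R -> R[i]).

Definition vnorm v : R := Num.sqrt (\sum_(i < 2) cmod (v i 0) ^+ 2).

Definition abs_continuous_on (a b : R) f : Prop :=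
  forall e, 0 < e -> exists2 d, 0 < d &
    forall (n : nat) (s t : nat -> R),
      (forall i, (i < n)%N -> a <= s i /\ s i <= t i /\ t i <= b) ->
      (forall i, (i.+1 < n)%N -> t i <= s i.+1) ->
      \sum_(i < n) (t i - s i) < d ->
      \sum_(i < n) vnorm (f (t i) - f (s i)) < e.

Definition loc_abs_continuous (I : set R) f : Prop :=
  forall a b, a <= b -> `[a, b] `<=` I -> abs_continuous_on a b f.

Definition has_vderive f (x : R) v : Prop :=
  forall i, is_derive x 1 (fun t => complex.Re (f t i 0)) (complex.Re (v i 0)) /\
            is_derive x 1 (fun t => complex.Im (f t i 0)) (complex.Im (v i 0)).

Definition mx2 (a b c d : R[i]) : 'M[R[i]]_2 :=
  \matrix_(i < 2, j < 2)
    if i == 0 then (if j == 0 then a else b) else (if j == 0 then c else d).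

(* The value of Lambda_phi u at x, when v = u'(x) and w = u(x). *)
Definition dirac_expr phi (x : R) v w : C2 :=
  mx2 'i 0 0 (- 'i) *m v + mx2 0 (phi x) (conjc (phi x)) 0 *m w.

Definition dirac_solution phi (E : R) U : Prop :=
  loc_abs_continuous `]0, +oo[ U /\
  {ae leb, forall x : R, 0 < x ->
     exists2 v, has_vderive U x v & dirac_expr phi x v (U x) = E%:C *: U x}.

Definition unbounded_pos U : Prop :=
  forall M : R, exists2 x, 0 < x & M < vnorm (U x).

(* L^2((0,oo),C^2), through representatives; equality is ae_eq_pos. *)
Definition ae_eq_pos f g : Prop := {ae leb, forall x : R, 0 < x -> f x = g x}.

Definition L2 f : Prop :=
  (forall i : 'I_2,
     measurable_fun (`]0, +oo[ : set R) (fun x : R => complex.Re (f x i 0)) /\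
     measurable_fun (`]0, +oo[ : set R) (fun x : R => complex.Im (f x i 0))) /\
  (\int[leb]_(x in `]0%R, +oo[) (vnorm (f x) ^+ 2)%:E < +oo)%E.

Definition L2dot f g : R[i] :=
  let F x := \sum_(i < 2) conjc (f x i 0) * g x i 0 in
  (Rintegral leb `]0, +oo[ (fun x => complex.Re (F x))) +i*
  (Rintegral leb `]0, +oo[ (fun x => complex.Im (F x))).

(* u is the continuous representative of an element of H^1 and D its
   derivative; local absolute continuity up to 0 gives meaning to u(0). *)
Definition H1 u D : Prop :=
  [/\ loc_abs_continuous `[0, +oo[ u, L2 u, L2 D &
      {ae leb, forall x : R, 0 < x -> has_vderive u x (D x)}].

(* An unbounded operator is given by its graph, a relation on L^2. *)
Definition dirac_op phi (omega : R[i]) f h : Prop :=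
  [/\ L2 f, L2 h & exists u D,
    [/\ H1 u D,
        omega * u 0 0 0 + conjc omega * u 0 1 0 = 0,
        ae_eq_pos f u &
        {ae leb, forall x : R, 0 < x -> h x = dirac_expr phi x (D x) (u x)}]].

End Dirac.

Section SpectralMeasures.
Context {R : realType}.
Local Notation C2 := 'cV[R[i]]_2.
Local Notation borel_measure := {measure set (measurableTypeR R) -> \bar R}.
Implicit Types (P : (R -> C2) -> R -> C2) (A : (R -> C2) -> (R -> C2) -> Prop).

(* Linearity and compatibility with a.e. equality follow from symmetry. *)
Definition orthogonal_projection P : Prop :=
  [/\ forall f, L2 f -> L2 (P f),
      forall f, L2 f -> ae_eq_pos (P (P f)) (P f) &
      forall f g, L2 f -> L2 g -> L2dot (P f) g = L2dot f (P g)].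

(* mu f is the measure B |-> <f, E(B) f>; that it is a measure expresses the
   countable additivity of E. *)
Definition projection_valued_measure
    (E : set (measurableTypeR R) -> (R -> C2) -> R -> C2)
    (mu : (R -> C2) -> borel_measure) : Prop :=
  [/\ forall B, measurable B -> orthogonal_projection (E B),
      forall f, L2 f -> ae_eq_pos (E setT f) f &
      forall f B, L2 f -> measurable B ->
        mu f B = (complex.Re (L2dot f (E B f)))%:E].

(* A = \int l dE(l): the domain of A is {f | \int l^2 d(mu f) < oo}, and
   <f, A f> = \int l d(mu f) there, which determines A by polarization. *)
Definition spectral_resolution A
    (E : set (measurableTypeR R) -> (R -> C2) -> R -> C2)
    (mu : (R -> C2) -> borel_measure) : Prop :=
  [/\ projection_valued_measure E mu,
      forall f, L2 f ->
        ((exists h, A f h) <-> (\int[mu f]_l (l ^+ 2)%:E < +oo)%E) &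
      forall f h, A f h ->
        L2dot f h = (Rintegral (mu f) setT (fun l => l))%:C].

Definition maximal_spectral_measure A (m : borel_measure) : Prop :=
  exists E mu, spectral_resolution A E mu /\
    exists2 g, L2 g & m = mu g /\ forall f, L2 f -> mu f `<< m.

Definition singular_measures (m1 m2 : borel_measure) : Prop :=
  exists N, [/\ measurable N, m1 (~` N) = 0%E & m2 N = 0%E].

Definition ac_part (m mac : borel_measure) : Prop :=
  mac `<< leb /\
  exists ms : borel_measure, singular_measures ms leb /\
    forall B, measurable B -> m B = (mac B + ms B)%E.

Definition ac_essential_support_is_R A : Prop :=
  forall m, maximal_spectral_measure A m ->
    exists2 mac, ac_part m mac & (mac `<< leb /\ leb `<< mac).

End SpectralMeasures.

(* Main.v *)
Require Import Defs.
From HB Require Import structures.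
From mathcomp Require Import all_boot all_order all_algebra.
From mathcomp Require Import all_classical all_reals all_analysis.
From mathcomp Require Import complex.
From mathcomp Require Import measurable_realfun ring lra zify.
Import Order.TTheory GRing.Theory Num.Theory.
Import numFieldNormedType.Exports.

Local Open Scope classical_set_scope.
Local Open Scope ring_scope.

Set Implicit Arguments.
Unset Strict Implicit.
Unset Printing Implicit Defensive.

(** For a solution [U] of [Lambda U = E U] put [P = |U|^2], [Y = 2 U_1 conj U_2]
    and [m = i phi]; then [P' = 2 Re (conj m Y)] and [Y' = - 2 i E Y + 2 m P].
    If [K] solves the Riccati equation [K' = - 2 i E K + m - conj m K^2], the
    energy [((1 + |K|^2) P - 2 Re (conj K Y)) / (1 - |K|^2)] is conserved; an
    integrable error in the Riccati equation changes it by a bounded factor only.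
    Solving this equation formally gives a sum over binary trees whose
    coefficients have one denominator [2 E - a] for each subtree, [a] being the
    frequency of the subtree.  Truncated to trees of size at most [p - 2], it has
    an integrable error: bounded variation takes care of the derivatives of the
    amplitudes, which are replaced by linear interpolations between integers,
    and, [p] being odd, what is left has order at least [p] and is controlled by
    the L^p condition.  The coefficients are summable as soon as a Riesz potential
    of order [(p - 2) alpha] of a finite atomic measure is finite at [E], and a
    dyadic covering shows that the other energies form a set of dimension at most
    [(p - 2) alpha < 1].

    The a priori estimate also holds for [(Lambda - E - i eps) u = f], with a loss
    that stays bounded on an interval of length [1 / eps].  For a suitable [f]
    supported near [0] it bounds [eps ||u||^2] from below, for almost every [E],
    as [eps] tends to [0].  As [||u||^2] is the integral of
    [1 / ((l - E)^2 + eps^2)] against the spectral measure of [f], Tonelli's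
    theorem shows that this measure charges every compact set of positive Lebesgue
    measure. *)

(** * Absolutely continuous functions *)

(** The exponent [(p - 2) * alpha] counts denominators. A tree of size [n] has [n] of them, so the
    [alpha]-th power of its coefficient is at most a weight times at most [p - 2] factors
    [|2 E - a|^(- alpha)]. A product of at most [m] nonnegative numbers is at most 1 plus the sum of
    their [m]-th powers, whence a singularity of order [(p - 2) * alpha]. As [alpha <= 1], summable
    [alpha]-th powers make the coefficients themselves summable. The series for [phi] is infinite,
    but the Riccati approximation uses its first [N] terms. All bounds on it are therefore uniform
    in [N], and [N] is chosen last, in terms of the length of the interval, so that the neglected
    tail costs a bounded factor only. A spectral resolution provides projections and the quadratic
    form of the operator, but no functional calculus. The resolvent is therefore replaced by Riemann
    sums over spectral cells, which solve [(Lambda - E - i eps) u = f] up to a residual. The a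
    priori estimate carries a forcing term [M] in order to absorb it, and a residual of square norm
    at most [eps^2] is small enough. *)

Section AbsoluteContinuity.
Context {R : realType}.
Implicit Types (a b x y s t v e k c m C : R) (f g F G M : R -> R).
Local Notation leb := (@lebesgue_measure R).

Definition ac a b f : Prop :=
  forall e, 0 < e -> exists2 d, 0 < d &
    forall (n : nat) (s t : nat -> R),
      (forall i, (i < n)%N -> a <= s i /\ s i <= t i /\ t i <= b) ->
      (forall i, (i.+1 < n)%N -> t i <= s i.+1) ->
      \sum_(i < n) (t i - s i) < d ->
      \sum_(i < n) `|f (t i) - f (s i)| < e.

Lemma ae_imp (P Q : R -> Prop) : {ae leb, forall x, P x} ->
  (forall x, P x -> Q x) -> {ae leb, forall x, Q x}.
Proof.
move=> [N [mN N0 HN]] PQ; exists N; split => // x /= nQ.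
by apply: HN => /= Px; apply: nQ; exact: PQ.
Qed.

Lemma ae_and (P Q : R -> Prop) : {ae leb, forall x, P x} ->
  {ae leb, forall x, Q x} -> {ae leb, forall x, P x /\ Q x}.
Proof.
move=> aP aQ; apply: (negligibleS _ (negligibleU aP aQ)) => x /= nPQ.
by have [Px|] := pselect (P x); [right => Qx; exact: nPQ|left].
Qed.

(** Induction along an interval: at the supremum of the points satisfying [S], the local step leads
    from a point just before it to a point just after it. *)
Lemma real_induction a b (S : R -> Prop) : a <= b -> S a ->
  (forall x, a <= x -> x <= b -> exists2 r, 0 < r &
     forall s t, a <= s -> s <= x -> x <= t -> t <= b -> x - r < s -> t < x + r ->
       S s -> S t) ->
  S b.
Proof.
move=> ab Sa H.
pose A := [set c | a <= c <= b /\ S c].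
have Aa : A a by rewrite /A /= lexx ab.
have hA : has_sup A.
  split; first by exists a.
  by exists b => x [/andP[_ xb] _].
pose x := sup A.
have ax : a <= x by apply: ub_le_sup => //; exact: hA.2.
have xb : x <= b by apply: ge_sup; [exact: hA.1|move=> y [/andP[]]].
have [r r0 Hr] := H x ax xb.
have [s [/andP[as_ sb] Ss] xs] := sup_adherent r0 hA.
have sx : s <= x by apply: ub_le_sup; [exact: hA.2|split => //; apply/andP].
pose t := Num.min b (x + r / 2).
have xt : x <= t by rewrite /t le_min xb /= lerDl divr_ge0 // ltW.
have tb : t <= b by rewrite /t ge_min lexx.
have St : S t.
  apply: (Hr s) => //; rewrite /t gt_min ltrD2l.
  by rewrite ltr_pdivrMr// ltr_pMr// ltr1n orbT.
have tx : t <= x.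
  apply: ub_le_sup; first exact: hA.2.
  by split => //; rewrite tb (le_trans ax xt).
suff -> : b = t by [].
apply/eqP; rewrite eq_le tb andbT.
move: tx; rewrite /t ge_min => /orP[bx|]; first by rewrite le_min lexx /= (le_trans bx)// lerDl divr_ge0// ltW.
by rewrite gerDl leNgt divr_gt0.
Qed.

(** Straddle estimate: [s] and [t] lie on opposite sides of [x], so the linearization errors
    [e * (x - s)] and [e * (t - x)] at [x] add up to [e * (t - s)]. *)
Lemma ge0_is_derive_local F x v e : 0 <= v -> is_derive x 1 F v -> 0 < e ->
  exists2 r, 0 < r & forall s t, s <= x -> x <= t -> x - r < s -> t < x + r ->
    - e * (t - s) <= F t - F s.
Proof.
move=> v0 [dF vE] e0.
have dq : h^-1 *: ((F \o shift x) h%:A - F x) @[h --> 0^'] --> v.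
  by rewrite -vE /derive; exact: dF.
have /cvgrPdist_lt /(_ _ e0) := dq.
rewrite near_withinE => /nbhs_ballP[r /= r0 H].
have Hle h : `|h| < r -> `|F (x + h) - F x - v * h| <= e * `|h|.
  move=> hr; have [->|h0] := eqVneq h 0.
    by rewrite addr0 subrr mulr0 subr0 normr0 mulr0.
  have := H h; rewrite /ball /= sub0r normrN => /(_ hr h0).
  rewrite /= (_ : h%:A = h); last by rewrite /GRing.scale/= mulr1.
  rewrite /GRing.scale/= addrC (addrC h) => /ltW Hh.
  have -> : F (x + h) - F x - v * h = - (h * (v - h^-1 * (F (x + h) - F x))).
    by field.
  rewrite normrN normrM mulrC; apply: ler_wpM2r => //.
  by move: Hh; rewrite (addrC (- _)).
exists r => // s t sx xt xrs txr.
have h1 : `|t - x| < r by rewrite ger0_norm ?subr_ge0// ltrBlDl.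
have h2 : `|s - x| < r by rewrite ler0_norm ?subr_le0// opprB; lra.
have := Hle _ h1; have := Hle _ h2.
rewrite ![x + _]addrC !subrK.
rewrite (@ger0_norm _ (t - x)) ?subr_ge0// (@ler0_norm _ (s - x)) ?subr_le0//.
rewrite !ler_norml => /andP[A1 A2] /andP[A3 A4].
have : 0 <= v * (t - s) by apply: mulr_ge0 => //; lra.
nra.
Qed.

(* Only finitely many of the small intervals met on the way from [a] to [b]
   surround a point of the exceptional null set; those sit in an open set of
   small measure, where [f] cannot vary much while [M] can only increase. *)
Lemma ac_add_nondecreasing_le a b f M : a <= b -> ac a b f ->
  (forall x y, a <= x -> x <= y -> y <= b -> M x <= M y) ->
  {ae leb, forall x, a < x < b -> exists2 v, 0 <= v & is_derive x 1 (f \+ M) v} ->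
  f a + M a <= f b + M b.
Proof.
move=> ab acf ndM [N [mN N0 HN]].
apply/ler_addgt0Pr => e0 e0gt.
pose e := e0 / (b - a + 1).
have e_gt0 : 0 < e by rewrite divr_gt0// ltr_wpDl// subr_ge0.
have eE : e * (b - a) + e = e0.
  by rewrite /e -{2}[e0 / _]mulr1 -mulrDr divfK// gt_eqF// ltr_wpDl// subr_ge0.
have [d d0 Hd] := acf e e_gt0.
(* The end points join the exceptional set, since the derivative is only given inside the
   interval. *)
have mN2 : measurable (N `|` [set a; b]).
  by apply: measurableU => //; apply: measurableU; exact: measurable_set1.
have N20 : leb (N `|` [set a; b]) = 0%E.
  rewrite measureU0//; first by apply: measurableU; exact: measurable_set1.
  exact/countable_lebesgue_measure0/finite_set_countable/finite_set2.
have Nfin : (leb (N `|` [set a; b]) < +oo)%E by rewrite N20.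
have [W [oW NW Wd]] := lebesgue_regularity_outer mN2 Nfin d0.
have mW : measurable W by exact: measurable_realfun.open_measurable.
have {}Wd : (leb W < d%:E)%E.
  have -> : W = (W `\` (N `|` [set a; b])) `|` (N `|` [set a; b]).
    by rewrite setUC setDUK.
  by rewrite measureU0//; exact: measurableD.
have leW (A B : set R) : measurable A -> measurable B -> A `<=` B ->
    (leb A <= leb B)%E.
  by move=> mA mB AB; apply: le_measure => //; rewrite inE.
(* Between [a] and [c] the sum drops by at most [e] times the length plus the variation of [f] over
   the intervals around exceptional points. The total length of these is charged to the part of [W]
   up to [c], which keeps it below [d] at the end. *)
pose S c := exists n (s t : nat -> R),
  [/\ forall i, (i < n)%N -> a <= s i /\ s i <= t i /\ t i <= c,
      forall i, (i.+1 < n)%N -> t i <= s i.+1,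
      ((\sum_(i < n) (t i - s i))%:E <= leb (W `&` `]a, c]))%E &
      - e * (c - a) - \sum_(i < n) `|f (t i) - f (s i)| <= f c + M c - (f a + M a)].
suff [n [s [t [H1 H2 H3 H4]]]] : S b.
  have lt_d : \sum_(i < n) (t i - s i) < d.
    rewrite -lte_fin; apply: (le_lt_trans H3); apply: le_lt_trans Wd.
    by apply: leW => //; exact: measurableI.
  have := Hd n s t H1 H2 lt_d; lra.
apply: (@real_induction a b) => //.
  exists 0%N, (fun=> 0), (fun=> 0); split => //; first by rewrite big_ord0 measure_ge0.
  by rewrite big_ord0 !subrr mulr0 subr0.
move=> x ax xb.
have [Nx|Nx] := pselect ((N `|` [set a; b]) x).
- have := NW _ Nx; move/(oW _)/nbhs_ballP => [r /= r0 Hr].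
  exists r => // s t as_ sx xt tb xrs txr [n [s' [t' [H1 H2 H3 H4]]]].
  pose u (v : nat -> R) w i := if i == n then w else v i.
  have bigu (G : R -> R -> R) : \sum_(i < n.+1) G (u s' s i) (u t' t i) =
      \sum_(i < n) G (s' i) (t' i) + G s t.
    rewrite big_ord_recr /= /u eqxx; congr (_ + _); apply: eq_bigr => i _.
    by rewrite !ltn_eqF.
  exists n.+1, (u s' s), (u t' t); split.
  + move=> i; rewrite ltnS leq_eqVlt /u => /orP[/eqP ->|ni].
      by rewrite eqxx; split => //; split => //; exact: le_trans xt.
    rewrite ltn_eqF//; have [? [? ?]] := H1 _ ni; split => //; split => //.
    by rewrite (le_trans _ xt)// (le_trans _ sx).
  + move=> i; rewrite ltnS /u => ni; rewrite (ltn_eqF ni).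
    move: (ni); rewrite leq_eqVlt => /orP[/eqP <-|ni'].
      by rewrite eqxx; have [? [? ?]] := H1 _ ni.
    by rewrite ltn_eqF//; exact: H2.
  + rewrite (bigu (fun p q => q - p)) EFinD.
    have lebst : leb `]s, t]%classic = (t - s)%:E.
      rewrite lebesgue_measure_itv/= lte_fin; case: ltP => // ts.
      by rewrite (_ : t - s = 0)//; apply/eqP; rewrite subr_eq0 eq_le ts (le_trans sx).
    have -> : W `&` `]a, t] = (W `&` `]a, s]) `|` `]s, t].
      apply/seteqP; split => y /=; rewrite !in_itv/=.
        move=> [Wy /andP[ay yt]]; rewrite ay yt.
        by have [|] := leP y s; [left|right].
      move=> [[Wy /andP[ay ys]]|/andP[sy yt]].
        by split => //; rewrite ay (le_trans ys)// (le_trans sx).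
      split; last by rewrite yt (le_lt_trans as_ sy).
      apply: Hr; rewrite /ball/= ltr_norml; apply/andP; split; lra.
    rewrite measureU//.
    * by apply: leeD => //; rewrite -lebst.
    * exact: measurableI.
    * apply/seteqP; split => y //=; rewrite !in_itv/= => -[[_ /andP[_ ys]] /andP[sy _]].
      by move: sy; rewrite ltNge ys.
  + rewrite (bigu (fun p q => `|f q - f p|)).
    have := ndM s t as_ (le_trans sx xt) tb.
    have : e * (s - a) <= e * (t - a) by rewrite ler_pM2l// lerD2r (le_trans sx).
    have := ler_norm (f s - f t); rewrite distrC.
    lra.
- have axb : a < x < b.
    by rewrite !lt_neqAle ax xb !andbT; apply/andP; split; apply/eqP => xE; apply: Nx; right;
      [left|right].
  have : ~ ~ exists2 v : R, 0 <= v & is_derive x 1 (f \+ M) v.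
    by move=> H; apply: Nx; left; apply: HN => /= /(_ axb).
  move/contrapT => [v v0 dv].
  have [r r0 Hr] := ge0_is_derive_local v0 dv e_gt0.
  exists r => // s t as_ sx xt tb xrs txr [n [s' [t' [H1 H2 H3 H4]]]].
  exists n, s', t'; split => //.
  + move=> i ni; have [? [? ?]] := H1 _ ni; split => //; split => //.
    by rewrite (le_trans _ xt)// (le_trans _ sx).
  + apply: (le_trans H3); apply: leW; [exact: measurableI|exact: measurableI|].
    apply: setIS => y /=; rewrite !in_itv/= => /andP[-> ys].
    by rewrite (le_trans ys)// (le_trans sx).
  + have := Hr s t sx xt xrs txr; rewrite /=; lra.
Qed.

Lemma ac_unif a b f e : ac a b f -> 0 < e -> exists2 d, 0 < d &
  forall s t, a <= s -> s <= t -> t <= b -> t - s < d -> `|f t - f s| < e.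
Proof.
move=> acf e0; have [d d0 Hd] := acf e e0; exists d => // s t as_ st tb std.
have := Hd 1%N (fun=> s) (fun=> t); rewrite !big_ord1; apply => //.
Qed.

Lemma ac_bounded a b f : a <= b -> ac a b f ->
  exists2 B, 0 <= B & forall x, a <= x -> x <= b -> `|f x| <= B.
Proof.
move=> ab acf; have [d d0 Hd] := ac_unif acf ltr01.
pose S c := exists2 B, 0 <= B & forall x, a <= x -> x <= c -> `|f x| <= B.
apply: (@real_induction a b S) => //.
  exists `|f a| => // x ax xa; suff -> : x = a by [].
  by apply/eqP; rewrite eq_le ax xa.
move=> x ax xb; exists (d / 2); first by rewrite divr_gt0.
move=> s t as_ sx xt tb xds txd [B B0 HB]; exists (B + 1); first by rewrite addr_ge0.
move=> y ay yt; have [ys|sy] := leP y s; first by rewrite (le_trans (HB _ ay ys))// lerDl.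
have ysd : y - s < d.
  rewrite [d]splitr; apply: (@le_lt_trans _ _ (t - s)); first by rewrite lerD2r.
  by move: xds txd; lra.
have := Hd s y as_ (ltW sy) (le_trans yt tb) ysd.
have := HB _ as_ (lexx s); have := ler_normD (f y - f s) (f s); rewrite subrK.
lra.
Qed.

Lemma ac_dominated2 a b f g h C : 0 <= C -> ac a b f -> ac a b g ->
  (forall s t, a <= s -> s <= t -> t <= b ->
    `|h t - h s| <= C * (`|f t - f s| + `|g t - g s|)) ->
  ac a b h.
Proof.
move=> C0 acf acg H e e0.
pose e1 := e / (2 * (C + 1)).
have C1 : 0 < C + 1 by rewrite ltr_wpDl.
have e10 : 0 < e1 by rewrite divr_gt0// mulr_gt0.
have [d1 d10 H1] := acf _ e10; have [d2 d20 H2] := acg _ e10.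
exists (Num.min d1 d2); first by rewrite lt_min d10.
move=> n s t st ord; rewrite lt_min => /andP[l1 l2].
have {H1 l1} := H1 n s t st ord l1; have {H2 l2} := H2 n s t st ord l2 => l1 l2.
apply: (@le_lt_trans _ _ ((C + 1) * (\sum_(i < n) `|f (t i) - f (s i)| +
    \sum_(i < n) `|g (t i) - g (s i)|))).
  rewrite -big_split/= mulr_sumr; apply: ler_sum => i _.
  have [? [? ?]] := st i (ltn_ord i).
  apply: le_trans (H _ _ _ _ _) _ => //.
  by apply: ler_wpM2r; rewrite ?addr_ge0// lerDl.
have -> : e = (C + 1) * (e1 + e1).
  by rewrite /e1; field; rewrite gt_eqF.
by rewrite ltr_pM2l// ltrD.
Qed.

Lemma acD a b f g : ac a b f -> ac a b g -> ac a b (fun x => f x + g x).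
Proof.
move=> acf acg; apply: (ac_dominated2 ler01 acf acg) => s t _ _ _.
by rewrite mul1r opprD addrACA ler_normD.
Qed.

Lemma acM a b f g : a <= b -> ac a b f -> ac a b g -> ac a b (fun x => f x * g x).
Proof.
move=> ab acf acg.
have [B1 B10 H1] := ac_bounded ab acf; have [B2 B20 H2] := ac_bounded ab acg.
apply: (ac_dominated2 (addr_ge0 B10 B20) acf acg) => s t as_ st tb.
have -> : f t * g t - f s * g s = (f t - f s) * g t + f s * (g t - g s) by ring.
apply: (le_trans (ler_normD _ _)); rewrite !normrM.
have h1 := H1 _ as_ (le_trans st tb); have h2 := H2 _ (le_trans as_ st) tb.
rewrite mulrDr; apply: lerD.
  by rewrite mulrC; apply: ler_wpM2r => //; rewrite ler_wpDl.
by apply: ler_wpM2r => //; rewrite ler_wpDr.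
Qed.

Lemma acV a b f m : 0 < m -> ac a b f -> (forall x, a <= x -> x <= b -> m <= f x) ->
  ac a b (fun x => (f x)^-1).
Proof.
move=> m0 acf mf; have m20 : 0 <= (m * m)^-1 by rewrite invr_ge0 mulr_ge0// ltW.
apply: (ac_dominated2 m20 acf acf) => s t as_ st tb.
have ms := mf _ as_ (le_trans st tb); have mt := mf _ (le_trans as_ st) tb.
have fs0 := lt_le_trans m0 ms; have ft0 := lt_le_trans m0 mt.
have -> : (f t)^-1 - (f s)^-1 = (f s * f t)^-1 * (f s - f t).
  by field; rewrite !gt_eqF.
have le1 : (f s * f t)^-1 <= (m * m)^-1.
  by rewrite lef_pV2 ?posrE ?mulr_gt0// ler_pM// ltW.
have ge1 : 0 <= (f s * f t)^-1 by rewrite invr_ge0 mulr_ge0// ltW.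
rewrite normrM distrC (ger0_norm ge1); apply: ler_pM => //.
by rewrite lerDl.
Qed.

Lemma ac_lipschitz a b f C : (forall s t, a <= s -> s <= t -> t <= b ->
  `|f t - f s| <= C * (t - s)) -> ac a b f.
Proof.
move=> H.
have acid : ac a b id.
  move=> e e0; exists e => // n s t st ord; apply: le_lt_trans.
  by apply: ler_sum => i _; have [_ [? _]] := st i (ltn_ord i); rewrite ger0_norm// subr_ge0.
apply: (ac_dominated2 (normr_ge0 C) acid acid) => s t as_ st tb.
apply: (le_trans (H _ _ as_ st tb)); rewrite (ger0_norm (_ : 0 <= t - s)) ?subr_ge0//.
have t0 : 0 <= t - s by rewrite subr_ge0.
have := ler_norm C; have := normr_ge0 C; nra.
Qed.

Lemma lipschitz_is_derive a b f f' C :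
  (forall x, a <= x -> x <= b -> is_derive x 1 f (f' x)) ->
  (forall x, a <= x -> x <= b -> `|f' x| <= C) ->
  forall s t, a <= s -> s <= t -> t <= b -> `|f t - f s| <= C * (t - s).
Proof.
move=> df fC s t as_ st tb.
have H x : x \in `[s, t]%R -> is_derive x 1 f (f' x).
  by rewrite in_itv/= => /andP[sx xt]; apply: df; [exact: le_trans sx|exact: le_trans tb].
have cf : {within `[s, t], continuous f}.
  apply: derivable_within_continuous => x xst.
  by have [] := H x xst.
have [c cst ->] := MVT_segment st (fun x xst => H x (subset_itv_oo_cc xst)) cf.
move: cst; rewrite in_itv/= => /andP[sc ct].
rewrite normrM (ger0_norm (_ : 0 <= t - s)) ?subr_ge0//.
by rewrite ler_wpM2r ?subr_ge0// fC// (le_trans as_ sc, le_trans ct tb).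
Qed.

Lemma ac_C1 a b f f' C :
  (forall x, a <= x -> x <= b -> is_derive x 1 f (f' x)) ->
  (forall x, a <= x -> x <= b -> `|f' x| <= C) -> ac a b f.
Proof. by move=> df fC; apply: ac_lipschitz; exact: lipschitz_is_derive df fC. Qed.

Lemma is_derive_mul f g x a b : is_derive x 1 f a -> is_derive x 1 g b ->
  is_derive x 1 (fun y => f y * g y) (a * g x + f x * b).
Proof.
move=> df dg; have -> : a * g x + f x * b = f x *: b + g x *: a.
  by rewrite /GRing.scale/=; ring.
exact: is_deriveM.
Qed.

Lemma is_derive_add f g x a b : is_derive x 1 f a -> is_derive x 1 g b ->
  is_derive x 1 (fun y => f y + g y) (a + b).
Proof. exact: is_deriveD. Qed.

Lemma is_derive_mulc f x a c : is_derive x 1 f a ->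
  is_derive x 1 (fun y => c * f y) (c * a).
Proof.
move=> df; have -> : (fun y => c * f y) = c \*: f by apply/funext.
exact: is_deriveZ.
Qed.

Lemma is_derive_expR_lin (k c x : R) :
  is_derive x 1 (fun y => expR (k * (y - c))) (k * expR (k * (x - c))).
Proof.
have -> : (fun y => expR (k * (y - c))) = expR \o (fun y => k * (y - c)) by [].
apply: is_derive_eq.
by rewrite subr0 /GRing.scale/= mulr1 mulrC.
Qed.

Lemma ac_expR_lin k c a b : ac a b (fun y => expR (k * (y - c))).
Proof.
apply: (@ac_C1 _ _ _ (fun x => k * expR (k * (x - c))) (`|k| * expR (`|k| * (`|a - c| + `|b - c|)))).
  by move=> x _ _; exact: is_derive_expR_lin.
move=> x ax xb; rewrite normrM ler_wpM2l// ger0_norm ?expR_ge0// ler_expR.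
apply: (le_trans (ler_norm _)); rewrite normrM ler_wpM2l//.
by rewrite ler_norml; apply/andP; split;
  have := ler_norm (a - c); have := ler_norm (- (a - c)); rewrite normrN;
  have := ler_norm (b - c); have := ler_norm (- (b - c)); rewrite normrN;
  have := normr_ge0 (a - c); have := normr_ge0 (b - c); lra.
Qed.

(** The two directions use the integrating factors [expR (- k * (x - b))] and [expR (k * (x - a))].
    Both are at most [expR (k * (b - a))], which is why [M] is multiplied by this constant. As [M]
    is only monotone, its growth may exceed the integral of its derivative; this helps in both
    inequalities. *)
Lemma gronwall a b k (G M : R -> R) : a <= b -> 0 <= k -> ac a b G ->
  (forall x y, a <= x -> x <= y -> y <= b -> M x <= M y) ->
  {ae leb, forall x, a < x < b -> exists g' m' : R,
     [/\ is_derive x 1 G g', is_derive x 1 M m', 0 <= m' & `|g'| <= k * G x + m']} ->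
  G b <= expR (k * (b - a)) * (G a + (M b - M a)) /\
  G a <= expR (k * (b - a)) * (G b + (M b - M a)).
Proof.
move=> ab k0 acG ndM H.
have e0 := expR_gt0 (k * (b - a)).
have ndeM x y : a <= x -> x <= y -> y <= b ->
    expR (k * (b - a)) * M x <= expR (k * (b - a)) * M y.
  by move=> ax xy yb; rewrite ler_pM2l//; exact: ndM.
have acN : ac a b (fun y => - 1 * G y).
  apply: acM => //; apply: (@ac_lipschitz _ _ _ 0) => *; by rewrite subrr normr0 mul0r.
split.
- have := @ac_add_nondecreasing_le a b (fun y => (-1 * G y) * expR ((- k) * (y - b)))
    (fun y => expR (k * (b - a)) * M y) ab (acM ab acN (ac_expR_lin _ _ _ _)) ndeM.
  rewrite subrr mulr0 expR0.
  have -> : - k * (a - b) = k * (b - a) by ring.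
  move=> F; have {}F : -1 * G a * expR (k * (b - a)) + expR (k * (b - a)) * M a <=
    -1 * G b * 1 + expR (k * (b - a)) * M b; last by nra.
  apply: F; apply: (ae_imp H) => x Hx axb; have {Hx} [g' [m' [dG dM m0 gm]]] := Hx axb.
  exists ((- 1 * g') * expR (- k * (x - b)) + (- 1 * G x) * (- k * expR (- k * (x - b))) +
     expR (k * (b - a)) * m').
    have le : expR (- k * (x - b)) <= expR (k * (b - a)).
      by rewrite ler_expR; move/andP: axb => [ax xb]; nra.
    have := expR_gt0 (- k * (x - b)); move: gm; rewrite ler_norml => /andP[].
    set u := expR (- k * (x - b)) in le *; set v := expR _ in le *. move=> h1 h2 u0.
    have : m' * u <= m' * v by apply: ler_wpM2l.
    have : g' * u <= (k * G x + m') * u by rewrite ler_pM2r.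
    lra.
  apply: (is_derive_add (is_derive_mul (is_derive_mulc (-1) dG)
    (is_derive_expR_lin (- k) b x)) (is_derive_mulc _ dM)).
- have := @ac_add_nondecreasing_le a b (fun y => G y * expR (k * (y - a)))
    (fun y => expR (k * (b - a)) * M y) ab (acM ab acG (ac_expR_lin _ _ _ _)) ndeM.
  rewrite subrr mulr0 expR0.
  move=> F; have {}F : G a * 1 + expR (k * (b - a)) * M a <=
    G b * expR (k * (b - a)) + expR (k * (b - a)) * M b; last by nra.
  apply: F; apply: (ae_imp H) => x Hx axb; have {Hx} [g' [m' [dG dM m0 gm]]] := Hx axb.
  exists (g' * expR (k * (x - a)) + G x * (k * expR (k * (x - a))) +
     expR (k * (b - a)) * m').
    have le : expR (k * (x - a)) <= expR (k * (b - a)).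
      by rewrite ler_expR; move/andP: axb => [ax xb]; nra.
    have := expR_gt0 (k * (x - a)); move: gm; rewrite ler_norml => /andP[].
    set u := expR (k * (x - a)) in le *; set v := expR _ in le *. move=> h1 h2 u0.
    have : m' * u <= m' * v by apply: ler_wpM2l.
    have : - (k * G x + m') * u <= g' * u by rewrite ler_pM2r.
    lra.
  apply: (is_derive_add (is_derive_mul dG (is_derive_expR_lin k a x)) (is_derive_mulc _ dM)).
Qed.

End AbsoluteContinuity.

(** * The conserved energy *)

Lemma sqr_sum_le_norm (R : realType) (y z P : R) : 0 <= P -> y ^+ 2 + z ^+ 2 <= P ^+ 2 ->
  `|y| <= P /\ `|z| <= P.
Proof.
move=> P0 h; split; rewrite -ler_sqr ?nnegrE// real_normK ?num_real//; apply: le_trans h.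
  by rewrite lerDl sqr_ge0.
by rewrite lerDr sqr_ge0.
Qed.

Section EnergyEstimate.
Context {R : realType}.
Local Notation leb := (@lebesgue_measure R).

Definition energy_num (P Y1 Y2 K1 K2 : R) : R :=
  (1 + (K1 ^+ 2 + K2 ^+ 2)) * P - 2 * (K1 * Y1 + K2 * Y2).

Definition energy (P Y1 Y2 K1 K2 : R) : R :=
  energy_num P Y1 Y2 K1 K2 * (1 - (K1 ^+ 2 + K2 ^+ 2))^-1.

Lemma energy0 (P Y1 Y2 : R) : energy P Y1 Y2 0 0 = P.
Proof. by rewrite /energy /energy_num; field. Qed.

(** This is the arithmetic-geometric mean inequality, written as [(2 * K1 * P - Y1) ^+ 2 >= 0] and
    likewise for [K2] to avoid square roots. A factor [P] has to be cancelled, hence the separate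
    case [P = 0]. *)
Lemma dot_le_half (P Y1 Y2 K1 K2 : R) : 0 <= P -> Y1 ^+ 2 + Y2 ^+ 2 <= P ^+ 2 ->
  K1 ^+ 2 + K2 ^+ 2 <= 1 / 4 -> 2 * (K1 * Y1 + K2 * Y2) <= (2 * (K1 ^+ 2 + K2 ^+ 2) + 1 / 2) * P.
Proof.
move=> P0 YP K4.
have [P_gt0|] := ltP 0 P; last first.
  move=> Pn; have P00 : P = 0 by apply/eqP; rewrite eq_le Pn.
  rewrite P00 mulr0 in YP *.
  have Y10 : Y1 = 0 by nra.
  have Y20 : Y2 = 0 by nra.
  by rewrite Y10 Y20 !mulr0 addr0 mulr0.
rewrite -(ler_pM2r P_gt0).
have h1 : 0 <= (2 * K1 * P - Y1) ^+ 2 by exact: sqr_ge0.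
have h2 : 0 <= (2 * K2 * P - Y2) ^+ 2 by exact: sqr_ge0.
nra.
Qed.

Lemma energy_num_bounds (P Y1 Y2 K1 K2 : R) : 0 <= P -> Y1 ^+ 2 + Y2 ^+ 2 <= P ^+ 2 ->
  K1 ^+ 2 + K2 ^+ 2 <= 1 / 4 ->
  P / 4 <= energy_num P Y1 Y2 K1 K2 /\ energy_num P Y1 Y2 K1 K2 <= 3 * P.
Proof.
move=> P0 YP K4.
have h1 := dot_le_half P0 YP K4.
have h2 : 2 * (- K1 * Y1 + - K2 * Y2) <= (2 * (K1 ^+ 2 + K2 ^+ 2) + 1 / 2) * P.
  by have := @dot_le_half P Y1 Y2 (- K1) (- K2) P0 YP; rewrite !sqrrN; apply.
have h3 : 0 <= (1 / 4 - (K1 ^+ 2 + K2 ^+ 2)) * P by apply: mulr_ge0 => //; lra.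
have h4 : 0 <= (K1 ^+ 2 + K2 ^+ 2) * P by apply: mulr_ge0 => //; nra.
by rewrite /energy_num; split; nra.
Qed.

Lemma energy_bounds (P Y1 Y2 K1 K2 : R) : 0 <= P -> Y1 ^+ 2 + Y2 ^+ 2 <= P ^+ 2 ->
  K1 ^+ 2 + K2 ^+ 2 <= 1 / 4 ->
  P <= 4 * energy P Y1 Y2 K1 K2 /\ energy P Y1 Y2 K1 K2 <= 4 * P.
Proof.
move=> P0 YP K4; have [h1 h2] := energy_num_bounds P0 YP K4.
have h0 : 0 <= K1 ^+ 2 + K2 ^+ 2 by nra.
rewrite /energy; set D := 1 - _; set N := energy_num _ _ _ _ _ in h1 h2 *.
have D1 : 3 / 4 <= D by rewrite /D; lra.
have D2 : D <= 1 by rewrite /D; lra.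
have D0 : 0 < D by lra.
have N0 : 0 <= N by lra.
split.
  rewrite mulrA ler_pdivlMr//.
  have : P * D <= P by rewrite ler_piMr.
  lra.
by rewrite ler_pdivrMr//; have : P * (3 / 4) <= P * D by [rewrite ler_wpM2l]; lra.
Qed.

Lemma norm_mul_le (x y A B : R) : `|x| <= A -> `|y| <= B -> `|x * y| <= A * B.
Proof. by move=> xA yB; rewrite normrM ler_pM. Qed.

Lemma norm_dot_le (K1 K2 e1 e2 h : R) : `|K1| <= 1 / 2 -> `|K2| <= 1 / 2 -> `|e1| <= h -> `|e2| <= h ->
  `|2 * (K1 * e1 + K2 * e2)| <= 2 * h.
Proof.
move=> k1 k2 h1 h2; have := norm_mul_le k1 h1; have := norm_mul_le k2 h2.
by rewrite !ler_norml => /andP[? ?] /andP[? ?]; apply/andP; split; lra.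
Qed.

Lemma norm_numerator_le (h P t x1 x2 x3 x4 x5 x6 : R) : `|x1| <= h * P -> `|x2| <= h * P ->
  `|x3| <= 1 / 2 * t -> `|x4| <= 1 / 2 * t -> `|x5| <= 2 * h * P -> `|x6| <= 5 / 4 * t ->
  `|x5 + x6 - 2 * (x1 + x3 + (x2 + x4))| <= 6 * h * P + 4 * t.
Proof.
rewrite !ler_norml => /andP[? ?] /andP[? ?] /andP[? ?] /andP[? ?] /andP[? ?] /andP[? ?].
by apply/andP; split; lra.
Qed.

(** The numerator is at most [12 * h * P + 4 * t], and dividing by [D ^+ 2 >= 9 / 16] multiplies
    this by at most [16 / 9]; 24 and 10 are rounded up. *)
Lemma norm_quotient_le (h P t D dN N dk : R) : 0 <= h -> 0 <= P -> 0 <= t -> 3 / 4 <= D -> D <= 1 ->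
  `|dN| <= 6 * h * P + 4 * t -> 0 <= N -> N <= 3 * P -> `|dk| <= 2 * h ->
  `|(dN * D + N * dk) / D ^+ 2| <= 24 * h * P + 10 * t.
Proof.
move=> h0 P0 t0 D1 D2 dNh N1 N2 dkh; have D0 : 0 < D by lra.
rewrite normrM (ger0_norm (_ : 0 <= (D ^+ 2)^-1)) ?invr_ge0 ?sqr_ge0//.
rewrite ler_pdivrMr ?exprn_gt0//.
have num : `|dN * D + N * dk| <= 12 * h * P + 4 * t.
  have DD : `|D| <= 1 by rewrite ger0_norm// ltW.
  have NN : `|N| <= 3 * P by rewrite ger0_norm.
  have a1 := norm_mul_le dNh DD; have a2 := norm_mul_le NN dkh.
  by apply: (le_trans (ler_normD _ _)); lra.
apply: (le_trans num); have hP : 0 <= h * P by exact: mulr_ge0.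
have DD : 9 / 16 <= D ^+ 2 by nra.
have : 0 <= (24 * h * P + 10 * t) * (D ^+ 2 - 9 / 16) by apply: mulr_ge0; lra.
lra.
Qed.

(* The energy is conserved exactly when [K] solves the Riccati equation
   [K' = - 2 i E K + m - conj m K^2]. *)
Lemma energy_derivative_bound (E P Y1 Y2 K1 K2 m1 m2 e1 e2 r0 r1 r2 h t : R) :
  let k' := 2 * (K1 * (2 * E * K2 + m1 - (m1 * (K1 ^+ 2 - K2 ^+ 2) + m2 * (2 * K1 * K2)) + e1) +
    K2 * (- 2 * E * K1 + m2 - (m1 * (2 * K1 * K2) - m2 * (K1 ^+ 2 - K2 ^+ 2)) + e2)) in
  let N' := k' * P + (1 + (K1 ^+ 2 + K2 ^+ 2)) * (2 * (m1 * Y1 + m2 * Y2) + r0) -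
    2 * (((2 * E * K2 + m1 - (m1 * (K1 ^+ 2 - K2 ^+ 2) + m2 * (2 * K1 * K2)) + e1) * Y1 +
          K1 * (2 * E * Y2 + 2 * m1 * P + r1)) +
         ((- 2 * E * K1 + m2 - (m1 * (2 * K1 * K2) - m2 * (K1 ^+ 2 - K2 ^+ 2)) + e2) * Y2 +
          K2 * (- 2 * E * Y1 + 2 * m2 * P + r2))) in
  let D := 1 - (K1 ^+ 2 + K2 ^+ 2) in
  0 <= P -> Y1 ^+ 2 + Y2 ^+ 2 <= P ^+ 2 -> K1 ^+ 2 + K2 ^+ 2 <= 1 / 4 ->
  `|e1| <= h -> `|e2| <= h -> `|r0| <= t -> `|r1| <= t -> `|r2| <= t ->
  `|N' * D^-1 + energy_num P Y1 Y2 K1 K2 * (k' / D ^+ 2)| <= 24 * h * P + 10 * t.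
Proof.
move=> k' N' D P0 YP K4 e1h e2h r0t r1t r2t.
have [N1 N2] := energy_num_bounds P0 YP K4.
have D1 : 3 / 4 <= D by rewrite /D; lra.
have D2 : D <= 1 by rewrite /D; nra.
have D0 : 0 < D by lra.
pose dk := 2 * (K1 * e1 + K2 * e2).
pose dN := dk * P + (1 + (K1 ^+ 2 + K2 ^+ 2)) * r0 - 2 * (e1 * Y1 + K1 * r1 + (e2 * Y2 + K2 * r2)).
have -> : N' * D^-1 + energy_num P Y1 Y2 K1 K2 * (k' / D ^+ 2) =
    (dN * D + energy_num P Y1 Y2 K1 K2 * dk) / D ^+ 2.
  rewrite /N' /k' /dN /dk /energy_num /D; field.
  by rewrite gt_eqF// -/D.
set N := energy_num _ _ _ _ _ in N1 N2 *.
have [K1h K2h] : `|K1| <= 1 / 2 /\ `|K2| <= 1 / 2.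
  by apply: sqr_sum_le_norm => //; apply: (le_trans K4); rewrite expr2; lra.
have [Y1P Y2P] := sqr_sum_le_norm P0 YP.
have h0 : 0 <= h by exact: le_trans e1h.
have t0 : 0 <= t by exact: le_trans r0t.
have dkh : `|dk| <= 2 * h by exact: norm_dot_le.
have dNh : `|dN| <= 6 * h * P + 4 * t.
  have a1 := norm_mul_le e1h Y1P; have a2 := norm_mul_le e2h Y2P.
  have a3 := norm_mul_le K1h r1t; have a4 := norm_mul_le K2h r2t.
  have PP : `|P| <= P by rewrite ger0_norm.
  have a5 := norm_mul_le dkh PP.
  have a6 : `|(1 + (K1 ^+ 2 + K2 ^+ 2)) * r0| <= 5 / 4 * t.
    by apply: norm_mul_le => //; rewrite ger0_norm ?addr_ge0 ?sqr_ge0//; lra.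
  exact: norm_numerator_le.
have N0 : 0 <= N by apply: le_trans N1; rewrite divr_ge0.
exact: norm_quotient_le.
Qed.

Section Step.
Context (a b E eta mu B : R) (P Y1 Y2 K1 K2 m1 m2 e1 e2 M : R -> R).
Context (ab : a <= b) (eta0 : 0 <= eta) (mu0 : 0 <= mu).
Context (acP : ac a b P) (acY1 : ac a b Y1) (acY2 : ac a b Y2).
Context (P0 : forall x, a <= x <= b -> 0 <= P x).
Context (YP : forall x, a <= x <= b -> (Y1 x) ^+ 2 + (Y2 x) ^+ 2 <= (P x) ^+ 2).
Context (K4 : forall x, a <= x <= b -> (K1 x) ^+ 2 + (K2 x) ^+ 2 <= 1 / 4).
Context (dK1 : forall x, a <= x <= b -> is_derive x 1 K1
  (2 * E * K2 x + m1 x - (m1 x * (K1 x ^+ 2 - K2 x ^+ 2) + m2 x * (2 * K1 x * K2 x)) + e1 x)).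
Context (dK2 : forall x, a <= x <= b -> is_derive x 1 K2
  (- 2 * E * K1 x + m2 x - (m1 x * (2 * K1 x * K2 x) - m2 x * (K1 x ^+ 2 - K2 x ^+ 2)) + e2 x)).
Context (eh : forall x, a <= x <= b -> `|e1 x| <= eta /\ `|e2 x| <= eta).
Context (mB : forall x, a <= x <= b -> `|m1 x| <= B /\ `|m2 x| <= B).
Context (ndM : forall x y, a <= x -> x <= y -> y <= b -> M x <= M y).
Context (HP : {ae leb, forall x, a < x < b -> exists p' y1' y2' nu : R,
  [/\ [/\ is_derive x 1 P p', is_derive x 1 Y1 y1', is_derive x 1 Y2 y2' & is_derive x 1 M nu],
      0 <= nu,
      `|p' - 2 * (m1 x * Y1 x + m2 x * Y2 x)| <= mu * P x + nu,
      `|y1' - (2 * E * Y2 x + 2 * m1 x * P x)| <= mu * P x + nu &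
      `|y2' - (- 2 * E * Y1 x + 2 * m2 x * P x)| <= mu * P x + nu]}).

Let G x := energy (P x) (Y1 x) (Y2 x) (K1 x) (K2 x).

(** The derivative of [G] is at most [24 * eta * P + 10 * (mu * P + nu)] in absolute value.
    Inserting [P <= 4 * G] gives the rate [96 * eta + 40 * mu] of the Gronwall estimate, with
    forcing [10 * M]. *)
Lemma energy_step :
  G b <= expR ((96 * eta + 40 * mu) * (b - a)) * (G a + (10 * M b - 10 * M a)) /\
  G a <= expR ((96 * eta + 40 * mu) * (b - a)) * (G b + (10 * M b - 10 * M a)).
Proof.
have Kh x : a <= x <= b -> `|K1 x| <= 1 / 2 /\ `|K2 x| <= 1 / 2.
  by move=> /K4 k; split; rewrite ler_norml; apply/andP; split; nra.
have B0 : 0 <= B.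
  have aab : a <= a <= b by rewrite lexx.
  by have [h _] := mB aab; exact: le_trans h.
have Kl (z : R) (x : R) : a <= x <= b -> `|z| <= eta -> 
  forall m n A C : R, `|m| <= B -> `|n| <= B -> `|A| <= 1 -> `|C| <= 1 ->
  forall u : R, `|u| <= 1 / 2 ->
  `|2 * E * u + m - (m * A + n * C) + z| <= `|E| + 3 * B + eta.
  move=> axb ze m n A C mB' nB A1 C1 u uh.
  have n2 : `|(2 : R)| = 2 by rewrite ger0_norm.
  apply: (le_trans (ler_normD _ _)); apply: lerD => //.
  apply: (le_trans (ler_normB _ _)); have -> : 3 * B = B + 2 * B by lra.
  rewrite addrA; apply: lerD.
    apply: (le_trans (ler_normD _ _)); apply: lerD => //.
    rewrite !normrM n2; have := normr_ge0 E; nra.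
  apply: (le_trans (ler_normD _ _)); rewrite !normrM.
  have := normr_ge0 m; have := normr_ge0 n; have := normr_ge0 A; have := normr_ge0 C; nra.
have Kb x : a <= x <= b -> `|K1 x ^+ 2 - K2 x ^+ 2| <= 1 /\ `|2 * K1 x * K2 x| <= 1.
  move=> axb; have := K4 axb; move=> k4; split; rewrite ler_norml; apply/andP; split; nra.
have acK1 : ac a b K1.
  apply: (@ac_C1 _ _ _ _ (fun x => 2 * E * K2 x + m1 x - (m1 x * (K1 x ^+ 2 - K2 x ^+ 2) + m2 x * (2 * K1 x * K2 x)) + e1 x)
     (`|E| + 3 * B + eta)) => x ax xb; have axb : a <= x <= b by rewrite ax.
    exact: dK1.
  have [? ?] := Kb _ axb; have [? ?] := mB axb; have [? ?] := eh axb; have [? ?] := Kh _ axb.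
  exact: (Kl _ x).
have acK2 : ac a b K2.
  apply: (@ac_C1 _ _ _ _ (fun x => - 2 * E * K1 x + m2 x - (m1 x * (2 * K1 x * K2 x) - m2 x * (K1 x ^+ 2 - K2 x ^+ 2)) + e2 x)
     (`|E| + 3 * B + eta)) => x ax xb; have axb : a <= x <= b by rewrite ax.
    exact: dK2.
  have [? ?] := Kb _ axb; have [? ?] := mB axb; have [? ?] := eh axb; have [? ?] := Kh _ axb.
  have -> : - 2 * E * K1 x + m2 x - (m1 x * (2 * K1 x * K2 x) - m2 x * (K1 x ^+ 2 - K2 x ^+ 2)) + e2 x =
     2 * E * (- K1 x) + m2 x - (m2 x * (- (K1 x ^+ 2 - K2 x ^+ 2)) + m1 x * (2 * K1 x * K2 x)) + e2 x by ring.
  by apply: (Kl _ x) => //; rewrite normrN.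
have acsq f : ac a b f -> ac a b (fun x => f x ^+ 2).
  by move=> acf; have := acM ab acf acf; under eq_fun do rewrite -expr2.
have acc (c : R) : ac a b (fun=> c).
  by apply: (@ac_lipschitz _ _ _ _ 0) => *; rewrite subrr normr0 mul0r.
have acG : ac a b G.
  have ac1 := acD (acc 1) (acD (acsq _ acK1) (acsq _ acK2)).
  have ac2 := acM ab (acc (-2)) (acD (acM ab acK1 acY1) (acM ab acK2 acY2)).
  have ac3 := acD (acc 1) (acM ab (acc (-1)) (acD (acsq _ acK1) (acsq _ acK2))).
  have acN : ac a b (fun y => energy_num (P y) (Y1 y) (Y2 y) (K1 y) (K2 y)).
    by under eq_fun do rewrite /energy_num -mulNr; exact: (acD (acM ab ac1 acP) ac2).
  apply: (acM ab acN); apply: (@acV _ _ _ _ (3 / 4)); first by lra.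
    by under eq_fun do rewrite -mulN1r; exact: ac3.
  by move=> x ax xb; have := @K4 x; rewrite ax xb => /(_ isT); lra.
apply: (@gronwall _ a b _ G (fun x => 10 * M x)) => //.
- by rewrite addr_ge0// mulr_ge0.
- by move=> x y ax xy yb; rewrite ler_pM2l//; exact: ndM.
apply: (ae_imp HP) => x Hx axb.
have {Hx} [p' [y1' [y2' [nu [[dP dY1 dY2 dM] nu0 hp h1 h2]]]]] := Hx axb.
have axb' : a <= x <= b by move/andP: axb => [/ltW -> /ltW].
have Px := P0 axb'; have YPx := YP axb'; have K4x := K4 axb'.
have [e1x e2x] := eh axb'.
pose D y := 1 - (K1 y ^+ 2 + K2 y ^+ 2).
have Dx : 3 / 4 <= D x by rewrite /D; lra.
have Dx0 : D x != 0 by rewrite gt_eqF//; lra.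
have bnd := @energy_derivative_bound E (P x) (Y1 x) (Y2 x) (K1 x) (K2 x) (m1 x) (m2 x)
  (e1 x) (e2 x) _ _ _ eta (mu * P x + nu) Px YPx K4x e1x e2x hp h1 h2.
have dK1x := dK1 axb'; have dK2x := dK2 axb'.
set k1' := (X in is_derive x 1 K1 X) in dK1x bnd *.
set k2' := (X in is_derive x 1 K2 X) in dK2x bnd *.
have dsq (f : R -> R) (f' : R) : is_derive x 1 f f' -> is_derive x 1 (fun y => f y ^+ 2) (2 * (f x * f')).
  move=> df; have := is_derive_mul df df.
  under eq_fun do rewrite -expr2; by have -> : f' * f x + f x * f' = 2 * (f x * f') by ring.
have dkap : is_derive x 1 (fun y => K1 y ^+ 2 + K2 y ^+ 2) (2 * (K1 x * k1') + 2 * (K2 x * k2')).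
  exact: is_derive_add (dsq _ _ dK1x) (dsq _ _ dK2x).
have dcst (c : R) : is_derive x 1 (fun=> c) (0 : R) by exact: is_derive_cst.
have dD : is_derive x 1 D (0 + -1 * (2 * (K1 x * k1') + 2 * (K2 x * k2'))).
  have -> : D = fun y => 1 + -1 * (K1 y ^+ 2 + K2 y ^+ 2) by apply/funext => y; rewrite mulN1r.
  exact: (is_derive_add (dcst 1) (is_derive_mulc (-1) dkap)).
have dDV : is_derive x 1 (fun y => (D y)^-1) (- (D x) ^- 2 *: (0 + -1 * (2 * (K1 x * k1') + 2 * (K2 x * k2')))).
  exact: is_deriveV.
have dN := is_derive_add (is_derive_mul (is_derive_add (dcst 1) dkap) dP)
  (is_derive_mulc (-2) (is_derive_add (is_derive_mul dK1x dY1) (is_derive_mul dK2x dY2))).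
have numE : (fun y => (1 + (K1 y ^+ 2 + K2 y ^+ 2)) * P y + -2 * (K1 y * Y1 y + K2 y * Y2 y)) =
    (fun y => energy_num (P y) (Y1 y) (Y2 y) (K1 y) (K2 y)).
  by apply/funext => y; rewrite /energy_num mulNr.
rewrite numE in dN.
have dG := is_derive_mul dN dDV.
move: dG; set g' := (X in is_derive x 1 _ X) => dG.
exists g', (10 * nu); split; [exact: dG|exact: (is_derive_mulc _ dM)|by rewrite mulr_ge0|].
apply: le_trans (_ : 24 * eta * P x + 10 * (mu * P x + nu) <= _); last first.
  have [PG _] := energy_bounds Px YPx K4x.
  by rewrite -/(G x) in PG; have : eta * P x <= eta * (4 * G x) by [exact: ler_wpM2l];
    have : mu * P x <= mu * (4 * G x) by [exact: ler_wpM2l]; lra.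
move: bnd; congr (`|_| <= _).
rewrite -/(D x) /g' /GRing.scale/=.
have -> : 2 * (m1 x * Y1 x + m2 x * Y2 x) + (p' - 2 * (m1 x * Y1 x + m2 x * Y2 x)) = p' by ring.
have -> : 2 * E * Y2 x + 2 * m1 x * P x + (y1' - (2 * E * Y2 x + 2 * m1 x * P x)) = y1' by ring.
have -> : - 2 * E * Y1 x + 2 * m2 x * P x + (y2' - (- 2 * E * Y1 x + 2 * m2 x * P x)) = y2' by ring.
by rewrite /k1' /k2'; field.
Qed.

End Step.
End EnergyEstimate.

(** * Trees and the approximate Riccati solution *)

Section ComplexCalculus.
Context {R : realType}.
Local Open Scope complex_scope.
Local Notation cmod := (@Normc.normc R).
Implicit Types (z w : R[i]) (f g : R -> R[i]).

Lemma cmodM z w : cmod (z * w) = cmod z * cmod w.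
Proof. exact: Normc.normcM. Qed.

Lemma cmodD z w : cmod (z + w) <= cmod z + cmod w.
Proof. exact: le_normcD. Qed.

Lemma cmodN z : cmod (- z) = cmod z.
Proof. exact: normcN. Qed.

Lemma cmodE z : cmod z = Num.sqrt (complex.Re z ^+ 2 + complex.Im z ^+ 2).
Proof. by case: z. Qed.

Lemma cmod_ge0 z : 0 <= cmod z.
Proof. by rewrite cmodE sqrtr_ge0. Qed.

Lemma cmod0 : cmod 0 = 0.
Proof. exact: Normc.normc0. Qed.

Lemma cmodJ z : cmod (conjc z) = cmod z.
Proof. by rewrite !cmodE; case: z => a b /=; rewrite sqrrN. Qed.

Lemma conjcM z w : conjc (z * w) = conjc z * conjc w.
Proof. exact: rmorphM. Qed.

Lemma cmodR (r : R) : cmod (r%:C) = `|r|.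
Proof. by rewrite cmodE /= expr0n addr0 sqrtr_sqr. Qed.

Lemma cmod_sqr z : cmod z ^+ 2 = complex.Re z ^+ 2 + complex.Im z ^+ 2.
Proof. by rewrite cmodE sqr_sqrtr// addr_ge0// sqr_ge0. Qed.

Lemma cmod_Re z : `|complex.Re z| <= cmod z.
Proof.
rewrite -[`|_|]ger0_norm// -ler_sqr ?nnegrE ?cmod_ge0// ?normr_ge0//.
by rewrite cmod_sqr normr_id real_normK ?num_real// lerDl sqr_ge0.
Qed.

Lemma cmod_Im z : `|complex.Im z| <= cmod z.
Proof.
rewrite -ler_sqr ?nnegrE ?cmod_ge0// cmod_sqr real_normK ?num_real//.
by rewrite lerDr sqr_ge0.
Qed.

Lemma cmod_le z (r : R) : 0 <= r -> complex.Re z ^+ 2 + complex.Im z ^+ 2 <= r ^+ 2 -> cmod z <= r.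
Proof. by move=> r0 h; rewrite -ler_sqr ?nnegrE ?cmod_ge0// cmod_sqr. Qed.

Lemma cmod_sum (I : Type) (s : seq I) (P : pred I) (F : I -> R[i]) :
  cmod (\sum_(i <- s | P i) F i) <= \sum_(i <- s | P i) cmod (F i).
Proof.
elim/big_rec2: _ => [|i x y _ h]; first by rewrite cmod0.
by apply: (le_trans (cmodD _ _)); rewrite lerD2l.
Qed.

Lemma ReM z w : complex.Re (z * w) = complex.Re z * complex.Re w - complex.Im z * complex.Im w.
Proof. by case: z => a b; case: w. Qed.

Lemma ImM z w : complex.Im (z * w) = complex.Re z * complex.Im w + complex.Im z * complex.Re w.
Proof. by case: z => a b; case: w. Qed.

Lemma ReD z w : complex.Re (z + w) = complex.Re z + complex.Re w.
Proof. by case: z => a b; case: w. Qed.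

Lemma ImD z w : complex.Im (z + w) = complex.Im z + complex.Im w.
Proof. by case: z => a b; case: w. Qed.

Lemma ReN z : complex.Re (- z) = - complex.Re z.
Proof. by case: z. Qed.

Lemma ImN z : complex.Im (- z) = - complex.Im z.
Proof. by case: z. Qed.

Definition cderive f (x : R) z : Prop :=
  is_derive x 1 (fun t => complex.Re (f t)) (complex.Re z) /\
  is_derive x 1 (fun t => complex.Im (f t)) (complex.Im z).

Lemma cderiveD f g x z w : cderive f x z -> cderive g x w ->
  cderive (fun t => f t + g t) x (z + w).
Proof.
move=> [f1 f2] [g1 g2]; split.
  by rewrite ReD; under eq_fun do rewrite ReD; exact: is_derive_add f1 g1.
by rewrite ImD; under eq_fun do rewrite ImD; exact: is_derive_add f2 g2.
Qed.

Lemma cderive_cst x z : cderive (fun=> z) x 0.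
Proof. by split; exact: is_derive_cst. Qed.

Lemma cderiveM f g x z w : cderive f x z -> cderive g x w ->
  cderive (fun t => f t * g t) x (z * g x + f x * w).
Proof.
move=> [f1 f2] [g1 g2]; split.
  rewrite ReD !ReM; under eq_fun do rewrite ReM -mulN1r.
  have h := is_derive_add (is_derive_mul f1 g1) (is_derive_mulc (-1) (is_derive_mul f2 g2)).
  by apply: (is_derive_eq h); ring.
rewrite ImD !ImM; under eq_fun do rewrite ImM.
have h := is_derive_add (is_derive_mul f1 g2) (is_derive_mul f2 g1).
by apply: (is_derive_eq h); ring.
Qed.

Lemma cderiveJ f x z : cderive f x z -> cderive (fun t => conjc (f t)) x (conjc z).
Proof.
move=> [f1 f2]; split.
  have -> : complex.Re (conjc z) = complex.Re z by case: z {f1 f2}.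
  have -> : (fun t => complex.Re (conjc (f t))) = (fun t => complex.Re (f t)) by apply/funext => t; case: (f t).
  exact: f1.
have -> : complex.Im (conjc z) = -1 * complex.Im z by case: z {f1 f2} => a b; rewrite mulN1r.
have -> : (fun t => complex.Im (conjc (f t))) = (fun t => -1 * complex.Im (f t)).
  by apply/funext => t; case: (f t) => a b; rewrite mulN1r.
exact: is_derive_mulc.
Qed.

Lemma cderive_sum (I : eqType) (s : seq I) (F : I -> R -> R[i]) (D : I -> R[i]) x :
  (forall i, i \in s -> cderive (F i) x (D i)) ->
  cderive (fun t => \sum_(i <- s) F i t) x (\sum_(i <- s) D i).
Proof.
elim: s => [|i s IH] H.
  by rewrite big_nil; under eq_fun do rewrite big_nil; exact: cderive_cst.
rewrite big_cons; under eq_fun do rewrite big_cons.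
apply: cderiveD; first by apply: H; rewrite mem_head.
by apply: IH => j js; apply: H; rewrite in_cons js orbT.
Qed.

(* [wave a x] is the paper's exp(- i a x). *)
Definition wave (a x : R) : R[i] := cos (a * x) -i* sin (a * x).

Lemma waveD a b x : wave (a + b) x = wave a x * wave b x.
Proof.
rewrite /wave mulrDl cosD sinD; apply/eqP; rewrite eq_complex /=.
by apply/andP; split; apply/eqP; ring.
Qed.

Lemma waveJ a x : conjc (wave a x) = wave (- a) x.
Proof. by rewrite /wave mulNr cosN sinN /= !opprK. Qed.

Lemma cmod_wave a x : cmod (wave a x) = 1.
Proof. by rewrite cmodE /= sqrrN cos2Dsin2 sqrtr1. Qed.

Lemma cderive_wave a x : cderive (wave a) x ((0 -i* a) * wave a x).
Proof.
have dl : is_derive x 1 (fun t : R => a * t) (a * 1).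
  by apply: is_derive_mulc; exact: is_derive_id.
split.
  rewrite ReM /= mul0r sub0r mulrN opprK.
  have -> : (fun t => cos (a * t)) = cos \o (fun t => a * t) by [].
  have h := @is_derive1_comp _ cos (fun t => a * t) x _ _ (is_derive_cos _) dl.
  by apply: (is_derive_eq h); rewrite /GRing.scale/=; ring.
rewrite ImM /= mul0r add0r.
have -> : (fun t => - sin (a * t)) = (fun t => -1 * (sin \o (fun t => a * t)) t).
  by apply/funext => t; rewrite mulN1r.
have h := is_derive_mulc (-1) (@is_derive1_comp _ sin (fun t => a * t) x _ _ (is_derive_sin _) dl).
by apply: (is_derive_eq h); rewrite /GRing.scale/=; ring.
Qed.

End ComplexCalculus.

(* [Node j s t] labels the contribution of [- conj m_j K_s K_t], where [m_j] is
   the [j]-th summand of [i phi], to the Riccati equation. *)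
Inductive tree := Leaf of nat | Node of nat & tree & tree.

(** The embedding into [GenTree.tree] provides the decidable equality that sums over lists of
    distinct trees rely on. *)
Fixpoint tree_code (t : tree) : GenTree.tree nat :=
  match t with
  | Leaf j => GenTree.Leaf j
  | Node j s t => GenTree.Node j [:: tree_code s; tree_code t]
  end.

Fixpoint tree_decode (t : GenTree.tree nat) : option tree :=
  match t with
  | GenTree.Leaf j => Some (Leaf j)
  | GenTree.Node j [:: s; t] =>
      if (tree_decode s, tree_decode t) is (Some s', Some t') then Some (Node j s' t') else None
  | _ => None
  end.

Lemma tree_codeK : pcancel tree_code tree_decode.
Proof. by elim=> //= j s -> t ->. Qed.

HB.instance Definition _ := Countable.copy tree (pcan_type tree_codeK).

Fixpoint labels (t : tree) : seq nat :=
  match t with Leaf j => [:: j] | Node j s t => j :: labels s ++ labels t end.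

Fixpoint subtrees (t : tree) : seq tree :=
  t :: match t with Leaf _ => [::] | Node _ s t => subtrees s ++ subtrees t end.

Definition tsize t := size (labels t).

(** Leaves and inner nodes both carry exactly one label. Hence the coefficient of a tree of size [n]
    has exactly [n] denominators, one for each subtree. *)
Lemma tsize_subtrees t : size (subtrees t) = tsize t.
Proof.
elim: t => //= j s IHs t IHt; rewrite size_cat IHs IHt /tsize /= size_cat//.
Qed.

Lemma tsize_gt0 t : (0 < tsize t)%N. Proof. by case: t. Qed.

Lemma tsize_Node j s t : tsize (Node j s t) = (tsize s + tsize t).+1.
Proof. by rewrite /tsize /= size_cat. Qed.

Lemma tsize_odd t : odd (tsize t).
Proof. by elim: t => [//|j s IHs t IHt]; rewrite tsize_Node /= oddD IHs IHt. Qed.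

(** [h] is fuel and bounds the height. The height of a tree does not exceed its size, so [h = m]
    reaches all trees of size at most [m]. *)
Fixpoint tree_upto (m N h : nat) : seq tree :=
  if h is h'.+1 then
    [seq Leaf j | j <- iota 0 N] ++
    [seq t <- [seq Node j st.1 st.2 | j <- iota 0 N,
         st <- [seq (s, t) | s <- tree_upto m N h', t <- tree_upto m N h']] | (tsize t <= m)%N]
  else [::].

Definition trees m N := tree_upto m N m.

Lemma tree_upto_uniq m N h : uniq (tree_upto m N h).
Proof.
elim: h => //= h IH; rewrite cat_uniq map_inj_uniq ?iota_uniq; last by move=> i j [].
rewrite andTb; apply/andP; split.
  apply/hasPn => x; rewrite mem_filter => /andP[_ /allpairsP[[j [s t]] /= [_ _ ->]]].
  by apply/negP => /mapP[].
apply: filter_uniq; apply: allpairs_uniq; [exact: iota_uniq| |].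
  by apply: allpairs_uniq => // -[a b] [a' b'] _ _ [-> ->].
by move=> [j [s t]] [j' [s' t']] _ _ /= [-> -> ->].
Qed.

Lemma mem_tree_upto_le m N h t : t \in tree_upto m N h -> (0 < m)%N -> (tsize t <= m)%N.
Proof.
case: h => //= h; rewrite mem_cat => /orP[/mapP[j _ ->]//|].
by rewrite mem_filter => /andP[].
Qed.

Lemma mem_tree_upto m N h t : (tsize t <= h)%N ->
  (t \in tree_upto m N h) = ((tsize t == 1)%N || (tsize t <= m)%N) && all (fun j => j < N)%N (labels t).
Proof.
elim: h t => [|h IH] t; first by rewrite leqn0 => /eqP tt; have := tsize_gt0 t; rewrite tt.
case: t => [j|j s t] th /=; rewrite mem_cat mem_filter.
  rewrite andbT mem_map ?mem_iota ?add0n /=; last by move=> ? ? [].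
  rewrite (_ : (Leaf j \in _) = false) ?andbF ?orbF//.
  by apply/negP => /allpairsP[[? [? ?]] [_ _]].
have -> : (Node j s t \in [seq Leaf i | i <- iota 0 N]) = false by apply/negP => /mapP[].
rewrite orFb tsize_Node.
have -> : ((tsize s + tsize t).+1 == 1)%N = false by have := tsize_gt0 s; case: (tsize s).
rewrite orFb; have [stm|] := leqP _ m => //=.
have sm : (tsize s <= m)%N by rewrite (leq_trans _ stm)// leqW// leq_addr.
have tm : (tsize t <= m)%N by rewrite (leq_trans _ stm)// leqW// leq_addl.
move: th; rewrite tsize_Node ltnS => sth.
have := IH s (leq_trans (leq_addr _ _) sth); have := IH t (leq_trans (leq_addl _ _) sth).
rewrite sm tm !orbT /= => Ht Hs.
rewrite all_cat -Hs -Ht; apply/allpairsP/idP => [[[j' [s' t']] /= [jN /allpairsP[[s2 t2] /= [s2h t2h [-> ->]]] [-> -> ->]]]|].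
  by move: jN; rewrite mem_iota /= add0n => ->; rewrite s2h t2h.
move=> /and3P[jN sh th]; exists (j, (s, t)); split => //=; first by rewrite mem_iota /= add0n.
by apply/allpairsP; exists (s, t).
Qed.

Lemma mem_trees m N t : (0 < m)%N ->
  (t \in trees m N) = (tsize t <= m)%N && all (fun j => j < N)%N (labels t).
Proof.
move=> m0; have [tm|tm] := leqP (tsize t) m.
  by rewrite mem_tree_upto// tm orbT.
by apply/negP => /mem_tree_upto_le /(_ m0); rewrite leqNgt tm.
Qed.

Lemma trees_uniq m N : uniq (trees m N). Proof. exact: tree_upto_uniq. Qed.

Lemma trees_sub m N N' : (0 < m)%N -> (N <= N')%N -> {subset trees m N <= trees m N'}.
Proof.
move=> m0 NN' t; rewrite !mem_trees// => /andP[-> /allP h]; apply/allP => j /h jN.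
exact: leq_trans NN'.
Qed.

(** One more unit of fuel only permutes the list, and unfolding it once splits the sum into leaves
    and nodes. These are to match the linear and the quadratic term of the Riccati equation;
    [tsize s + tsize t < m] is the truncation [tsize (Node j s t) <= m]. *)
Lemma big_trees (V : zmodType) m N (F : tree -> V) : (0 < m)%N ->
  \sum_(t <- trees m N) F t = \sum_(j < N) F (Leaf j) +
    \sum_(j < N) \sum_(s <- trees m N) \sum_(t <- trees m N | (tsize s + tsize t < m)%N) F (Node j s t).
Proof.
move=> m0.
have -> : \sum_(t <- trees m N) F t = \sum_(t <- tree_upto m N m.+1) F t.
  apply: perm_big; apply: uniq_perm; [exact: trees_uniq|exact: tree_upto_uniq|].
  move=> t; rewrite mem_trees//; have [tm|tm] := leqP (tsize t) m.
    by rewrite mem_tree_upto ?tm ?orbT// leqW.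
  by apply/esym/negP => /mem_tree_upto_le /(_ m0); rewrite leqNgt tm.
rewrite /= big_cat /=; congr (_ + _).
  by rewrite big_map -{1}[N]subn0 -/(index_iota 0 N) big_mkord.
rewrite big_filter big_mkcond /= big_allpairs_dep /=.
rewrite -{1}[N]subn0 -/(index_iota 0 N) big_mkord; apply: eq_bigr => j _.
rewrite big_allpairs_dep /=; apply: eq_bigr => s _.
rewrite [RHS]big_mkcond; apply: eq_bigr => t _.
by rewrite tsize_Node.
Qed.

(** If [f i] is the largest factor, the product is at most [f i ^+ size l], hence at most
    [f i ^+ p], which is one of the summands. *)
Lemma prod_le_sum_exp (R : realType) (I : eqType) (l : seq I) (f : I -> R) (p : nat) :
  (forall i, i \in l -> 0 <= f i <= 1) -> (p <= size l)%N -> (0 < p)%N ->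
  \prod_(i <- l) f i <= \sum_(i <- l) f i ^+ p.
Proof.
move=> f01 pl p0; case: l f01 pl => [|i0 l] f01 pl.
  by move: p0; rewrite ltnNge (leq_trans pl).
have [i il imax] : exists2 i, i \in i0 :: l & forall j, j \in i0 :: l -> f j <= f i.
  elim: l i0 {f01 pl} => [|k l IH] i0.
    by exists i0; rewrite ?mem_head// => j; rewrite inE => /eqP ->.
  have [i il imax] := IH k; have [ii0|i0i] := leP (f i0) (f i).
    exists i; first by rewrite in_cons il orbT.
    by move=> j; rewrite in_cons => /orP[/eqP ->//|]; exact: imax.
  exists i0; first by rewrite mem_head.
  by move=> j; rewrite in_cons => /orP[/eqP ->//|/imax ji]; rewrite (le_trans ji)// ltW.
have /andP[fi0 fi1] := f01 _ il.
apply: (@le_trans _ _ (f i ^+ size (i0 :: l))).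
  elim: (i0 :: l) f01 imax => [|k s IH] f01 imax; first by rewrite big_nil expr0.
  rewrite big_cons exprS; have /andP[fk0 _] := f01 k (mem_head _ _).
  apply: ler_pM => //.
  - by rewrite big_seq; apply: prodr_ge0 => j js; have /andP[] : 0 <= f j <= 1 by apply: f01; rewrite in_cons js orbT.
  - by apply: imax; rewrite mem_head.
  - by apply: IH => j js; [apply: f01|apply: imax]; rewrite in_cons js orbT.
apply: (@le_trans _ _ (f i ^+ p)); first exact: ler_wiXn2l.
rewrite (big_rem i il) lerDl big_seq; apply: sumr_ge0 => j js.
by have /f01/andP[fj0 _] : j \in i0 :: l := mem_rem js; rewrite exprn_ge0.
Qed.

(** * The truncated tree expansion and its defect in the Riccati equation *)

Section RiccatiData.
Context {R : realType}.
Local Open Scope complex_scope.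
Local Notation cmod := (@Normc.normc R).
Context (p : nat) (p3 : (3 <= p)%N) (podd : odd p).
Context (c : nat -> R[i]) (theta : nat -> R) (g : nat -> nat -> R[i]) (v : nat -> nat -> R).
Context (g1 : forall j n, cmod (g j n) <= 1) (v0 : forall j n, 0 <= v j n).
Context (gv : forall j n, cmod (g j n.+1 - g j n) <= v j n).

(** The nodes start at 1 because the data are only constrained at positive points; what lies before
    the first useful node is treated by a crude bound. *)
Definition node (n : nat) : R := n.+1%:R.
Definition lin j n (x : R) : R[i] := g j n + (x - node n)%:C * (g j n.+1 - g j n).
Definition amp j n : R := Num.max (cmod (g j n)) (cmod (g j n.+1)).

Fixpoint tprod (t : tree) n (x : R) : R[i] :=
  match t with
  | Leaf j => lin j n x
  | Node j s t => conjc (lin j n x) * (tprod s n x * tprod t n x)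
  end.

Fixpoint tprod_slope (t : tree) n (x : R) : R[i] :=
  match t with
  | Leaf j => g j n.+1 - g j n
  | Node j s t => conjc (g j n.+1 - g j n) * (tprod s n x * tprod t n x) +
      conjc (lin j n x) * (tprod_slope s n x * tprod t n x + tprod s n x * tprod_slope t n x)
  end.

Fixpoint freq (t : tree) : R :=
  match t with Leaf j => theta j | Node j s t => freq s + freq t - theta j end.

(** These coefficients make the equation hold tree by tree: [K' + 2 i E K] produces the factor
    [i * (2 * E - freq t)]. Its [i] cancels that of the potential, in a leaf directly and in a node
    because [- conjc 'i = 'i]. *)
Fixpoint tcoef (E : R) (t : tree) : R[i] :=
  match t with
  | Leaf j => c j / (2 * E - freq t)%:C
  | Node j s s' => conjc (c j) * tcoef E s * tcoef E s' / (2 * E - freq t)%:C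
  end.

Definition tvar (t : tree) n : R := \sum_(j <- labels t) v j n.
Definition tpow (t : tree) n : R := \sum_(j <- labels t) amp j n ^+ p.

Lemma amp01 j n : 0 <= amp j n <= 1.
Proof. by rewrite /amp le_max cmod_ge0 /= ge_max !g1. Qed.

Lemma cmod_lin j n x : node n <= x <= node n.+1 -> cmod (lin j n x) <= amp j n.
Proof.
move=> /andP[nx xn]; pose s := x - node n.
have s0 : 0 <= s by rewrite subr_ge0.
have s1 : 0 <= 1 - s by rewrite /s /node; move: xn; rewrite /node -natr1; lra.
have -> : lin j n x = (1 - s)%:C * g j n + s%:C * g j n.+1.
  rewrite /lin -/s (_ : (1 - s)%:C = 1 - s%:C); first by ring.
  by apply/eqP; rewrite eq_complex /= subr0 !eqxx.
apply: (le_trans (cmodD _ _)); rewrite !cmodM !cmodR !ger0_norm//.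
have h1 : cmod (g j n) <= amp j n by rewrite /amp le_max lexx.
have h2 : cmod (g j n.+1) <= amp j n by rewrite /amp le_max lexx orbT.
have := ler_wpM2l s0 h2; have := ler_wpM2l s1 h1; lra.
Qed.

Lemma lin_node j n : lin j n (node n) = g j n.
Proof. by rewrite /lin subrr mul0r addr0. Qed.

Lemma lin_nodeS j n : lin j n (node n.+1) = g j n.+1.
Proof.
rewrite /lin /node; have -> : n.+2%:R - n.+1%:R = 1 :> R by rewrite -natr1; lra.
by rewrite mul1r addrC subrK.
Qed.

(** Adjacent cells agree at their common node, so that the approximate Riccati solution is
    continuous and the energies of successive cells can be chained. *)
Lemma tprod_node t n : tprod t n (node n.+1) = tprod t n.+1 (node n.+1).
Proof. by elim: t => [j|j s IHs t IHt] /=; rewrite ?IHs ?IHt lin_node lin_nodeS. Qed.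

Lemma cderive_lin j n x : cderive (lin j n) x (g j n.+1 - g j n).
Proof.
have h : cderive (fun y => (y - node n)%:C) x 1.
  split => /=.
    have := is_derive_add (is_derive_id x (1 : R)) (is_derive_cst (- node n) x (1 : R)).
    by move=> h; apply: (is_derive_eq h); rewrite addr0.
  exact: is_derive_cst.
have := cderiveD (cderive_cst x (g j n)) (cderiveM h (cderive_cst x (g j n.+1 - g j n))).
by rewrite mulr0 addr0 mul1r add0r.
Qed.

Lemma cderive_tprod t n x : cderive (tprod t n) x (tprod_slope t n x).
Proof.
elim: t => [j|j s IHs t IHt] /=; first exact: cderive_lin.
exact: cderiveM (cderiveJ (cderive_lin j n x)) (cderiveM IHs IHt).
Qed.

Lemma cmod_tprod t n x : node n <= x <= node n.+1 ->
  cmod (tprod t n x) <= \prod_(j <- labels t) amp j n.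
Proof.
move=> nx; elim: t => [j|j s IHs t IHt] /=; first by rewrite big_seq1 cmod_lin.
rewrite big_cons big_cat /= !cmodM cmodJ.
by rewrite !ler_pM ?mulr_ge0 ?cmod_ge0 ?cmod_lin.
Qed.

Lemma prod_amp01 l n : 0 <= \prod_(j <- l) amp j n <= 1.
Proof.
apply/andP; split; first by apply: prodr_ge0 => j _; case/andP: (amp01 j n).
by apply: prodr_ile1 => j _; exact: amp01.
Qed.

Lemma cmod_tprod1 t n x : node n <= x <= node n.+1 -> cmod (tprod t n x) <= 1.
Proof. by move=> /(cmod_tprod t) h; apply: (le_trans h); case/andP: (prod_amp01 (labels t) n). Qed.

Lemma cmod_tprod_slope t n x : node n <= x <= node n.+1 -> cmod (tprod_slope t n x) <= tvar t n.
Proof.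
move=> nx; rewrite /tvar; elim: t => [j|j s IHs t IHt] /=; first by rewrite big_seq1.
rewrite big_cons big_cat /=; apply: (le_trans (cmodD _ _)).
have le1 (z w : R[i]) (a : R) : cmod z <= a -> cmod w <= 1 -> cmod (z * w) <= a.
  move=> za w1; rewrite cmodM -[leRHS]mulr1; apply: ler_pM => //; exact: cmod_ge0.
have l1 : cmod (lin j n x)^* <= 1.
  by rewrite cmodJ (le_trans (cmod_lin _ nx))//; case/andP: (amp01 j n).
have hs := cmod_tprod1 s nx; have ht := cmod_tprod1 t nx.
apply: lerD; first by apply: (le1); [rewrite cmodJ|apply: (le1)].
rewrite mulrC; apply: (le1) => //; apply: (le_trans (cmodD _ _)); apply: lerD; first exact: (le1).
by rewrite mulrC; apply: (le1).
Qed.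

(** All amplitudes are at most 1, so the product is bounded by the amplitude of the root label
    alone, whose [p]-th power is part of [tpow]. *)
Lemma cmod_tprod_pow t n x : node n <= x <= node n.+1 -> cmod (tprod t n x) ^+ p <= tpow t n.
Proof.
move=> nx; have : cmod (tprod t n x) <= amp (head 0%N (labels t)) n.
  apply: (le_trans (cmod_tprod t nx)).
  case: t => [j|j s t] /=; rewrite big_cons ?big_nil ?mulr1//.
  by rewrite ler_piMr//; [case/andP: (amp01 j n)|case/andP: (prod_amp01 (labels s ++ labels t) n)].
move=> h; apply: (@le_trans _ _ (amp (head 0%N (labels t)) n ^+ p)).
  by apply: lerXn2r; rewrite ?nnegrE ?cmod_ge0//; case/andP: (amp01 (head 0%N (labels t)) n).
rewrite /tpow; case: t {h} => [j|j s t] /=; rewrite big_cons ?big_nil ?addr0//.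
by rewrite lerDl; apply: sumr_ge0 => k _; rewrite exprn_ge0//; case/andP: (amp01 k n).
Qed.

Let m := (p - 2)%N.

Definition pot N n (x : R) : R[i] :=
  'i * \sum_(j < N) c j * (wave (theta j) x * lin j n x).

Definition ric (E : R) N n (x : R) : R[i] :=
  \sum_(t <- trees m N) tcoef E t * (wave (freq t) x * tprod t n x).

Definition ric_slope (E : R) N n (x : R) : R[i] :=
  \sum_(t <- trees m N) tcoef E t * ((0 -i* freq t) * wave (freq t) x * tprod t n x +
     wave (freq t) x * tprod_slope t n x).

Definition ric_err (E : R) N n (x : R) : R[i] :=
  ric_slope E N n x - ((0 -i* (2 * E)) * ric E N n x + pot N n x - conjc (pot N n x) * ric E N n x ^+ 2).

Definition err_bound (E : R) N n : R :=
  \sum_(t <- trees m N) cmod (tcoef E t) * tvar t n +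
  \sum_(j < N) \sum_(s <- trees m N) \sum_(t <- trees m N)
    cmod (c j) * (cmod (tcoef E s) * cmod (tcoef E t)) * (amp j n ^+ p + tpow s n + tpow t n).

Lemma cderive_ric E N n x : cderive (ric E N n) x (ric_slope E N n x).
Proof.
apply: cderive_sum => t _.
have := cderiveM (cderive_cst x (tcoef E t)) (cderiveM (cderive_wave (freq t) x) (cderive_tprod t n x)).
by rewrite mul0r add0r.
Qed.

Lemma tcoef_Leaf E j : 2 * E - freq (Leaf j) != 0 ->
  tcoef E (Leaf j) * (0 +i* (2 * E - freq (Leaf j))) = 'i * c j.
Proof.
move=> h; have -> : 0 +i* (2 * E - freq (Leaf j)) = 'i * (2 * E - freq (Leaf j))%:C.
  by apply/eqP; rewrite eq_complex /= !(mul0r, mul1r, mulr0, subr0, add0r, sub0r, oppr0) !eqxx.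
have h' : (2 * E - freq (Leaf j))%:C != 0 :> R[i].
  by apply: contra_neq h => /(congr1 (@complex.Re R)) /= h0; exact: h0.
by rewrite mulrCA divfK.
Qed.

Lemma tcoef_Node E j s t : 2 * E - freq (Node j s t) != 0 ->
  tcoef E (Node j s t) * (0 +i* (2 * E - freq (Node j s t))) =
  'i * (conjc (c j) * tcoef E s * tcoef E t).
Proof.
move=> h; have -> : 0 +i* (2 * E - freq (Node j s t)) = 'i * (2 * E - freq (Node j s t))%:C.
  by apply/eqP; rewrite eq_complex /= !(mul0r, mul1r, mulr0, subr0, add0r, sub0r, oppr0) !eqxx.
have h' : (2 * E - freq (Node j s t))%:C != 0 :> R[i].
  by apply: contra_neq h => /(congr1 (@complex.Re R)) /= h0; exact: h0.
by rewrite mulrCA divfK.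
Qed.

Let m0 : (0 < m)%N. Proof. by rewrite /m subn_gt0. Qed.

(** Expanding [K' + 2 i E K] over trees reproduces the potential, from the leaves, and those terms
    of [conj m K^2] whose tree survives the truncation. What remains are the slopes of the
    amplitudes and the products that were cut off. *)
Lemma ric_errE E N n x : (forall t, (tsize t <= m)%N -> 2 * E - freq t != 0) ->
  ric_err E N n x =
  \sum_(t <- trees m N) tcoef E t * (wave (freq t) x * tprod_slope t n x) +
  \sum_(j < N) \sum_(s <- trees m N) \sum_(t <- trees m N | ~~ (tsize s + tsize t < m)%N)
    conjc ('i * (c j * (wave (theta j) x * lin j n x))) *
    (tcoef E s * (wave (freq s) x * tprod s n x) * (tcoef E t * (wave (freq t) x * tprod t n x))).
Proof.
move=> nres.
pose W t := wave (freq t) x * tprod t n x.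
pose F t := tcoef E t * (0 +i* (2 * E - freq t)) * W t.
have e1 : ric_slope E N n x - (0 -i* (2 * E)) * ric E N n x =
    \sum_(t <- trees m N) F t +
    \sum_(t <- trees m N) tcoef E t * (wave (freq t) x * tprod_slope t n x).
  rewrite mulr_sumr /ric_slope -sumrB -big_split /=; apply: eq_bigr => t _.
  rewrite /F /W; have -> : 0 +i* (2 * E - freq t) = (0 -i* freq t) - (0 -i* (2 * E)).
    by apply/eqP; rewrite eq_complex /= oppr0 addr0 eqxx opprK addrC eqxx.
  by ring.
pose Z j := 'i * (c j * (wave (theta j) x * lin j n x)).
have e2 : \sum_(t <- trees m N) F t = pot N n x -
    \sum_(j < N) \sum_(s <- trees m N) \sum_(t <- trees m N | (tsize s + tsize t < m)%N)
     conjc (Z j) * (tcoef E s * W s * (tcoef E t * W t)).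
  rewrite big_trees//; congr (_ + _).
    rewrite /pot mulr_sumr; apply: eq_bigr => j _.
    rewrite /F tcoef_Leaf; last by apply: nres.
    by rewrite -!mulrA.
  rewrite -sumrN; apply: eq_bigr => j _; rewrite -sumrN; apply: eq_bigr => s _.
  rewrite -sumrN; apply: eq_bigr => t st.
  rewrite /F tcoef_Node; last by apply: nres; rewrite tsize_Node.
  have Ji : conjc 'i = - 'i :> R[i] by apply/eqP; rewrite eq_complex /= oppr0 !eqxx.
  by rewrite /W /Z !conjcM Ji waveJ /= !waveD; ring.
have e3 : conjc (pot N n x) * ric E N n x ^+ 2 =
    \sum_(j < N) \sum_(s <- trees m N) \sum_(t <- trees m N) conjc (Z j) * (tcoef E s * W s * (tcoef E t * W t)).
  rewrite /pot mulr_sumr rmorph_sum /= mulr_suml; apply: eq_bigr => j _.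
  have -> : ric E N n x ^+ 2 = \sum_(s <- trees m N) \sum_(t <- trees m N) tcoef E s * W s * (tcoef E t * W t).
    by rewrite expr2 /ric mulr_suml; apply: eq_bigr => s _; rewrite mulr_sumr.
  by rewrite mulr_sumr; apply: eq_bigr => s _; rewrite mulr_sumr.
rewrite /ric_err; set A := ric_slope _ _ _ _; set B := (0 -i* (2 * E)) * _.
have -> : A - (B + pot N n x - (pot N n x)^* * ric E N n x ^+ 2) =
   (A - B) - pot N n x + (pot N n x)^* * ric E N n x ^+ 2 by ring.
rewrite /A /B e1 e2 e3.
set T1 := (X in pot N n x - X + _); set T2 := (X in _ - _ + X = _).
set T3 := (X in _ = _ + X).
have -> : T2 = T1 + T3.
  rewrite -big_split /=; apply: eq_bigr => j _; rewrite -big_split /=; apply: eq_bigr => s _.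
  by rewrite (bigID (fun t => (tsize s + tsize t < m)%N)) /=.
by ring.
Qed.

Lemma sum_prod_amp l n : (p <= size l)%N ->
  \prod_(j <- l) amp j n <= \sum_(j <- l) amp j n ^+ p.
Proof. by move=> pl; apply: prod_le_sum_exp => // [i _|]; [exact: amp01|exact: leq_trans p3]. Qed.

Lemma ric_err_le E N n x : (forall t, (tsize t <= m)%N -> 2 * E - freq t != 0) ->
  node n <= x <= node n.+1 -> cmod (ric_err E N n x) <= err_bound E N n.
Proof.
move=> nres nx; rewrite ric_errE// /err_bound; apply: (le_trans (cmodD _ _)); apply: lerD.
  apply: (le_trans (cmod_sum _ _ _)); apply: ler_sum => t _.
  rewrite !cmodM cmod_wave mul1r ler_wpM2l ?cmod_ge0//; exact: cmod_tprod_slope.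
apply: (le_trans (cmod_sum _ _ _)); apply: ler_sum => j _.
apply: (le_trans (cmod_sum _ _ _)); apply: ler_sum => s _.
apply: (le_trans (cmod_sum _ _ _)); rewrite big_mkcond /=; apply: ler_sum => t _.
have tp0 u : 0 <= tpow u n.
  by apply: sumr_ge0 => k _; rewrite exprn_ge0//; case/andP: (amp01 k n).
case: ifPn => [st|_]; last first.
  rewrite !mulr_ge0 ?cmod_ge0 ?addr_ge0 ?exprn_ge0//; case/andP: (amp01 j n) => //.
have i1 : cmod 'i = 1 by rewrite cmodE /= expr0n add0r expr1n sqrtr1.
rewrite !cmodM cmodJ !cmodM i1 !cmod_wave !mul1r.
set a := cmod (c j); set b := cmod (tcoef E s); set d := cmod (tcoef E t).
have -> : a * cmod (lin j n x) * (b * cmod (tprod s n x) * (d * cmod (tprod t n x))) =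
  a * (b * d) * (cmod (lin j n x) * (cmod (tprod s n x) * cmod (tprod t n x))) by ring.
apply: ler_wpM2l; first by rewrite !mulr_ge0 ?cmod_ge0.
apply: (@le_trans _ _ (\prod_(k <- labels (Node j s t)) amp k n)).
  by have := cmod_tprod (Node j s t) nx; rewrite /= !cmodM cmodJ.
apply: (le_trans (sum_prod_amp n _)); last by rewrite /= big_cons big_cat /= addrA.
(* The sizes of [s] and [t] and [m = p - 2] are odd, hence [m <= tsize s + tsize t]
   is strict and the remainder only contains products of at least [p] factors. *)
have := tsize_Node j s t; rewrite /tsize => ->; rewrite -!/(tsize _).
move: st; rewrite -leqNgt leq_eqVlt => /orP[/eqP st|st]; last first.
  by rewrite -(leq_add2r 2) in st; move: st; rewrite /m; lia.
have o1 := tsize_odd s; have o2 := tsize_odd t.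
have om : odd m by rewrite /m oddB ?(leq_trans _ p3)//= podd.
by move: om; rewrite st oddD o1 o2.
Qed.

End RiccatiData.

(** * The a priori estimate *)

(** Otherwise [e] is exceeded at arbitrarily late [n], for varying [N]. Monotonicity in [N] brings
    any number of these occurrences to a common [N], where their sum exceeds [C]. *)
Lemma uniform_tail (R : realType) (b : nat -> nat -> R) (C e : R) :
  (forall N n, 0 <= b N n) -> (forall N N' n, (N <= N')%N -> b N n <= b N' n) ->
  (forall N k, \sum_(n < k) b N n <= C) -> 0 < e ->
  exists X, forall n N, (X <= n)%N -> b N n <= e.
Proof.
move=> b0 bmon bC e0; apply: contrapT => noX.
have step X : exists n N, (X <= n)%N /\ e < b N n.
  apply: contrapT => H; apply: noX; exists X => n N Xn; rewrite leNgt; apply/negP => lt.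
  by apply: H; exists n, N.
have grow k : exists N M, k%:R * e <= \sum_(n < M) b N n.
  elim: k => [|k [N [M IH]]]; first by exists 0%N, 0%N; rewrite big_ord0 mul0r.
  have [n [N' [Mn lt]]] := step M.
  exists (maxn N N'), n.+1; rewrite -natr1 mulrDl mul1r big_ord_recr /=; apply: lerD.
    apply: (le_trans IH); apply: (@le_trans _ _ (\sum_(i < M) b (maxn N N') i)).
      by apply: ler_sum => i _; apply: bmon; rewrite leq_maxl.
    rewrite -(big_mkord xpredT (b (maxn N N'))) -[leRHS](big_mkord xpredT (b (maxn N N'))).
    rewrite (big_cat_nat (leq0n M) Mn) /= lerDl; exact: sumr_ge0.
  by rewrite ltW// (lt_le_trans lt)// bmon// leq_maxr.
have C0 : 0 <= C by apply: le_trans (bC 0%N 0%N); rewrite big_ord0.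
have [N [M]] := grow (Num.truncn (C / e)).+1; apply/negP; rewrite -ltNge.
apply: (le_lt_trans (bC N M)); rewrite -ltr_pdivrMr//.
by have /truncn_itv/andP[_] : 0 <= C / e by rewrite divr_ge0// ltW.
Qed.

Lemma exchange_sum_le (R : realType) (I : eqType) (l : seq I) (w : I -> R) (f : I -> nat -> R) (k : nat) (S K : R) :
  (forall i, 0 <= w i) -> 0 <= K -> \sum_(i <- l) w i <= S ->
  (forall i, i \in l -> \sum_(n < k) f i n <= K) ->
  \sum_(n < k) \sum_(i <- l) w i * f i n <= S * K.
Proof.
move=> w0 Kge wS fK; rewrite exchange_big /=; apply: (@le_trans _ _ ((\sum_(i <- l) w i) * K)).
  rewrite mulr_suml big_seq [leRHS]big_seq; apply: ler_sum => i il.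
  by rewrite -mulr_sumr ler_wpM2l ?w0// fK.
by rewrite ler_wpM2r.
Qed.

Lemma sum_subset_le (R : realType) (I : eqType) (s1 s2 : seq I) (F : I -> R) :
  (forall i, 0 <= F i) -> uniq s1 -> uniq s2 -> {subset s1 <= s2} ->
  \sum_(i <- s1) F i <= \sum_(i <- s2) F i.
Proof.
move=> F0 u1 u2 s12; rewrite [leRHS](bigID (mem s1)) /= -[leRHS]/(_ + _).
have -> : \sum_(i <- s2 | i \in s1) F i = \sum_(i <- s1) F i.
  rewrite -big_filter; apply: perm_big; apply: uniq_perm => //; first exact: filter_uniq.
  by move=> i; rewrite mem_filter; case: (boolP (i \in s1)) => // /s12 ->.
by rewrite lerDl; apply: sumr_ge0.
Qed.

Lemma perturb_dot (R : realType) (z a1 a2 b1 b2 y1 y2 D P e nu : R) :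
  `|a1 - b1| <= D -> `|a2 - b2| <= D -> `|y1| <= P -> `|y2| <= P ->
  `|z - 2 * (a1 * y1 + a2 * y2)| <= e * P + nu ->
  `|z - 2 * (b1 * y1 + b2 * y2)| <= (e + 4 * D) * P + nu.
Proof.
move=> d1 d2 h1 h2 h.
have -> : z - 2 * (b1 * y1 + b2 * y2) =
  (z - 2 * (a1 * y1 + a2 * y2)) + (2 * ((a1 - b1) * y1) + 2 * ((a2 - b2) * y2)) by ring.
have n2 : `|2 : R| = 2 by rewrite ger0_norm.
apply: (le_trans (ler_normD _ _)); have := ler_normD (2 * ((a1 - b1) * y1)) (2 * ((a2 - b2) * y2)).
rewrite !(normrM 2) n2 !normrM.
have := ler_pM (normr_ge0 _) (normr_ge0 _) d1 h1; have := ler_pM (normr_ge0 _) (normr_ge0 _) d2 h2.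
lra.
Qed.

Lemma perturb_scal (R : realType) (z t a b D P e nu : R) : 0 <= P ->
  `|a - b| <= D -> `|z - (t + 2 * a * P)| <= e * P + nu ->
  `|z - (t + 2 * b * P)| <= (e + 4 * D) * P + nu.
Proof.
move=> P0 d h.
have -> : z - (t + 2 * b * P) = (z - (t + 2 * a * P)) + 2 * ((a - b) * P) by ring.
have n2 : `|2 : R| = 2 by rewrite ger0_norm.
apply: (le_trans (ler_normD _ _)); rewrite !(normrM 2) n2 normrM (ger0_norm P0).
have := ler_wpM2r P0 d; have : 0 <= D * P by rewrite mulr_ge0// (le_trans _ d).
lra.
Qed.

Lemma Re_imulB (R : realType) (z w : R[i]) :
  complex.Re (Complex 0 1 * z - w) = - complex.Im z - complex.Re w.
Proof. by case: z => a b; case: w => c d /=; rewrite mul0r mul1r sub0r. Qed.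

Lemma Im_imulB (R : realType) (z w : R[i]) :
  complex.Im (Complex 0 1 * z - w) = complex.Re z - complex.Im w.
Proof. by case: z => a b; case: w => c d /=; rewrite mul0r mul1r add0r. Qed.

Lemma scale_bound (R : realType) (F1 F2 x y m : R) : 0 <= F1 -> F1 <= F2 -> 0 <= y -> 0 <= m ->
  x <= F1 * (y + 10 * m) -> x <= 10 * (F2 * (y + m)).
Proof.
move=> F0 F12 y0 m0 h; apply: (le_trans h); apply: (@le_trans _ _ (F2 * (10 * (y + m)))).
  by apply: ler_pM => //; lra.
by rewrite mulrCA.
Qed.

Lemma scale_bound4 (R : realType) (F1 F2 x z w y m : R) : 0 <= F1 -> F1 <= F2 -> 0 <= y -> 0 <= m ->
  0 <= w -> x <= 4 * z -> z <= F1 * (w + 10 * m) -> w <= 4 * y -> x <= 40 * F2 * (y + m).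
Proof.
move=> F0 F12 y0 m0 w0 h1 h2 h3; apply: (le_trans h1); apply: (@le_trans _ _ (4 * (F2 * (10 * (y + m))))).
  by rewrite ler_pM2l//; apply: (le_trans h2); apply: ler_pM => //; lra.
by rewrite le_eqVlt; apply/orP; left; apply/eqP; ring.
Qed.

Lemma chain_bound (R : realType) (A B x y z m1 m2 : R) : 1 <= A -> 0 <= B -> 0 <= m2 ->
  x <= B * (y + m2) -> y <= A * (z + m1) -> x <= A * B * (z + (m1 + m2)).
Proof.
move=> A1 B0 m20 h1 h2; apply: (le_trans h1); rewrite [A * B]mulrC -mulrA; apply: ler_wpM2l => //.
have : 0 <= (A - 1) * m2 by apply: mulr_ge0; lra.
lra.
Qed.

Section EnergySystem.
Context {R : realType}.
Local Notation leb := (@lebesgue_measure R).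

(* For a solution [U] of [Lambda U = E U] the functions [P = |U|^2] and
   [Y1 + i Y2 = 2 U_1 conj U_2] satisfy this system with no error at all. *)
Definition energy_system (phi : R -> R[i]) (E e a b : R) (P Y1 Y2 M : R -> R) : Prop :=
  [/\ [/\ ac a b P, ac a b Y1 & ac a b Y2],
      forall x, a <= x <= b -> 0 <= P x /\ Y1 x ^+ 2 + Y2 x ^+ 2 <= P x ^+ 2,
      forall x y, a <= x -> x <= y -> y <= b -> M x <= M y &
      {ae leb, forall x, a < x < b -> exists p' y1' y2' nu : R,
        [/\ [/\ is_derive x 1 P p', is_derive x 1 Y1 y1', is_derive x 1 Y2 y2' & is_derive x 1 M nu],
          0 <= nu,
          `|p' - 2 * (- complex.Im (phi x) * Y1 x + complex.Re (phi x) * Y2 x)| <= e * P x + nu,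
          `|y1' - (2 * E * Y2 x + 2 * - complex.Im (phi x) * P x)| <= e * P x + nu &
          `|y2' - (- 2 * E * Y1 x + 2 * complex.Re (phi x) * P x)| <= e * P x + nu]}].

Lemma ac_sub (a b a' b' : R) (f : R -> R) : a <= a' -> b' <= b -> ac a b f -> ac a' b' f.
Proof.
move=> aa bb acf e e0; have [d d0 H] := acf e e0; exists d => // n s t st; apply: H.
by move=> i /st[? [? ?]]; rewrite (le_trans aa)//; split => //; split => //; exact: le_trans bb.
Qed.

Lemma energy_system_sub phi E e (a b a' b' : R) P Y1 Y2 M : a <= a' -> b' <= b ->
  energy_system phi E e a b P Y1 Y2 M -> energy_system phi E e a' b' P Y1 Y2 M.
Proof.
move=> aa bb [[h1 h2 h3] h4 h5 h6]; split.
- by split; apply: ac_sub aa bb _.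
- by move=> x /andP[ax xb]; apply: h4; rewrite (le_trans aa)// (le_trans xb).
- by move=> x y ax xy yb; apply: h5 => //; [exact: le_trans ax|exact: le_trans bb].
- by apply: (ae_imp h6) => x H /andP[ax xb]; apply: H; rewrite (le_lt_trans aa)// (lt_le_trans xb).
Qed.

End EnergySystem.

Section Apriori.
Context {R : realType}.
Local Open Scope complex_scope.
Local Notation leb := (@lebesgue_measure R).
Local Notation cmod := (@Normc.normc R).
Context (p : nat) (p3 : (3 <= p)%N) (podd : odd p).
Context (c : nat -> R[i]) (theta : nat -> R) (g : nat -> nat -> R[i]) (v : nat -> nat -> R).
Context (g1 : forall j n, cmod (g j n) <= 1) (v0 : forall j n, 0 <= v j n).
Context (gv : forall j n, cmod (g j n.+1 - g j n) <= v j n).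
Context (K0 C0 : R).
Context (sv : forall j k, \sum_(n < k) v j n <= K0).
Context (sg : forall j k, \sum_(n < k) cmod (g j n) ^+ p <= K0).
Context (sc : forall N, \sum_(j < N) cmod (c j) <= C0).
Context (phi : R -> R[i]) (eta : nat -> R) (eta0 : forall N, 0 <= eta N).
Context (phiB : forall x, 0 < x -> cmod (phi x) <= C0).
Context (phi_app : forall N n x, @node R n <= x <= node n.+1 ->
  cmod ('i * phi x - pot c theta g N n x) <= \sum_(j < N) cmod (c j) * v j n + eta N).
Context (eta_cvg : forall e : R, 0 < e -> exists N, eta N <= e).

Let m := (p - 2)%N.
Let m0 : (0 < m)%N. Proof. by rewrite /m subn_gt0. Qed.
Let p0 : (0 < p)%N. Proof. exact: leq_trans p3. Qed.

Lemma K0_ge0 : 0 <= K0.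
Proof. by have := sv 0%N 0%N; rewrite big_ord0. Qed.

Lemma C0_ge0 : 0 <= C0.
Proof. by have := sc 0%N; rewrite big_ord0. Qed.

Lemma sum_amp j k : \sum_(n < k) amp g j n ^+ p <= 2 * K0.
Proof.
apply: (@le_trans _ _ (\sum_(n < k) (cmod (g j n) ^+ p + cmod (g j n.+1) ^+ p))).
  apply: ler_sum => n _; rewrite /amp; case: (leP (cmod (g j n)) (cmod (g j n.+1))) => _.
    by rewrite lerDr exprn_ge0// cmod_ge0.
  by rewrite lerDl exprn_ge0// cmod_ge0.
rewrite big_split /= (_ : 2 * K0 = K0 + K0); last by lra.
apply: lerD; first exact: sg.
apply: le_trans (sg j k.+1); rewrite [leRHS]big_ord_recl.
rewrite -[X in X <= _]/(\sum_(i < k) cmod (g j (lift ord0 i)) ^+ p) lerDr.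
by rewrite exprn_ge0// cmod_ge0.
Qed.

Lemma sum_labels_le (f : nat -> nat -> R) (K : R) t k : 0 <= K ->
  (forall j, \sum_(n < k) f j n <= K) -> (tsize t <= m)%N ->
  \sum_(n < k) \sum_(j <- labels t) f j n <= m%:R * K.
Proof.
move=> Kge fK tm; rewrite exchange_big /=; apply: (@le_trans _ _ (\sum_(j <- labels t) K)).
  by apply: ler_sum => j _.
rewrite big_const_seq count_predT -[size _]/(tsize t) iter_addr addr0 mulr_natl.
exact: ler_wpMn2l.
Qed.

Section GoodEnergy.
Context (E Sig : R) (nres : forall t, (tsize t <= m)%N -> 2 * E - freq theta t != 0).
Context (HSig : forall N, \sum_(t <- trees m N) cmod (tcoef c theta E t) <= Sig).

Lemma Sig_ge0 : 0 <= Sig.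
Proof. by apply: le_trans (HSig 0%N); apply: sumr_ge0 => t _; exact: cmod_ge0. Qed.

Definition err_total : R := Sig * (m%:R * K0) + C0 * (Sig * (Sig * (2 * K0 + m%:R * (2 * K0) + m%:R * (2 * K0)))).

Lemma amp_ge0 j n : 0 <= amp g j n.
Proof. by case/andP: (amp01 g1 j n). Qed.

Lemma tpow_ge0 t n : 0 <= tpow p g t n.
Proof. by apply: sumr_ge0 => k _; rewrite exprn_ge0// amp_ge0. Qed.

Lemma mem_trees_size N t : t \in trees m N -> (tsize t <= m)%N.
Proof. by rewrite mem_trees// => /andP[]. Qed.

Lemma sum_err N k : \sum_(n < k) err_bound p c theta g v E N n <= err_total.
Proof.
have K2 : 0 <= 2 * K0 by rewrite mulr_ge0// K0_ge0.
have hv t : t \in trees m N -> \sum_(n < k) tvar v t n <= m%:R * K0.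
  by move=> /mem_trees_size tm; apply: sum_labels_le => //; exact: K0_ge0.
have hp t : t \in trees m N -> \sum_(n < k) tpow p g t n <= m%:R * (2 * K0).
  by move=> /mem_trees_size tm; apply: (sum_labels_le (f := fun j n => amp g j n ^+ p)) => // j; exact: sum_amp.
rewrite /err_bound big_split /= /err_total; apply: lerD.
  apply: exchange_sum_le => //; [by move=> t; exact: cmod_ge0|by rewrite mulr_ge0// K0_ge0].
have W0 : 0 <= 2 * K0 + m%:R * (2 * K0) + m%:R * (2 * K0) by rewrite !addr_ge0// mulr_ge0.
rewrite exchange_big /=.
apply: (@le_trans _ _ (\sum_(j < N) cmod (c j) * (Sig * (Sig * (2 * K0 + m%:R * (2 * K0) + m%:R * (2 * K0)))))); last first.
  by rewrite -mulr_suml ler_wpM2r// !mulr_ge0// Sig_ge0.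
apply: ler_sum => j _.
apply: (@le_trans _ _ (\sum_(n < k) \sum_(s <- trees m N) (cmod (c j) * cmod (tcoef c theta E s)) *
  (\sum_(t <- trees m N) cmod (tcoef c theta E t) * (amp g j n ^+ p + tpow p g s n + tpow p g t n)))).
  apply: ler_sum => n _; apply: ler_sum => s _; rewrite mulr_sumr; apply: ler_sum => t _.
  by rewrite !mulrA.
rewrite (mulrA (cmod (c j)) Sig); apply: (exchange_sum_le (w := fun s => cmod (c j) * cmod (tcoef c theta E s))
  (f := fun s n => \sum_(t <- trees m N) cmod (tcoef c theta E t) * (amp g j n ^+ p + tpow p g s n + tpow p g t n))).
- by move=> s; rewrite mulr_ge0// cmod_ge0.
- by rewrite mulr_ge0// Sig_ge0.
- by rewrite -mulr_sumr ler_wpM2l ?cmod_ge0.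
move=> s sT; apply: (exchange_sum_le (w := fun t => cmod (tcoef c theta E t))
  (f := fun t n => amp g j n ^+ p + tpow p g s n + tpow p g t n)) => //; first by move=> t; exact: cmod_ge0.
move=> t tT; rewrite !big_split /=; apply: lerD; first apply: lerD.
- exact: sum_amp.
- exact: hp.
- exact: hp.
Qed.

(** A product of modulus [y] satisfies [y <= h + y ^+ p / h ^+ p.-1], whether [y] is below or above
    [h]. By the choice of [h], the terms [h] contribute at most [1 / 4] altogether. The [p]-th
    powers have sums over the cells bounded uniformly in [N], so [uniform_tail] makes them
    contribute at most [1 / 4] beyond some [X]. *)
Lemma ric_small : exists X, forall n N x, (X <= n)%N -> @node R n <= x <= node n.+1 ->
  cmod (ric p c theta g E N n x) <= 1 / 2.
Proof.
pose h := (4 * (Sig + 1))^-1.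
have S1 : 0 < Sig + 1 by rewrite ltr_wpDl// Sig_ge0.
have h0 : 0 < h by rewrite invr_gt0 mulr_gt0.
pose b N n := \sum_(t <- trees m N) cmod (tcoef c theta E t) * tpow p g t n.
have [|N N' n NN'|N k||X HX] := @uniform_tail R b (Sig * (m%:R * (2 * K0))) (h ^+ p.-1 / 4).
- by move=> N n; apply: sumr_ge0 => t _; rewrite mulr_ge0 ?cmod_ge0 ?tpow_ge0.
- apply: sum_subset_le => //; [|exact: trees_uniq|exact: trees_uniq|exact: trees_sub].
  by move=> t; rewrite mulr_ge0 ?cmod_ge0 ?tpow_ge0.
- have K2 : 0 <= m%:R * (2 * K0) by rewrite !mulr_ge0// K0_ge0.
  apply: exchange_sum_le => //; first by move=> t; exact: cmod_ge0.
  move=> t /mem_trees_size tm; apply: (sum_labels_le (f := fun j n => amp g j n ^+ p)) => [|j|//].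
    by rewrite mulr_ge0// K0_ge0.
  exact: sum_amp.
- by rewrite divr_gt0// exprn_gt0.
exists X => n N x Xn nx; rewrite /ric; apply: (le_trans (cmod_sum _ _ _)).
have hp0 : 0 < h ^+ p.-1 by rewrite exprn_gt0.
apply: (@le_trans _ _ (\sum_(t <- trees m N) cmod (tcoef c theta E t) * (h + tpow p g t n / h ^+ p.-1))).
  apply: ler_sum => t _; rewrite !cmodM cmod_wave mul1r ler_wpM2l ?cmod_ge0//.
  have yp := cmod_tprod_pow p g1 t nx.
  set y := cmod (tprod g t n x) in yp *.
  have y0 : 0 <= y by exact: cmod_ge0.
  have [yh|hy] := leP y h; first by rewrite (le_trans yh)// lerDl divr_ge0 ?tpow_ge0// ltW.
  apply: ler_wpDl; first exact: ltW.
  rewrite ler_pdivlMr// (le_trans _ yp)// -{2}(prednK p0) exprS ler_wpM2l//.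
  by apply: lerXn2r; rewrite ?nnegrE// ltW.
under eq_bigr do rewrite mulrDr mulrA.
rewrite big_split /= -!mulr_suml.
have b1 := HX n N Xn; rewrite -/(b N n).
have b2 : b N n / h ^+ p.-1 <= 1 / 4 by rewrite ler_pdivrMr// (le_trans b1)//; lra.
have b3 : (\sum_(t <- trees m N) cmod (tcoef c theta E t)) * h <= 1 / 4.
  rewrite /h ler_pdivrMr ?mulr_gt0//; apply: (le_trans (HSig N)); lra.
lra.
Qed.

(** The summable part of the exponent lost on one cell, from [energy_step] with [eta] the Riccati
    error and [mu] the error in the potential; [160 = 40 * 4]. The contributions of [e] and [eta N],
    which grow with the length, are kept apart. *)
Definition step_loss N n : R :=
  96 * err_bound p c theta g v E N n + 160 * \sum_(j < N) cmod (c j) * v j n.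

Definition level_energy (P Y1 Y2 : R -> R) N n (x : R) : R :=
  energy (P x) (Y1 x) (Y2 x) (complex.Re (ric p c theta g E N n x)) (complex.Im (ric p c theta g E N n x)).

Lemma err_bound_ge0 N n : 0 <= err_bound p c theta g v E N n.
Proof.
rewrite /err_bound addr_ge0//; apply: sumr_ge0 => t _; last apply: sumr_ge0 => s _; last apply: sumr_ge0 => u _.
  by rewrite mulr_ge0 ?cmod_ge0//; apply: sumr_ge0.
by rewrite !mulr_ge0 ?cmod_ge0// !addr_ge0 ?tpow_ge0// exprn_ge0// amp_ge0.
Qed.

Lemma sum_cv_ge0 N n : 0 <= \sum_(j < N) cmod (c j) * v j n.
Proof. by apply: sumr_ge0 => j _; rewrite mulr_ge0// cmod_ge0. Qed.

Lemma step_loss_ge0 N n : 0 <= step_loss N n.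
Proof.
apply: addr_ge0; apply: mulr_ge0 => //; [exact: err_bound_ge0|exact: sum_cv_ge0].
Qed.

Lemma sum_step_loss N k : \sum_(n < k) step_loss N n <= 96 * err_total + 160 * (C0 * K0).
Proof.
rewrite big_split /= -!mulr_sumr lerD// ler_wpM2l// ?sum_err//.
rewrite exchange_big /=; apply: (@le_trans _ _ (\sum_(j < N) cmod (c j) * K0)).
  by apply: ler_sum => j _; rewrite -mulr_sumr ler_wpM2l ?cmod_ge0//; exact: sv.
by rewrite -mulr_suml ler_wpM2r// K0_ge0.
Qed.

Lemma cmod_pot N n x : @node R n <= x <= node n.+1 -> cmod (pot c theta g N n x) <= C0.
Proof.
move=> nx; rewrite /pot cmodM.
have -> : cmod 'i = 1 by rewrite cmodE /= expr0n add0r expr1n sqrtr1.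
rewrite mul1r; apply: le_trans (sc N); apply: (le_trans (cmod_sum _ _ _)).
apply: ler_sum => j _; rewrite !cmodM cmod_wave mul1r ler_piMr ?cmod_ge0//.
by rewrite (le_trans (cmod_lin _ _ nx))//; case/andP: (amp01 g1 j n).
Qed.

Lemma level_step X N n (s t e : R) P Y1 Y2 M :
  (forall n N x, (X <= n)%N -> @node R n <= x <= node n.+1 -> cmod (ric p c theta g E N n x) <= 1 / 2) ->
  (X <= n)%N -> node n <= s -> s <= t -> t <= node n.+1 -> 0 <= e ->
  energy_system phi E e s t P Y1 Y2 M ->
  level_energy P Y1 Y2 N n t <=
    expR (step_loss N n + 40 * (e + 4 * eta N) * (t - s)) * (level_energy P Y1 Y2 N n s + (10 * M t - 10 * M s)) /\
  level_energy P Y1 Y2 N n s <=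
    expR (step_loss N n + 40 * (e + 4 * eta N) * (t - s)) * (level_energy P Y1 Y2 N n t + (10 * M t - 10 * M s)).
Proof.
move=> small Xn ns st tn e0 [[acP acY1 acY2] PY ndM HP].
have nx x : s <= x <= t -> node n <= x <= node n.+1.
  by move=> /andP[sx xt]; rewrite (le_trans ns)// (le_trans xt).
(* The factor 4 is the price of replacing ['i * phi] by the truncated interpolated potential, see
   [perturb_dot] and [perturb_scal]. *)
pose mu := e + 4 * (\sum_(j < N) cmod (c j) * v j n + eta N).
have mu0 : 0 <= mu by rewrite /mu addr_ge0// mulr_ge0// addr_ge0 ?sum_cv_ge0.
pose K x := ric p c theta g E N n x; pose q x := pot c theta g N n x.
pose r x := ric_err p c theta g E N n x.
have K4 x : s <= x <= t -> complex.Re (K x) ^+ 2 + complex.Im (K x) ^+ 2 <= 1 / 4.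
  move=> /nx /(small n N x Xn) Kx; rewrite -cmod_sqr (_ : 1 / 4 = (1 / 2) ^+ 2); last by field.
  by apply: lerXn2r; rewrite ?nnegrE ?cmod_ge0.
have [dK1 dK2] : (forall x, s <= x <= t -> is_derive x 1 (fun y => complex.Re (K y))
     (2 * E * complex.Im (K x) + complex.Re (q x) - (complex.Re (q x) * (complex.Re (K x) ^+ 2 - complex.Im (K x) ^+ 2) +
        complex.Im (q x) * (2 * complex.Re (K x) * complex.Im (K x))) + complex.Re (r x))) /\
   (forall x, s <= x <= t -> is_derive x 1 (fun y => complex.Im (K y))
     (- 2 * E * complex.Re (K x) + complex.Im (q x) - (complex.Re (q x) * (2 * complex.Re (K x) * complex.Im (K x)) -
        complex.Im (q x) * (complex.Re (K x) ^+ 2 - complex.Im (K x) ^+ 2)) + complex.Im (r x))).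
  have sl x : ric_slope p c theta g E N n x = (0 -i* (2 * E)) * K x + q x - conjc (q x) * (K x * K x) + r x.
    by rewrite /r /ric_err -/(K x) -/(q x) expr2 addrC subrK.
  split=> x _; have [d1 d2] := cderive_ric p c theta g E N n x; rewrite sl in d1 d2.
    apply: (is_derive_eq d1); move: (q x) (r x) (K x) => [q1 q2] [r1 r2] [k1 k2] /=; ring.
  apply: (is_derive_eq d2); move: (q x) (r x) (K x) => [q1 q2] [r1 r2] [k1 k2] /=; ring.
have rh x : s <= x <= t -> `|complex.Re (r x)| <= err_bound p c theta g v E N n /\
    `|complex.Im (r x)| <= err_bound p c theta g v E N n.
  move=> /nx nxx; have h := ric_err_le p3 podd c g1 gv N nres nxx.
  by split; [apply: le_trans (cmod_Re _) _|apply: le_trans (cmod_Im _) _].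
have qB x : s <= x <= t -> `|complex.Re (q x)| <= C0 /\ `|complex.Im (q x)| <= C0.
  move=> /nx nxx; have h := cmod_pot N nxx.
  by split; [apply: le_trans (cmod_Re _) _|apply: le_trans (cmod_Im _) _].
(* At most one cell is crossed, so [t - s <= 1] and the errors of the cell are paid without a factor
   of length; only [e] and [eta N] keep the factor [t - s]. *)
have kE : (96 * err_bound p c theta g v E N n + 40 * mu) * (t - s) <=
    step_loss N n + 40 * (e + 4 * eta N) * (t - s).
  have ts1 : t - s <= 1.
    by move: ns tn; rewrite /node -(natr1 n.+1); lra.
  have ts0 : 0 <= t - s by rewrite subr_ge0.
  have := step_loss_ge0 N n; rewrite /step_loss /mu; set A := err_bound _ _ _ _ _ _ _ _.
  set D := \sum_(j < N) _ => L0; nra.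
have P0 x : s <= x <= t -> 0 <= P x by move=> /PY[].
have YP x : s <= x <= t -> Y1 x ^+ 2 + Y2 x ^+ 2 <= P x ^+ 2 by move=> /PY[].
have HP' : {ae leb, forall x, s < x < t -> exists p' y1' y2' nu : R,
  [/\ [/\ is_derive x 1 P p', is_derive x 1 Y1 y1', is_derive x 1 Y2 y2' & is_derive x 1 M nu],
      0 <= nu,
      `|p' - 2 * (complex.Re (q x) * Y1 x + complex.Im (q x) * Y2 x)| <= mu * P x + nu,
      `|y1' - (2 * E * Y2 x + 2 * complex.Re (q x) * P x)| <= mu * P x + nu &
      `|y2' - (- 2 * E * Y1 x + 2 * complex.Im (q x) * P x)| <= mu * P x + nu]}.
  apply: (ae_imp HP) => x H sxt; have [p' [y1' [y2' [nu [ders nu0 h1 h2 h3]]]]] := H sxt.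
  have sxt' : s <= x <= t by case/andP: sxt => /ltW -> /ltW ->.
  have := phi_app N (nx _ sxt'); set D := _ + eta N => hD.
  have Pp := P0 _ sxt'; have YPx := YP _ sxt'.
  have d1 := le_trans (cmod_Re _) hD; have d2 := le_trans (cmod_Im _) hD.
  move: d1 d2; rewrite Re_imulB Im_imulB -/(q x).
  have [Y1P Y2P] := sqr_sum_le_norm Pp YPx.
  set f1 := complex.Re (q x) in h1 h2 h3 *; set f2 := complex.Im (q x) in h1 h2 h3 *.
  set w1 := complex.Re (phi x) in h1 h2 h3 *; set w2 := complex.Im (phi x) in h1 h2 h3 *.
  move=> d1 d2; exists p', y1', y2', nu; split => //; rewrite /mu -/D.
  - exact: perturb_dot h1.
  - exact: perturb_scal h2.
  - exact: perturb_scal h3.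
have [h1 h2] := energy_step st (err_bound_ge0 N n) mu0 acP acY1 acY2 P0 YP K4 dK1 dK2 rh qB ndM HP'.
have MM : 0 <= 10 * M t - 10 * M s by rewrite subr_ge0 ler_pM2l//; exact: ndM.
have G0 x : s <= x <= t -> 0 <= level_energy P Y1 Y2 N n x.
  move=> xst; have [b1 _] := energy_bounds (P0 _ xst) (YP _ xst) (K4 _ xst).
  by rewrite -(pmulr_rge0 (x := 4))// (le_trans (P0 _ xst)).
have sst : s <= s <= t by rewrite lexx.
have tst : s <= t <= t by rewrite lexx st.
split; [apply: (le_trans h1)|apply: (le_trans h2)]; apply: ler_wpM2r; rewrite ?ler_expR//.
  by rewrite addr_ge0//; exact: G0.
by rewrite addr_ge0//; exact: G0.
Qed.

Lemma level_energy_node P Y1 Y2 N n :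
  level_energy P Y1 Y2 N n (node n.+1) = level_energy P Y1 Y2 N n.+1 (node n.+1).
Proof.
rewrite /level_energy (_ : ric p c theta g E N n (node n.+1) = ric p c theta g E N n.+1 (node n.+1))//.
by apply: eq_bigr => t _; rewrite tprod_node.
Qed.

Lemma level_chain X N i k (a b e : R) P Y1 Y2 M :
  (forall n N x, (X <= n)%N -> @node R n <= x <= node n.+1 -> cmod (ric p c theta g E N n x) <= 1 / 2) ->
  (X <= i)%N -> (i <= k)%N -> node i <= a -> a <= node i.+1 -> a <= b ->
  node k <= b -> b <= node k.+1 -> 0 <= e -> energy_system phi E e a b P Y1 Y2 M ->
  let L := \sum_(n < k.+1) step_loss N n + 40 * (e + 4 * eta N) * (b - a) in
  level_energy P Y1 Y2 N k b <= expR L * (level_energy P Y1 Y2 N i a + (10 * M b - 10 * M a)) /\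
  level_energy P Y1 Y2 N i a <= expR L * (level_energy P Y1 Y2 N k b + (10 * M b - 10 * M a)).
Proof.
move=> small Xi; elim: k b => [|k IH] b ik ia ai ab kb bk e0 sys L.
  move: ik; rewrite leqn0 => /eqP i0; subst i.
  have := level_step N small Xi ia ab bk e0 sys; rewrite /L big_ord1; exact.
have r0 : 0 <= 40 * (e + 4 * eta N) by rewrite mulr_ge0// addr_ge0// mulr_ge0.
have G0 n x : (X <= n)%N -> node n <= x <= node n.+1 -> a <= x <= b -> 0 <= level_energy P Y1 Y2 N n x.
  move=> Xn nx axb; have [_ PY _ _] := sys; have [P0 YP] := PY _ axb.
  have K4 : complex.Re (ric p c theta g E N n x) ^+ 2 + complex.Im (ric p c theta g E N n x) ^+ 2 <= 1 / 4.
    rewrite -cmod_sqr (_ : 1 / 4 = (1 / 2) ^+ 2); last by field.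
    by apply: lerXn2r; rewrite ?nnegrE ?cmod_ge0// small.
  have [b1 _] := energy_bounds P0 YP K4.
  by rewrite -(pmulr_rge0 (x := 4))// (le_trans P0).
have aa : a <= a <= b by rewrite lexx.
have bb : a <= b <= b by rewrite lexx ab.
have [_ _ ndM _] := sys.
move: (ik); rewrite leq_eqVlt => /orP[/eqP ik1|]; last rewrite ltnS => ik'.
  subst i; have [h1 h2] := level_step N small Xi ia ab bk e0 sys.
  have LL : step_loss N k.+1 + 40 * (e + 4 * eta N) * (b - a) <= L.
    by rewrite /L lerD2r big_ord_recr /= lerDr; apply: sumr_ge0 => n _; exact: step_loss_ge0.
  have MM : 0 <= 10 * M b - 10 * M a by rewrite subr_ge0 ler_pM2l//; exact: ndM.
  split; [apply: (le_trans h1)|apply: (le_trans h2)]; apply: ler_wpM2r; rewrite ?ler_expR//.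
    by rewrite addr_ge0// G0// ia ai.
  by rewrite addr_ge0// G0// kb bk.
pose y : R := node k.+1.
have ay : a <= y by rewrite (le_trans ai)// /y /node ler_nat !ltnS.
have ky : node k <= y by rewrite /y /node ler_nat.
have [a1 a2] := IH y ik' ia ai ay ky (lexx _) e0 (energy_system_sub (lexx a) kb sys).
have Xk : (X <= k.+1)%N by rewrite (leq_trans Xi)// leqW.
have [b1 b2] := level_step N small Xk (lexx _) kb bk e0 (energy_system_sub ay (lexx b) sys).
rewrite level_energy_node -/y in a1 a2; rewrite -/y in b1 b2.
set A := expR _ in a1 a2; set B := expR _ in b1 b2.
have LE : expR L = A * B.
  rewrite /A /B -expRD /L big_ord_recr /=; congr expR; ring.
have A1 : 1 <= A.
  rewrite -expR0 ler_expR addr_ge0//; last by rewrite mulr_ge0// subr_ge0.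
  by apply: sumr_ge0 => n _; exact: step_loss_ge0.
have B1 : 1 <= B by rewrite -expR0 ler_expR addr_ge0 ?step_loss_ge0// mulr_ge0// subr_ge0.
have M1 := ndM _ _ (lexx a) ay kb; have M2 := ndM _ _ ay kb (lexx b).
have A0 : 0 <= A by exact: le_trans A1.
have B0 : 0 <= B by exact: le_trans B1.
rewrite LE; have -> : 10 * M b - 10 * M a = (10 * M y - 10 * M a) + (10 * M b - 10 * M y) by ring.
split; first by apply: chain_bound b1 a1 => //; rewrite subr_ge0 ler_pM2l.
rewrite [A * B]mulrC [_ + (10 * M b - _)]addrC.
by apply: chain_bound a2 b2 => //; rewrite subr_ge0 ler_pM2l.
Qed.

(** Beyond the node [X], which does not depend on [N], the energy is comparable with [P] and its
    losses are summable over the cells. The part before [X] is bounded in length and needs no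
    cancellation. *)
Lemma energy_apriori : exists2 C : R, 1 <= C &
  forall (e a b : R) P Y1 Y2 M, 0 <= e -> 0 <= a -> a <= b ->
    energy_system phi E e a b P Y1 Y2 M ->
    P b <= C * expR (C * e * (b - a)) * (P a + (M b - M a)) /\
    P a <= C * expR (C * e * (b - a)) * (P b + (M b - M a)).
Proof.
have [X small] := ric_small.
pose H := 96 * err_total + 160 * (C0 * K0) + 1.
have K0p := K0_ge0; have C0p := C0_ge0.
have H0 : 0 <= H.
  have := sum_step_loss 0 0; rewrite big_ord0 /H; lra.
pose T : R := node X.
have T0 : 0 <= T by rewrite /T /node.
(* With [K = 0] the energy is [P] itself and the whole potential counts as an error of size [C0];
   this costs the exponent [160 * C0 * T], with [160 = 40 * 4]. *)
have stage1 (e a b : R) P Y1 Y2 M : 0 <= e -> 0 <= a -> a <= b -> b <= T ->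
    energy_system phi E e a b P Y1 Y2 M ->
    P b <= 10 * expR (160 * C0 * T) * expR (40 * e * (b - a)) * (P a + (M b - M a)) /\
    P a <= 10 * expR (160 * C0 * T) * expR (40 * e * (b - a)) * (P b + (M b - M a)).
  move=> e0 a0 ab bT [[acP acY1 acY2] PY ndM HP].
  have mu0 : 0 <= e + 4 * C0 by rewrite addr_ge0// mulr_ge0.
  have P0 x : a <= x <= b -> 0 <= P x by move=> /PY[].
  have YP x : a <= x <= b -> Y1 x ^+ 2 + Y2 x ^+ 2 <= P x ^+ 2 by move=> /PY[].
  have [|||||||h1 h2] := @energy_step R a b E 0 (e + 4 * C0) 0 P Y1 Y2 (fun=> 0) (fun=> 0) (fun=> 0) (fun=> 0)
    (fun=> 0) (fun=> 0) M ab (lexx 0) mu0 acP acY1 acY2 P0 YP.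
  - by move=> x _; rewrite expr0n addr0 divr_ge0.
  - by move=> x _; rewrite !(mulr0, mul0r, expr0n, addr0, subr0); exact: is_derive_cst.
  - by move=> x _; rewrite !(mulr0, mul0r, expr0n, addr0, subr0); exact: is_derive_cst.
  - by move=> x _; rewrite normr0.
  - by move=> x _; rewrite normr0.
  - exact: ndM.
  - apply: (ae_imp HP) => x Hx axb; have [p' [y1' [y2' [nu [ders nu0 h1 h2 h3]]]]] := Hx axb.
    have x0 : 0 < x by case/andP: axb => /(le_lt_trans a0).
    have axb' : a <= x <= b by case/andP: axb => /ltW -> /ltW ->.
    have d1 := le_trans (cmod_Re _) (phiB x0); have d2 := le_trans (cmod_Im _) (phiB x0).
    have Pp := P0 _ axb'; have YPx := YP _ axb'.
    have [Y1P Y2P] := sqr_sum_le_norm Pp YPx.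
    set w1 := complex.Re (phi x) in d1 h1 h2 h3 *; set w2 := complex.Im (phi x) in d2 h1 h2 h3 *.
    have {}d1 : `|w1 - 0| <= C0 by rewrite subr0.
    have {}d2 : `|- w2 - 0| <= C0 by rewrite subr0 normrN.
    exists p', y1', y2', nu; split => //.
    + exact: perturb_dot h1.
    + exact: perturb_scal h2.
    + exact: perturb_scal h3.
  rewrite !energy0 in h1 h2.
  have fac : expR ((96 * 0 + 40 * (e + 4 * C0)) * (b - a)) <= expR (160 * C0 * T) * expR (40 * e * (b - a)).
    rewrite -expRD ler_expR mulr0 add0r.
    have : 160 * C0 * (b - a) <= 160 * C0 * T by rewrite ler_wpM2l ?mulr_ge0//; lra.
    lra.
  have MM : 0 <= M b - M a by rewrite subr_ge0; exact: ndM.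
  have Pa : 0 <= P a by apply: P0; rewrite lexx.
  have Pb : 0 <= P b by apply: P0; rewrite lexx ab.
  set F1 := expR _ in fac h1 h2; set F2 := expR (160 * C0 * T) * expR (40 * e * (b - a)) in fac.
  have F10 : 0 <= F1 by exact: expR_ge0.
  rewrite -!mulrBr in h1 h2; rewrite -!(mulrA 10) -/F2.
  by split; [exact: scale_bound h1|exact: scale_bound h2].
have stage2 (e a b : R) P Y1 Y2 M : 0 <= e -> T <= a -> a <= b ->
    energy_system phi E e a b P Y1 Y2 M ->
    P b <= 40 * expR H * expR (40 * e * (b - a)) * (P a + (M b - M a)) /\
    P a <= 40 * expR H * expR (40 * e * (b - a)) * (P b + (M b - M a)).
  move=> e0 Ta ab sys.
  have [_ PY ndM _] := sys.
  have level z : T <= z -> exists2 i, (X <= i)%N & node i <= z <= node i.+1.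
    move=> Tz; have z0 : 0 <= z by exact: le_trans Tz.
    have := truncn_itv z0; set j := Num.truncn z => /andP[jz zj].
    have Xj : (X < j)%N.
      by rewrite -ltnS -(ltr_nat R); apply: le_lt_trans zj.
    exists j.-1; first by rewrite -ltnS prednK// (leq_trans _ Xj).
    by rewrite /node prednK ?(leq_trans _ Xj)// jz ltW.
  have [i Xi /andP[ia ai]] := level a Ta.
  have [k Xk /andP[kb bk]] := level b (le_trans Ta ab).
  have ik : (i <= k.+1)%N.
    by have := le_trans ia (le_trans ab bk); rewrite /node ler_nat.
  (* Here [N] is finally fixed, depending on the length of the interval: then
     [160 * eta N * (b - a) <= 1], which is the summand 1 in [H]. *)
  have [N etaN] : exists N, eta N <= (160 * (b - a) + 1)^-1.
    by apply: eta_cvg; rewrite invr_gt0; have : 0 <= b - a by [rewrite subr_ge0]; lra.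
  (* If [i = k.+1], then [a] and [b] both equal [node k.+1], which also belongs to the cell
     [k.+1]. *)
  wlog ik' : k Xk kb bk ik / (i <= k)%N.
    move=> W; have [ik'|ki] := leqP i k; first exact: (W k).
    have ik1 : i = k.+1 by apply/eqP; rewrite eqn_leq ik ki.
    apply: (W k.+1) => //; first exact: leqW.
    - by rewrite -ik1 (le_trans ia).
    - by rewrite (le_trans bk)// /node ler_nat.
    - by rewrite ik1 leqW.
  have [h1 h2] := level_chain N small Xi ik' ia ai ab kb bk e0 sys.
  have aab : a <= a <= b by rewrite lexx.
  have bab : a <= b <= b by rewrite lexx ab.
  have [Pa YPa] := PY _ aab; have [Pb YPb] := PY _ bab.
  have K4 n x : (X <= n)%N -> node n <= x <= node n.+1 ->
      complex.Re (ric p c theta g E N n x) ^+ 2 + complex.Im (ric p c theta g E N n x) ^+ 2 <= 1 / 4.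
    move=> Xn nx; rewrite -cmod_sqr (_ : 1 / 4 = (1 / 2) ^+ 2); last by field.
    by apply: lerXn2r; rewrite ?nnegrE ?cmod_ge0// small.
  have iaai : node i <= a <= node i.+1 by rewrite ia.
  have kbbk : node k <= b <= node k.+1 by rewrite kb.
  have [a1 a2] := energy_bounds Pa YPa (K4 _ _ Xi iaai).
  have [b1 b2] := energy_bounds Pb YPb (K4 _ _ Xk kbbk).
  rewrite -/(level_energy P Y1 Y2 N i a) in a1 a2; rewrite -/(level_energy P Y1 Y2 N k b) in b1 b2.
  have fac : expR (\sum_(n < k.+1) step_loss N n + 40 * (e + 4 * eta N) * (b - a)) <= expR H * expR (40 * e * (b - a)).
    rewrite -expRD ler_expR /H.
    have := sum_step_loss N k.+1.
    have ba0 : 0 <= b - a by rewrite subr_ge0.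
    have D0 : 0 < 160 * (b - a) + 1 by lra.
    have : eta N * (160 * (b - a) + 1) <= 1 by rewrite -ler_pdivlMr// mul1r.
    have := eta0 N; lra.
  have MM : 0 <= M b - M a by rewrite subr_ge0; exact: ndM.
  set F1 := expR (\sum_(n < k.+1) _ + _) in fac h1 h2; set F2 := expR H * _ in fac.
  have F10 : 0 <= F1 by exact: expR_ge0.
  have -> : 40 * expR H * expR (40 * e * (b - a)) = 40 * F2 by rewrite /F2 mulrA.
  rewrite -!mulrBr in h1 h2.
  have G0 x N' n : 0 <= P x -> P x <= 4 * level_energy P Y1 Y2 N' n x -> 0 <= level_energy P Y1 Y2 N' n x.
    by move=> Px h; rewrite -(pmulr_rge0 (x := 4))// (le_trans Px).
  split; first exact: (scale_bound4 F10 fac Pa MM (G0 _ _ _ Pa a1) b1 h1 a2).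
  exact: (scale_bound4 F10 fac Pb MM (G0 _ _ _ Pb b1) a1 h2 b2).
pose A := 10 * expR (160 * C0 * T); pose B := 40 * expR H.
have A1 : 1 <= A.
  have : 1 <= expR (160 * C0 * T) by rewrite -expR0 ler_expR !mulr_ge0.
  rewrite /A; lra.
have B1 : 40 <= B.
  have : 1 <= expR H by rewrite -expR0 ler_expR.
  rewrite /B; lra.
exists (A * B); first by nra.
move=> e a b P Y1 Y2 M e0 a0 ab sys.
have AB : A <= A * B /\ B <= A * B by split; nra.
have AB40 : 40 <= A * B by nra.
have [_ PY ndM _] := sys.
have P0 x : a <= x <= b -> 0 <= P x by move=> /PY[].
have MM : 0 <= M b - M a by rewrite subr_ge0; exact: ndM.
have fac x : 0 <= x -> expR (40 * e * x) <= expR (A * B * e * x).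
  by move=> x0; rewrite ler_expR ler_wpM2r// ler_wpM2r.
have ba0 : 0 <= b - a by rewrite subr_ge0.
have fba := fac _ ba0.
have Pa : 0 <= P a by apply: P0; rewrite lexx.
have Pb : 0 <= P b by apply: P0; rewrite lexx ab.
have up (D x y : R) : D <= A * B -> 0 <= D -> 0 <= y -> x <= D * expR (40 * e * (b - a)) * y ->
    x <= A * B * expR (A * B * e * (b - a)) * y.
  move=> DAB D0 y0 h; apply: (le_trans h); apply: ler_wpM2r => //; apply: ler_pM => //; exact: expR_ge0.
have A0 : 0 <= A by exact: le_trans A1.
have B0 : 0 <= B by exact: le_trans B1.
have [bT|Tb] := leP b T.
  have [h1 h2] := stage1 _ _ _ _ _ _ _ e0 a0 ab bT sys.
  split; [exact: (up A _ _ AB.1 A0 (addr_ge0 Pa MM) h1)|exact: (up A _ _ AB.1 A0 (addr_ge0 Pb MM) h2)].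
have [Ta|aT] := leP T a.
  have [h1 h2] := stage2 _ _ _ _ _ _ _ e0 Ta ab sys.
  split; [exact: (up B _ _ AB.2 B0 (addr_ge0 Pa MM) h1)|exact: (up B _ _ AB.2 B0 (addr_ge0 Pb MM) h2)].
have aT' := ltW aT; have Tb' := ltW Tb.
have [h1 h2] := stage1 _ _ _ _ _ _ _ e0 a0 aT' (lexx T) (energy_system_sub (lexx a) Tb' sys).
have [h3 h4] := stage2 _ _ _ _ _ _ _ e0 (lexx T) Tb' (energy_system_sub aT' (lexx b) sys).
have M1 := ndM _ _ (lexx a) aT' Tb'; have M2 := ndM _ _ aT' Tb' (lexx b).
have PT : 0 <= P T by apply: P0; rewrite aT'.
rewrite -/A -/B in h1 h2 h3 h4.
have eE : expR (40 * e * (b - a)) = expR (40 * e * (T - a)) * expR (40 * e * (b - T)).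
  by rewrite -expRD; congr expR; ring.
set u := expR (40 * e * (T - a)) in h1 h2 eE; set w := expR (40 * e * (b - T)) in h3 h4 eE.
have u1 : 1 <= u by rewrite -expR0 ler_expR !mulr_ge0// subr_ge0.
have w1 : 1 <= w by rewrite -expR0 ler_expR !mulr_ge0// subr_ge0.
have AU : 1 <= A * u by rewrite -[leLHS]mulr1; apply: ler_pM.
have BW : 1 <= B * w by rewrite -[leLHS]mulr1; apply: ler_pM => //; apply: le_trans B1; rewrite ler1n.
have BW0 : 0 <= B * w by exact: le_trans BW.
have AU0 : 0 <= A * u by exact: le_trans AU.
have MT : M b - M a = (M T - M a) + (M b - M T) by ring.
have ABE : A * B * (u * w) = A * u * (B * w) by ring.
split; [apply: (up (A * B) _ _ (lexx _) (mulr_ge0 A0 B0) (addr_ge0 Pa MM))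
       |apply: (up (A * B) _ _ (lexx _) (mulr_ge0 A0 B0) (addr_ge0 Pb MM))]; rewrite eE ABE MT.
  by apply: chain_bound h3 h1 => //; rewrite subr_ge0.
rewrite [A * u * _]mulrC [_ + (M b - _)]addrC.
by apply: chain_bound h2 h4 => //; rewrite subr_ge0.
Qed.

End GoodEnergy.
End Apriori.

(** * Finiteness of Riesz potentials *)

Lemma int_dist_le1 (i j : int) : i < j + 2 -> j < i + 2 -> `|j - i| <= 1.
Proof. lia. Qed.

Section RieszPotential.
Context {R : realType}.
Context (l : nat -> seq (R * R)) (W beta s sigma : R).
Context (w0 : forall N wb, wb \in l N -> 0 < wb.1).
Context (mono : forall N N' (F : R -> R), (N <= N')%N -> (forall x, 0 <= F x) ->
  \sum_(wb <- l N) wb.1 * F wb.2 <= \sum_(wb <- l N') wb.1 * F wb.2).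
Context (mass : forall N, \sum_(wb <- l N) wb.1 <= W).
Context (beta0 : 0 < beta) (betas : beta < s) (ssigma : s < sigma).

Definition dyadic (n : nat) (x : R) : int := Num.floor (x * 2 ^+ n).
Definition near_cell n (i : int) (x : R) : R := ((`|dyadic n x - i| <= 1)%R : bool)%:R.
Let q : R := 2 `^ (- s).
Let rho : R := 2 `^ beta.
Let tau : R := 2 `^ (- sigma).

(** The mass of a dyadic cell together with its two neighbours is compared with [2^(- s n)]; the
    neighbours are included because a point at distance less than [2^(- n)] may fall into an
    adjacent cell. The choice [beta < s] makes the potential converge where heavy cells stop
    occurring, and [s < sigma] makes the [sigma]-th powers of the lengths of the heavy cells
    summable. *)
Definition heavy n (i : int) : Prop :=
  exists N, q ^+ n <= \sum_(wb <- l N) wb.1 * near_cell n i wb.2.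

Lemma W_ge0 : 0 <= W.
Proof.
apply: le_trans (mass 0); rewrite big_seq; apply: sumr_ge0 => wb h; exact: ltW (w0 h).
Qed.

Let q0 : 0 < q. Proof. exact: powR_gt0. Qed.
Let rho0 : 0 < rho. Proof. exact: powR_gt0. Qed.
Let tau0 : 0 < tau. Proof. exact: powR_gt0. Qed.

Let pow2_lt1 (x : R) : x < 0 -> 2 `^ x < 1.
Proof.
move=> x0; rewrite -[x]opprK powRN invf_lt1 ?powR_gt0//.
have : 1 `^ (- x) < 2 `^ (- x) by apply: gt0_ltr_powR; rewrite ?oppr_gt0 ?nnegrE ?ltr1n.
by rewrite powR1.
Qed.

Let rhoq1 : rho * q < 1.
Proof. by rewrite /rho /q -powRD ?pnatr_eq0 ?implybT//; apply: pow2_lt1; rewrite subr_lt0. Qed.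

Let tauq1 : tau / q < 1.
Proof.
by rewrite /tau /q -powRN opprK -powRD ?pnatr_eq0 ?implybT//; apply: pow2_lt1; rewrite addrC subr_lt0.
Qed.

Lemma near_cell_ge0 n i x : 0 <= near_cell n i x.
Proof. by rewrite /near_cell ler0n. Qed.

Lemma count_near (u : seq int) n x : uniq u -> \sum_(i <- u) near_cell n i x <= 3.
Proof.
move=> uu; rewrite /near_cell -natr_sum ler_nat -big_mkcond /= sum1_count -size_filter.
set d := dyadic n x.
have sub : {subset [seq i <- u | `|d - i| <= 1] <= [:: d - 1; d; d + 1]}.
  by move=> i; rewrite mem_filter !inE => /andP[h _]; lia.
by have := uniq_leq_size (filter_uniq _ uu) sub.
Qed.

(** By monotonicity finitely many heavy cells are heavy for a common [N], and each atom is counted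
    for at most three cells. *)
Lemma heavy_size n (u : seq int) : uniq u -> (forall i, i \in u -> heavy n i) ->
  (size u)%:R * q ^+ n <= 3 * W.
Proof.
move=> uu uh.
have [N HN] : exists N, forall i, i \in u -> q ^+ n <= \sum_(wb <- l N) wb.1 * near_cell n i wb.2.
  elim: u {uu} uh => [|i u IH] uh; first by exists 0%N.
  have [N HN] : exists N, forall i, i \in u -> q ^+ n <= \sum_(wb <- l N) wb.1 * near_cell n i wb.2.
    by apply: IH => j ju; apply: uh; rewrite in_cons ju orbT.
  have [N' HN'] := uh i (mem_head _ _).
  exists (maxn N N') => j; rewrite in_cons => /orP[/eqP ->|/HN h].
    by apply: (le_trans HN'); apply: mono; [exact: leq_maxr|exact: near_cell_ge0].
  by apply: (le_trans h); apply: mono; [exact: leq_maxl|exact: near_cell_ge0].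
apply: (@le_trans _ _ (\sum_(i <- u) \sum_(wb <- l N) wb.1 * near_cell n i wb.2)).
  have -> : (size u)%:R * q ^+ n = \sum_(i <- u) q ^+ n.
    by rewrite big_const_seq count_predT iter_addr addr0 mulr_natl.
  by rewrite big_seq [leRHS]big_seq; apply: ler_sum.
rewrite exchange_big /=; apply: (@le_trans _ _ (\sum_(wb <- l N) wb.1 * 3)).
  rewrite big_seq [leRHS]big_seq; apply: ler_sum => wb h.
  by rewrite -mulr_sumr ler_wpM2l ?count_near// (ltW (w0 h)).
by rewrite -mulr_suml mulrC ler_wpM2l.
Qed.

Lemma heavy_finite n : exists2 u : seq int, uniq u & (forall i, heavy n i <-> i \in u).
Proof.
apply: contrapT => nou.
have long k : exists u : seq int, [/\ uniq u, (forall i, i \in u -> heavy n i) & size u = k].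
  elim: k => [|k [u [uu uh us]]]; first by exists [::].
  have [i hi iu] : exists2 i, heavy n i & i \notin u.
    apply: contrapT => no; apply: nou; exists u => // i; split => [hi|]; last exact: uh.
    by apply: contrapT => /negP iu; apply: no; exists i.
  exists (i :: u); split => /=; [by rewrite iu| |by rewrite us].
  by move=> j; rewrite in_cons => /orP[/eqP ->|/uh].
have qn : 0 < q ^+ n by rewrite exprn_gt0.
have W0 := W_ge0.
have [u [uu uh us]] := long (Num.truncn (3 * W / q ^+ n)).+1.
have := heavy_size uu uh; rewrite us leNgt => /negP; apply.
rewrite -ltr_pdivrMr//.
by have /truncn_itv/andP[_] : 0 <= 3 * W / q ^+ n by rewrite divr_ge0 ?mulr_ge0// ltW.
Qed.

Definition light (E : R) : Prop := exists n0, forall n, (n0 <= n)%N -> ~ heavy n (dyadic n E).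

Lemma near_cellE n (E b : R) : `|E - b| * 2 ^+ n < 1 -> near_cell n (dyadic n E) b = 1.
Proof.
move=> h; rewrite /near_cell (_ : _ <= _)//; rewrite -(ler_int R) /dyadic.
set x := E * 2 ^+ n; set y := b * 2 ^+ n.
have xy : `|x - y| < 1 by rewrite /x /y -mulrBl normrM (ger0_norm (_ : 0 <= 2 ^+ n)).
have := floor_itv x; have := floor_itv y => /andP[y1 y2] /andP[x1 x2].
move: xy; rewrite ltr_norml => /andP[h1 h2].
have a1 : Num.floor x < Num.floor y + 2.
  rewrite -(ltr_int R) intrD /=; move: y2; rewrite intrD /=; lra.
have a2 : Num.floor y < Num.floor x + 2.
  rewrite -(ltr_int R) intrD /=; move: x2; rewrite intrD /=; lra.
by rewrite ler_int; exact: int_dist_le1.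
Qed.

Lemma geometric_le (r : R) n : 0 <= r -> r < 1 -> \sum_(i < n) r ^+ i <= (1 - r)^-1.
Proof.
move=> r0 r1; have h : 0 < 1 - r by rewrite subr_gt0.
rewrite -[leRHS]mul1r ler_pdivlMr//.
suff -> : (\sum_(i < n) r ^+ i) * (1 - r) = 1 - r ^+ n by rewrite lerBlDr lerDl exprn_ge0.
by elim: n => [|n IH]; rewrite ?big_ord0 ?expr0 ?subrr ?mul0r// big_ord_recr /= mulrDl IH exprS; ring.
Qed.

(** The cells containing an atom of weight [w] are heavy as soon as [q ^+ n <= w]. Applied to the
    half frequencies this excludes resonances. *)
Lemma light_ne E N wb : light E -> wb \in l N -> wb.2 != E.
Proof.
move=> [n0 H] h; apply/eqP => bE.
have w := w0 h.
have [n nn0 qn] : exists2 n, (n0 <= n)%N & q ^+ n <= wb.1.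
  have q1 : `|q| < 1 by rewrite gtr0_norm//; apply: pow2_lt1; rewrite oppr_lt0 (lt_trans beta0).
  have /cvgrPdist_le /(_ _ w) [n1 _ Hn] := cvg_expr q1.
  exists (maxn n0 n1); first exact: leq_maxl.
  have := Hn (maxn n0 n1) (leq_maxr _ _); rewrite sub0r normrN ger0_norm//.
  by rewrite exprn_ge0// ltW.
apply: (H n nn0); exists N; apply: (le_trans qn).
rewrite (big_rem wb h) /= bE near_cellE ?subrr ?normr0 ?mul0r// mulr1 lerDl.
rewrite big_seq; apply: sumr_ge0 => v /mem_rem vl; rewrite mulr_ge0 ?near_cell_ge0// ltW//.
exact: w0 vl.
Qed.

Lemma powR_le_rho (x : R) n : 0 < x -> 1 <= x * 2 ^+ n -> x `^ (- beta) <= rho ^+ n.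
Proof.
move=> x0 xn; have -> : rho ^+ n = (2 ^+ n) `^ beta.
  by rewrite -[in RHS](powR_mulrn n (ler0n R 2)) -powRrM mulrC powRrM powR_mulrn ?powR_ge0.
rewrite powRN -[leLHS]mul1r ler_pdivrMr ?powR_gt0// -powRM ?(ltW x0)// mulrC.
have : 1 `^ beta <= (x * 2 ^+ n) `^ beta.
  by apply: ge0_ler_powR; rewrite ?nnegrE ?(ltW beta0)// mulr_ge0 ?(ltW x0).
by rewrite powR1.
Qed.

(** If [|E - b|] lies between [2^(- n - 1)] and [2^(- n)], the single term of index [n] already
    dominates the left-hand side; the term [rho ^+ n0] is for points at distance at least
    [2^(- n0)]. *)
Lemma powR_le_cells E b n0 n1 : b != E -> (n0 <= n1)%N -> 1 <= `|E - b| * 2 ^+ n1 ->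
  `|E - b| `^ (- beta) <= rho ^+ n0 + \sum_(n0 <= n < n1) rho ^+ n.+1 * near_cell n (dyadic n E) b.
Proof.
move=> bE n01 h1; have d0 : 0 < `|E - b| by rewrite normr_gt0 subr_eq0 eq_sym.
have S0 (m n : nat) : 0 <= \sum_(m <= i < n) rho ^+ i.+1 * near_cell i (dyadic i E) b.
  by apply: sumr_ge0 => i _; rewrite mulr_ge0 ?near_cell_ge0// exprn_ge0// ltW.
elim: n1 n01 h1 => [|n1 IH] n01 h1.
  by move: n01; rewrite leqn0 => /eqP ->; rewrite (le_trans (powR_le_rho d0 h1))// lerDl.
move: n01; rewrite leq_eqVlt => /orP[/eqP n0E|n01].
  by rewrite n0E (le_trans (powR_le_rho d0 h1))// lerDl.
have [h2|h2] := leP 1 (`|E - b| * 2 ^+ n1).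
  rewrite big_nat_recr//= addrA (le_trans (IH n01 h2))// lerDl.
  by rewrite mulr_ge0 ?near_cell_ge0// exprn_ge0// ltW.
rewrite (le_trans (powR_le_rho d0 h1))// big_nat_recr//= near_cellE// mulr1 addrA lerDr addr_ge0//.
by rewrite exprn_ge0// ltW.
Qed.

(** Integrating the dyadic bound against the measure, generation [n] contributes at most
    [rho ^+ n.+1 * q ^+ n] because the cell of [E] is not heavy, and [rho * q < 1]. *)
Lemma light_bounded E : light E -> exists K, forall N,
  \sum_(wb <- l N) wb.1 * `|E - wb.2| `^ (- beta) <= K.
Proof.
move=> lE; have [n0 H] := lE.
exists (rho ^+ n0 * W + rho * (1 - rho * q)^-1) => N.
(* The generation [n1] separates [E] from the finitely many atoms of [l N]. It depends on [N], but
   the geometric series makes the final bound independent of it. *)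
have [n1 n01 Hn1] : exists2 n1, (n0 <= n1)%N & forall wb, wb \in l N -> 1 <= `|E - wb.2| * 2 ^+ n1.
  have : forall wb, wb \in l N -> wb.2 != E by move=> wb; exact: light_ne.
  elim: (l N) => [|wb t IH] ne; first by exists n0.
  have [n1 n01 Hn1] : exists2 n1, (n0 <= n1)%N & forall wb, wb \in t -> 1 <= `|E - wb.2| * 2 ^+ n1.
    by apply: IH => v vt; apply: ne; rewrite in_cons vt orbT.
  have d0 : 0 < `|E - wb.2| by rewrite normr_gt0 subr_eq0 eq_sym ne ?mem_head.
  pose n2 := (Num.truncn (`|E - wb.2|^-1)).+1.
  have n2P : 1 <= `|E - wb.2| * 2 ^+ n2.
    rewrite -ler_pdivrMl// mulr1; have /truncn_itv/andP[_ lt] : 0 <= `|E - wb.2|^-1 by rewrite invr_ge0 ltW.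
    rewrite (le_trans (ltW lt))// -natrX ler_nat ltnW//; exact: ltn_expl.
  exists (maxn n1 n2); first by rewrite (leq_trans n01)// leq_maxl.
  move=> v; rewrite in_cons => /orP[/eqP ->|/Hn1 h]; [apply: (le_trans n2P)|apply: (le_trans h)];
    by rewrite ler_wpM2l// ler_weXn2l ?ler1n// leq_max leqnn ?orbT.
apply: (@le_trans _ _ (\sum_(wb <- l N) wb.1 * (rho ^+ n0 +
    \sum_(n0 <= n < n1) rho ^+ n.+1 * near_cell n (dyadic n E) wb.2))).
  rewrite big_seq [leRHS]big_seq; apply: ler_sum => wb h; apply: ler_wpM2l; first exact: ltW (w0 h).
  by apply: powR_le_cells => //; [exact: light_ne lE h|exact: Hn1].
under eq_bigr do rewrite mulrDr mulr_sumr.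
rewrite big_split /= -mulr_suml mulrC; apply: lerD.
  by rewrite ler_wpM2l// exprn_ge0// ltW.
rewrite exchange_big /=; apply: (@le_trans _ _ (\sum_(n0 <= n < n1) rho * (rho * q) ^+ n)).
  rewrite big_seq [leRHS]big_seq; apply: ler_sum => n; rewrite mem_index_iota => /andP[nn _].
  under eq_bigr do rewrite mulrCA.
  rewrite -mulr_sumr exprS -mulrA exprMn ler_wpM2l ?(ltW rho0)// ler_wpM2l//.
    by rewrite exprn_ge0// ltW.
  by rewrite leNgt; apply/negP => lt; apply: (H n nn); exists N; exact: ltW.
rewrite -mulr_sumr ler_wpM2l ?(ltW rho0)//; apply: le_trans (geometric_le n1 _ rhoq1); last first.
  by rewrite mulr_ge0// ltW.
rewrite -(big_mkord xpredT (fun i => (rho * q) ^+ i)) (big_cat_nat (leq0n n0) n01) /= lerDr.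
by apply: sumr_ge0 => i _; rewrite exprn_ge0// mulr_ge0// ltW.
Qed.

(** A point that is not light lies in heavy cells of arbitrarily late generations. The generations
    from [n0] on therefore cover; generation [n] has at most [3 * W / q ^+ n] heavy cells of length
    [2^(- n)], so the sum is a geometric tail of ratio [tau / q < 1]. *)
Lemma not_light_cover e : 0 < e -> exists lo len : nat -> R,
  [/\ forall k, 0 <= len k <= e,
      forall E, ~ light E -> exists k, lo k <= E < lo k + len k &
      forall K, \sum_(k < K) len k `^ sigma <= e].
Proof.
move=> e0.
have [u Hu] : exists u : nat -> seq int, forall n, uniq (u n) /\ forall i, heavy n i <-> i \in u n.
  have := fun n => heavy_finite n; move=> H.
  have {}H n : exists v : seq int, uniq v /\ forall i, heavy n i <-> i \in v.
    by have [v uv hv] := H n; exists v.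
  by exists (fun n => sval (cid (H n))) => n; exact: (svalP (cid (H n))).
have s1 : 0 < 1 - tau / q by rewrite subr_gt0.
have W0 := W_ge0.
have tq0 : 0 <= tau / q by rewrite divr_ge0// ltW.
have [n0 h1 h2] : exists2 n0 : nat, 2 ^- n0 <= e & 3 * W * (tau / q) ^+ n0 * (1 - tau / q)^-1 <= e.
  have hlf : `|2^-1 : R| < 1 by rewrite ger0_norm// invf_lt1// ltr1n.
  have tq1 : `|tau / q| < 1 by rewrite ger0_norm.
  pose D := 3 * W * (1 - tau / q)^-1 + 1.
  have D0 : 0 < D by rewrite /D ltr_wpDl// mulr_ge0 ?invr_ge0 ?mulr_ge0// ltW.
  have eD : 0 < e / D by rewrite divr_gt0.
  have /cvgrPdist_le /(_ _ e0) [a1 _ Ha1] := cvg_expr hlf.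
  have /cvgrPdist_le /(_ _ eD) [a2 _ Ha2] := cvg_expr tq1.
  exists (maxn a1 a2).
    have := Ha1 (maxn a1 a2) (leq_maxl _ _); rewrite sub0r normrN exprVn ger0_norm//.
  have := Ha2 (maxn a1 a2) (leq_maxr _ _); rewrite sub0r normrN ger0_norm ?exprn_ge0//.
  rewrite ler_pdivlMr// => h; rewrite mulrAC; apply: le_trans h.
  rewrite mulrC ler_wpM2l ?exprn_ge0// /D lerDl//.
pose wd (nj : nat * nat) : R := if (n0 <= nj.1)%N && (nj.2 < size (u nj.1))%N then 2 ^- nj.1 else 0.
pose code k : nat * nat := odflt (0, 0)%N (pickle_inv k).
(* Numbers that decode to nothing get the default [(0, 0)]; [act] gives them length 0, so that the
   interval of this pair is not counted repeatedly. *)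
pose act k : bool := (pickle_inv k : option (nat * nat)) != None.
exists (fun k => (nth 0 (u (code k).1) (code k).2)%:~R / 2 ^+ (code k).1),
  (fun k => if act k then wd (code k) else 0).
split.
- move=> k; case: ifP => _; last by rewrite lexx ltW.
  rewrite /wd; case: ifP => [/andP[n0n _]|_]; last by rewrite lexx ltW.
  rewrite invr_ge0 exprn_ge0//= (le_trans _ h1)// lef_pV2 ?posrE ?exprn_gt0//.
  by rewrite ler_weXn2l// ler1n.
- move=> E nl.
  have [n n0n hn] : exists2 n, (n0 <= n)%N & heavy n (dyadic n E).
    by apply: contrapT => no; apply: nl; exists n0 => n nn hn; apply: no; exists n.
  have iu : dyadic n E \in u n by apply/(Hu n).2.
  exists (pickle (n, index (dyadic n E) (u n))).
  rewrite /act /code pickleK_inv /= /wd /= n0n index_mem iu /= nth_index//.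
  have p2 : 0 < (2 : R) ^+ n by rewrite exprn_gt0.
  have := floor_itv (E * 2 ^+ n); rewrite -/(dyadic n E) intrD /= => /andP[g1 g2].
  rewrite ler_pdivrMr// g1 /= -[X in _ + X]mul1r -mulrDl ltr_pdivlMr//.
- move=> K.
  pose F (nj : nat * nat) : R := if (n0 <= nj.1)%N && (nj.2 < size (u nj.1))%N then tau ^+ nj.1 else 0.
  have F0 nj : 0 <= F nj by rewrite /F; case: ifP => // _; rewrite exprn_ge0// ltW.
  (* Intervals of length 0 contribute nothing only for [sigma] different from 0, since the power of
     0 with exponent 0 is 1. *)
  have sg0 : sigma != 0 by rewrite gt_eqF// (lt_trans beta0)// (lt_trans betas).
  have wF nj : wd nj `^ sigma = F nj.
    rewrite /wd /F; case: ifP => _; last by rewrite powR0.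
    rewrite -powR_invn// -powRrM -powR_mulrn ?powR_ge0// /tau -powRrM; congr (2 `^ _); ring.
  pose L := pmap (pickle_inv : nat -> option (nat * nat)) (iota 0 K).
  have uL : uniq L.
    by apply: (pmap_uniq (@pickle_invK _)); exact: iota_uniq.
  apply: (@le_trans _ _ (\sum_(nj <- L) F nj)).
    rewrite -(big_mkord xpredT (fun k => (if act k then wd (code k) else 0) `^ sigma)).
    rewrite /L /index_iota subn0; elim: (iota 0 K) => [|k t IH]; first by rewrite !big_nil.
    rewrite big_cons /= /act /code; case: (pickle_inv k) => [nj|] /=.
      by rewrite big_cons wF lerD2l.
    by rewrite powR0// add0r.
  pose n1 := (\max_(nj <- L) nj.1).+1.
  pose A := [seq (n, j) | n <- iota 0 n1, j <- iota 0 (size (u n))].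
  apply: (@le_trans _ _ (\sum_(nj <- A) F nj)).
    rewrite (bigID (fun nj : nat * nat => nj.2 < size (u nj.1))%N) /=.
    rewrite [X in _ + X]big1 ?addr0; last first.
      by move=> nj /negbTE h; rewrite /F h andbF.
    rewrite -big_filter; apply: sum_subset_le => //; first exact: filter_uniq.
      apply: allpairs_uniq_dep; [exact: iota_uniq|by move=> n _; exact: iota_uniq|].
      by move=> [n j] [n' j'] _ _ /= [-> ->].
    move=> [n j]; rewrite mem_filter /= => /andP[ju jL].
    apply/allpairsPdep; exists n, j; split => //; rewrite mem_iota//= add0n.
    rewrite /n1 ltnS; exact: (@leq_bigmax_seq _ L xpredT (fun nj => nj.1) (n, j) jL isT).
  rewrite big_allpairs_dep /=.
  apply: (@le_trans _ _ (\sum_(n <- iota 0 n1) (if (n0 <= n)%N then 3 * W * (tau / q) ^+ n else 0))).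
    apply: ler_sum => n _; rewrite big_seq.
    have [nn|nn] := leqP n0 n; last first.
      by rewrite big1// => j _; rewrite /F /= leqNgt nn.
    apply: (@le_trans _ _ (\sum_(j <- iota 0 (size (u n))) tau ^+ n)).
      rewrite [leRHS]big_seq; apply: ler_sum => j; rewrite mem_iota /= add0n => ju.
      by rewrite /F /= nn ju.
    rewrite big_const_seq count_predT size_iota iter_addr addr0 -[leLHS]mulr_natl.
    have := @heavy_size n (u n) (Hu n).1 (fun i => ((Hu n).2 i).2).
    have qn : 0 < q ^+ n by rewrite exprn_gt0.
    rewrite -ler_pdivlMr// expr_div_n => h; rewrite mulrA [leRHS]mulrAC ler_wpM2r// exprn_ge0// ltW//.
  have -> : iota 0 n1 = index_iota 0 n1 by rewrite /index_iota subn0.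
  apply: le_trans h2; rewrite -big_mkcond /=.
  have [n10|n01] := leqP n1 n0.
    rewrite big_nat_cond big1; first by rewrite !mulr_ge0 ?exprn_ge0 ?invr_ge0// ltW.
    by move=> n /andP[/andP[_ nn1] n0n]; move: (leq_trans nn1 n10); rewrite ltnNge n0n.
  rewrite (big_cat_nat (leq0n n0) (ltnW n01)) /= [X in X + _]big_nat_cond [X in X + _]big1 ?add0r; last first.
    by move=> n /andP[/andP[_ nn1] n0n]; move: nn1; rewrite ltnNge n0n.
  apply: (@le_trans _ _ (\sum_(n0 <= n < n1) 3 * W * (tau / q) ^+ n)).
    rewrite big_mkcond /=; apply: ler_sum => n _; case: ifP => // _.
    by rewrite !mulr_ge0// exprn_ge0.
  rewrite -mulr_sumr -[leRHS]mulrA ler_wpM2l ?mulr_ge0//.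
  rewrite -{1}[n0]add0n big_addn big_mkord; under eq_bigr do rewrite exprD.
  by rewrite -mulr_suml mulrC ler_wpM2l ?exprn_ge0// geometric_le.
Qed.

End RieszPotential.

(** * Economical covers, Hausdorff measure and Lebesgue null sets *)

Section SmallCovers.
Context {R : realType}.
Local Notation leb := (@lebesgue_measure R).
Implicit Types (S : set R) (sigma e beta : R).

Definition small_covers sigma S : Prop := forall e, 0 < e -> exists lo len : nat -> R,
  [/\ forall k, 0 <= len k <= e,
      forall x, S x -> exists k, lo k <= x < lo k + len k &
      forall K, \sum_(k < K) len k `^ sigma <= e].

Let cell (lo len : nat -> R) (k : nat) : set R := [set x | lo k <= x < lo k + len k].

Lemma ediam_cell (lo len : nat -> R) k : 0 <= len k -> (ediam (cell lo len k) <= (len k)%:E)%E.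
Proof.
move=> l0; apply: ge_ereal_sup => y [->|[[x z] [/= /andP[x1 x2] /andP[z1 z2]] <-]].
  by rewrite lee_fin.
by rewrite lee_fin ler_norml; apply/andP; split; lra.
Qed.

Lemma ediam_ge0 (A : set R) : (0 <= ediam A)%E.
Proof. by apply: ereal_sup_ubound; left. Qed.

Lemma hausdorff_gauge_ge0 sigma (A : set R) : (0 <= hausdorff_gauge sigma A)%E.
Proof. by rewrite /hausdorff_gauge; case: ifP => // _; exact: poweR_ge0. Qed.

Lemma hausdorff_gauge_cell sigma (lo len : nat -> R) k : 0 <= sigma -> 0 <= len k ->
  (hausdorff_gauge sigma (cell lo len k) <= (len k `^ sigma)%:E)%E.
Proof.
move=> s0 l0; rewrite /hausdorff_gauge; case: ifP => _; first by rewrite lee_fin powR_ge0.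
rewrite -poweR_EFin; apply: gt0_ler_poweR => //.
- by rewrite in_itv /= ediam_ge0 leey.
- by rewrite in_itv /= lee_fin l0 leey.
- exact: ediam_cell.
Qed.

Lemma nneseries_le (u : nat -> \bar R) (C : \bar R) : (forall n, (0 <= u n)%E) ->
  (forall K, (\sum_(0 <= n < K) u n <= C)%E) -> (\sum_(0 <= n <oo) u n <= C)%E.
Proof.
move=> u0 H; apply: lime_le; first by apply: is_cvg_nneseries.
by apply: nearW.
Qed.

Lemma small_covers_hausdorff_measure0 sigma S : 0 <= sigma -> small_covers sigma S ->
  hausdorff_measure sigma S = 0%E.
Proof.
move=> s0 H; apply/eqP; rewrite eq_le; apply/andP; split.
  apply: ge_ereal_sup => _ [d /= d0 <-]; apply/lee_addgt0Pr => e e0; rewrite add0e.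
  have m0 : 0 < Num.min d e by rewrite lt_min d0.
  have [lo [len [l0 cov sum]]] := H _ m0.
  apply: ge_ereal_inf; exists (\sum_(0 <= n <oo) hausdorff_gauge sigma (cell lo len n))%E.
    exists (cell lo len) => //; split=> [x Sx|n].
      by have [k hk] := cov x Sx; exists k.
    have /andP[l1 l2] := l0 n; apply: (le_trans (ediam_cell _ l1)).
    by rewrite lee_fin (le_trans l2)// ge_min lexx.
  apply: nneseries_le => [n|K]; first exact: hausdorff_gauge_ge0.
  apply: (@le_trans _ _ (\sum_(0 <= n < K) (len n `^ sigma)%:E)%E).
    by apply: lee_sum => n _; apply: hausdorff_gauge_cell => //; case/andP: (l0 n).
  rewrite sumEFin lee_fin big_mkord (le_trans (sum K))// ge_min lexx orbT//.
apply: le_ereal_sup_tmp; exists (hausdorff_premeasure sigma 1 S).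
  by exists 1 => //=; exact: ltr01.
apply: le_ereal_inf_tmp => _ [B _ <-]; apply: nneseries_ge0 => n _ _.
exact: hausdorff_gauge_ge0.
Qed.

Lemma small_covers_hausdorff_dim beta S : 0 <= beta ->
  (forall sigma, beta < sigma -> small_covers sigma S) -> (hausdorff_dim S <= beta%:E)%E.
Proof.
move=> b0 H; apply/lee_addgt0Pr => e e0; apply: ge_ereal_inf; exists (beta + e)%:E => //.
exists (beta + e) => //; split; first by rewrite addr_ge0// ltW.
by apply: small_covers_hausdorff_measure0; rewrite ?addr_ge0 ?(ltW e0)//; apply: H; rewrite ltrDl.
Qed.

(** For lengths at most 1 and [sigma <= 1] the length is at most its [sigma]-th power, so the covers
    have arbitrarily small total length. *)
Lemma small_covers_negligible sigma S : 0 < sigma <= 1 -> small_covers sigma S ->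
  leb.-negligible S.
Proof.
move=> /andP[s0 s1] H.
have Hn n : exists ll : (nat -> R) * (nat -> R), [/\ forall k, 0 <= ll.2 k <= n.+1%:R^-1,
      forall x, S x -> exists k, ll.1 k <= x < ll.1 k + ll.2 k &
      forall K, \sum_(k < K) ll.2 k `^ sigma <= n.+1%:R^-1].
  have n0 : 0 < n.+1%:R^-1 :> R by rewrite invr_gt0.
  by have [lo [len h]] := H _ n0; exists (lo, len).
pose ll n := sval (cid (Hn n)).
have Hl n : [/\ forall k, 0 <= (ll n).2 k <= n.+1%:R^-1,
      forall x, S x -> exists k, (ll n).1 k <= x < (ll n).1 k + (ll n).2 k &
      forall K, \sum_(k < K) (ll n).2 k `^ sigma <= n.+1%:R^-1] by exact: svalP (cid (Hn n)).
pose C n k : set R := `[(ll n).1 k, (ll n).1 k + (ll n).2 k[%classic.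
have mC n k : measurable (C n k) by exact: measurable_itv.
pose U n := \bigcup_k C n k.
have mU n : measurable (U n) by apply: bigcup_measurable => k _; exact: mC.
have lebU n : (leb (U n) <= (n.+1%:R^-1)%:E)%E.
  have [l0 _ sum] := Hl n.
  have := @measure_sigma_subadditive _ _ _ leb (U n) (C n) (mC n) (mU n) (@subset_refl _ _).
  move=> h; apply: (le_trans h); apply: nneseries_le => [k|K]; first exact: measure_ge0.
  apply: (@le_trans _ _ (\sum_(0 <= k < K) ((ll n).2 k `^ sigma)%:E)%E).
    apply: lee_sum => k _; have /andP[l1 l2] := l0 k.
    suff : (lebesgue_measure (C n k) <= ((ll n).2 k `^ sigma)%:E)%E by [].
    rewrite /C lebesgue_measure_itv /= lte_fin; case: ltP => [lt|_]; last by rewrite lee_fin powR_ge0.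
    rewrite -EFinD lee_fin addrAC subrr add0r.
    have lt0 : 0 < (ll n).2 k by rewrite -(ltrDl ((ll n).1 k)).
    apply: ger1_powR => //; rewrite lt0 (le_trans l2)// invf_le1// ler1n//.
  by rewrite sumEFin lee_fin big_mkord.
exists (\bigcap_n U n); split.
- by apply: bigcapT_measurable.
- apply/eqP; rewrite eq_le measure_ge0 andbT; apply/lee_addgt0Pr => e e0; rewrite add0e.
  pose n := Num.truncn e^-1.
  apply: (@le_trans _ _ (leb (U n))).
    by apply: le_measure; [rewrite inE; exact: bigcapT_measurable|rewrite inE; exact: mU|exact: bigcap_inf].
  apply: (le_trans (lebU n)); rewrite lee_fin invf_ple ?posrE//.
  by have /truncn_itv/andP[_ /ltW] : 0 <= e^-1 by rewrite invr_ge0 ltW.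
- move=> x Sx n _; have [_ cov _] := Hl n; have [k hk] := cov x Sx.
  by exists k => //; rewrite /C /= in_itv.
Qed.

End SmallCovers.

(** * Sampling the amplitudes *)

Section ElementaryBounds.
Context {R : realType}.
Local Notation leb := (@lebesgue_measure R).

Lemma le_pow_mean (a b : R) p : 0 <= a -> 0 <= b -> (a + b) ^+ p <= 2 ^+ p * (a ^+ p + b ^+ p).
Proof.
wlog ab : a b / a <= b.
  by move=> W a0 b0; have [ab|/ltW ba] := leP a b; [exact: W|rewrite addrC [a ^+ _ + _]addrC W].
move=> a0 b0; apply: (@le_trans _ _ ((2 * b) ^+ p)).
  by apply: lerXn2r; rewrite ?nnegrE ?addr_ge0 ?mulr_ge0//; lra.
by rewrite exprMn ler_wpM2l ?exprn_ge0// lerDr exprn_ge0.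
Qed.

(** Each [x i] to the power [alpha] is at most [A]. This bounds the second factor of
    [x i = x i ^ alpha * x i ^ (1 - alpha)]. *)
Lemma sum_le_sum_powR (I : eqType) (s : seq I) (x : I -> R) (alpha A : R) :
  0 < alpha -> alpha <= 1 -> (forall i, 0 <= x i) -> \sum_(i <- s) x i `^ alpha <= A ->
  \sum_(i <- s) x i <= A * A `^ ((1 - alpha) / alpha).
Proof.
move=> a0 a1 x0 sA.
have A0 : 0 <= A by apply: le_trans sA; apply: sumr_ge0 => i _; exact: powR_ge0.
apply: (@le_trans _ _ (\sum_(i <- s) x i `^ alpha * A `^ ((1 - alpha) / alpha))); last first.
  by rewrite -mulr_suml ler_wpM2r ?powR_ge0.
rewrite big_seq [leRHS]big_seq; apply: ler_sum => i si.
have [xi0|xi0] := eqVneq (x i) 0; first by rewrite xi0 mulr_ge0 ?powR_ge0.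
have xi : 0 < x i by rewrite lt_def xi0 x0.
have xE : x i `^ alpha * x i `^ (1 - alpha) = x i.
  by rewrite -powRD ?xi0 ?implybT// addrC subrK powRr1// ltW.
rewrite -[leLHS]xE; apply: ler_wpM2l; first exact: powR_ge0.
have -> : x i `^ (1 - alpha) = (x i `^ alpha) `^ ((1 - alpha) / alpha).
  by rewrite -powRrM; congr (_ `^ _); field; rewrite gt_eqF.
apply: ge0_ler_powR; rewrite ?nnegrE ?powR_ge0 ?divr_ge0 ?subr_ge0 ?(ltW a0)//.
apply: le_trans sA; rewrite (big_rem i si) /= lerDl; apply: sumr_ge0 => j _; exact: powR_ge0.
Qed.

(** With [M] the maximum of 1 and of the factors, the product is at most [M ^+ size l <= M ^+ m],
    and [M ^+ m] is either 1 or one of the summands. *)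
Lemma prod_le_one_add_sum (I : eqType) (l : seq I) (y : I -> R) m : (forall i, 0 <= y i) ->
  (size l <= m)%N -> \prod_(i <- l) y i <= 1 + \sum_(i <- l) y i ^+ m.
Proof.
move=> y0 lm; have [M [M1 yM Mle]] : exists M, [/\ 1 <= M, forall i, i \in l -> y i <= M &
    M ^+ m <= 1 + \sum_(i <- l) y i ^+ m].
  elim: l {lm} => [|i l [M [M1 yM Mle]]]; first by exists 1; rewrite big_nil expr1n addr0.
  have S0 : 0 <= \sum_(i <- l) y i ^+ m by apply: sumr_ge0 => j _; exact: exprn_ge0.
  have [yi|yi] := leP (y i) M.
    exists M; split => //; first by move=> j; rewrite in_cons => /orP[/eqP ->//|/yM].
    by rewrite big_cons; have := exprn_ge0 m (y0 i); lra.
  exists (y i); split => //; first by rewrite (le_trans M1)// ltW.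
    by move=> j; rewrite in_cons => /orP[/eqP ->//|/yM h]; rewrite (le_trans h)// ltW.
  by rewrite big_cons; lra.
apply: le_trans Mle; apply: (@le_trans _ _ (M ^+ size l)); last exact: ler_weXn2l.
elim: l yM {lm} => [|i l IH] yM; first by rewrite big_nil.
rewrite big_cons exprS; apply: ler_pM => //; first exact: prodr_ge0.
  by apply: yM; rewrite mem_head.
by apply: IH => j jl; apply: yM; rewrite in_cons jl orbT.
Qed.

(** The integral of a nonnegative function is a supremum over the simple functions below it, and
    enlarging the function enlarges this set. *)
Lemma ge0_le_integral_nomeas d (T : measurableType d) (mu : {measure set T -> \bar R}) (D : set T)
    (f1 f2 : T -> \bar R) : (forall x, D x -> (0 <= f1 x)%E) ->
  (forall x, D x -> (f1 x <= f2 x)%E) ->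
  (\int[mu]_(x in D) f1 x <= \int[mu]_(x in D) f2 x)%E.
Proof.
move=> f10 f12.
have f20 x : D x -> (0 <= f2 x)%E by move=> Dx; rewrite (le_trans (f10 _ Dx))// f12.
rewrite !ge0_integralE//; apply: ge_ereal_sup => _ [h hf <-].
apply: ereal_sup_ubound; exists h => // x; apply: (le_trans (hf x)).
by rewrite /patch; case: ifPn => //; rewrite inE => Dx; exact: f12.
Qed.

(* [f] is not assumed measurable. *)
Lemma sum_le_integral (f : R -> R) (a : nat -> R) N : (forall x, 0 <= f x) -> (forall n, 0 <= a n) ->
  (forall n x, @node R n < x < node n.+1 -> a n <= f x) ->
  ((\sum_(n < N) a n)%:E <= \int[leb]_(x in `]0%R, +oo[) (f x)%:E)%E.
Proof.
move=> f0 a0 af.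
pose C n : set R := `]node n, node n.+1[%classic.
have mC n : measurable (C n) by exact: measurable_itv.
have mD : measurable (`]0%R, +oo[%classic : set R) by exact: measurable_itv.
have lebC n : leb (C n `&` `]0%R, +oo[) = 1%E.
  have -> : C n `&` `]0%R, +oo[ = C n.
    apply/setIidl => x; rewrite /C /= !in_itv /= andbT => /andP[+ _]; apply: le_lt_trans.
    by rewrite /node.
  suff : lebesgue_measure (C n) = 1%E by [].
  rewrite /C lebesgue_measure_itv /= lte_fin /node ltr_nat ltnSn -EFinD -(natr1 n.+1).
  by congr (_%:E); lra.
have intC n : (\int[leb]_(x in `]0%R, +oo[) (\1_(C n) x)%:E)%E = 1%E.
  have := @integral_indic _ _ _ leb _ mD _ (mC n); rewrite [RHS](lebC n); exact.
pose step x : \bar R := (\sum_(n <- iota 0 N) (a n)%:E * (\1_(C n) x)%:E)%E.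
have intstep : (\int[leb]_(x in `]0%R, +oo[) step x = (\sum_(n < N) a n)%:E)%E.
  rewrite /step ge0_integral_sum//.
  - rewrite -sumEFin -(big_mkord xpredT (fun n => (a n)%:E)) /index_iota subn0.
    apply: eq_bigr => n _; rewrite ge0_integralZl_EFin//.
    + by rewrite -[RHS]mule1; congr (_ * _)%E; exact: intC.
    + by apply/measurable_EFinP; apply: measurable_indic; exact: mC.
  - by move=> n; apply: measurable_funeM; apply/measurable_EFinP; apply: measurable_indic; exact: mC.
  - by move=> n x _; rewrite mule_ge0// lee_fin.
rewrite -intstep; apply: ge0_le_integral_nomeas => x _.
  by apply: sume_ge0 => n _; rewrite mule_ge0// lee_fin.
rewrite /step; under eq_bigr do rewrite -EFinM; rewrite sumEFin lee_fin.
have [[n xn]|no] := pselect (exists n, C n x); last first.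
  rewrite big1// => n _; rewrite indicE memNset ?mulr0// => xn; apply: no; by exists n.
have uniq k : C k x -> k = n.
  move: xn; rewrite /C /= !in_itv /= /node => /andP[n1 n2] /andP[k1 k2].
  have := lt_trans n1 k2; have := lt_trans k1 n2; rewrite !ltr_nat !ltnS => a1 a2.
  by apply/eqP; rewrite eqn_leq a1 a2.
have le (s : seq nat) : seq.uniq s -> \sum_(k <- s) a k * \1_(C k) x <= a n.
  move=> us; have [ns|ns] := boolP (n \in s); last first.
    rewrite big_seq big1 ?a0// => k ks; rewrite indicE memNset ?mulr0//.
    by move=> /uniq kn; move: ns; rewrite -kn ks.
  rewrite (bigD1_seq n) //= [X in _ + X]big1 ?addr0.
    by rewrite indicE mem_set// mulr1.
  move=> k kn; rewrite indicE memNset ?mulr0//.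
  by move=> /uniq kn'; rewrite kn' eqxx in kn.
apply: (le_trans (le _ (iota_uniq 0 N))); apply: af.
by move: xn; rewrite /C /= in_itv.
Qed.

End ElementaryBounds.

(** * Variation over unit cells and linear interpolation *)

Section Discretization.
Context {R : realType}.
Local Notation cmod := (@Normc.normc R).
Context (ga : R -> R[i]) (V : R).
Context (HV : forall (k : nat) (x : nat -> R), 0 < x 0%N -> (forall j, (j < k)%N -> x j < x j.+1) ->
   \sum_(j < k) cmod (ga (x j.+1) - ga (x j)) <= V).

(** The variation along the two legs from the left node to [x] and from [x] to the right node. Its
    supremum over the cell controls the jump between samples as well as the distance to the linear
    interpolation, and these suprema are summable over the cells. *)
Definition cell_osc n (x : R) : R :=
  cmod (ga x - ga (node n)) + cmod (ga (node n.+1) - ga x).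

Definition cell_var n : R := sup [set cell_osc n x | x in [set x | @node R n < x < node n.+1]].


Lemma V_ge0 : 0 <= V.
Proof. by have := HV (k := 0) (x := fun=> 1) ltr01 (fun j => ltac:(by [])); rewrite big_ord0. Qed.

Lemma dist_le_V x y : 0 < x -> 0 < y -> cmod (ga x - ga y) <= V.
Proof.
wlog xy : x y / x <= y.
  move=> W x0 y0; have [xy|/ltW yx] := leP x y; first exact: W.
  by rewrite -cmodN opprB; exact: W.
move=> x0 y0; move: xy; rewrite le_eqVlt => /orP[/eqP ->|xy].
  by rewrite subrr cmod0 V_ge0.
have := HV (k := 1) (x := fun j => if j == 0%N then x else y) x0.
rewrite big_ord1 /= -cmodN opprB; apply; by case.
Qed.

Lemma sum_cell_osc N (xs : nat -> R) : (forall n, node n < xs n < node n.+1) ->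
  \sum_(n < N) cell_osc n (xs n) <= V.
Proof.
move=> xsP.
(* A single partition, with the nodes at even and the points [xs] at odd places, contains both legs
   of every cell. *)
pose y j := if odd j then xs j./2 else node j./2.
have := HV (k := N.*2) (x := y).
have -> : \sum_(j < N.*2) cmod (ga (y j.+1) - ga (y j)) = \sum_(n < N) cell_osc n (xs n).
  elim: N => [|N IH]; first by rewrite !big_ord0.
  rewrite doubleS !big_ord_recr /= IH -addrA; congr (_ + _).
  by rewrite /cell_osc /y /= odd_double /= uphalf_double !doubleK.
apply; first by rewrite /y /=.
move=> j _; rewrite /y /=; case: (boolP (odd j)) => oj /=.
  by rewrite uphalf_half oj add1n; case/andP: (xsP j./2).
by rewrite uphalf_half (negbTE oj) add0n; case/andP: (xsP j./2).
Qed.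

Let mid n : R := @node R n + 1 / 2.
Let midP n : node n < mid n < node n.+1.
Proof. by rewrite /mid /node -(natr1 n.+1); apply/andP; split; lra. Qed.

Lemma cell_osc_le n x : node n < x < node n.+1 -> cell_osc n x <= V.
Proof.
move=> nx; have := @sum_cell_osc n.+1 (fun k => if k == n then x else mid k) _.
rewrite big_ord_recr /= eqxx => H.
apply: le_trans (H _); last first.
  by move=> k; case: eqP => [->|_]; [exact: nx|exact: midP].
rewrite lerDr; apply: sumr_ge0 => k _; rewrite addr_ge0// cmod_ge0//.
Qed.

Let has_sup_osc n : has_sup [set cell_osc n x | x in [set x | @node R n < x < node n.+1]].
Proof.
split; first by exists (cell_osc n (mid n)), (mid n); [exact: midP|].
by exists V => _ [x /= nx <-]; exact: cell_osc_le.
Qed.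

Lemma cell_osc_le_var n x : node n < x < node n.+1 -> cell_osc n x <= cell_var n.
Proof. by move=> nx; apply: ub_le_sup; [exact: (has_sup_osc n).2|exists x]. Qed.

Lemma cell_var_ge0 n : 0 <= cell_var n.
Proof. by apply: le_trans (cell_osc_le_var (midP n)); rewrite addr_ge0// cmod_ge0. Qed.

Lemma sum_cell_var N : \sum_(n < N) cell_var n <= V.
Proof.
apply/ler_addgt0Pr => e e0.
have N0 : 0 < e / N.+1%:R by rewrite divr_gt0.
have Hx n : exists x, node n < x < node n.+1 /\ cell_var n - e / N.+1%:R < cell_osc n x.
  by have [_ [x nx <-] lt] := sup_adherent N0 (has_sup_osc n); exists x.
pose xs n := sval (cid (Hx n)).
have xsP n : node n < xs n < node n.+1 by exact: (svalP (cid (Hx n))).1.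
have xsl n : cell_var n - e / N.+1%:R < cell_osc n (xs n) by exact: (svalP (cid (Hx n))).2.
apply: (@le_trans _ _ (\sum_(n < N) (cell_osc n (xs n) + e / N.+1%:R))).
  by apply: ler_sum => n _; rewrite -lerBlDr ltW.
rewrite big_split /=; apply: lerD; first exact: sum_cell_osc.
rewrite sumr_const card_ord -[leLHS]mulr_natl mulrCA ger_pMr//.
by rewrite ler_pdivrMr// mul1r ler_nat.
Qed.

Lemma cell_diff n : cmod (ga (node n.+1) - ga (node n)) <= cell_var n.
Proof.
apply: le_trans (cell_osc_le_var (midP n)).
have -> : ga (node n.+1) - ga (node n) = (ga (node n.+1) - ga (mid n)) + (ga (mid n) - ga (node n)).
  by rewrite addrA subrK.
by rewrite /cell_osc [leRHS]addrC; exact: cmodD.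
Qed.

(** At the fraction [s] of the cell the deviation is [1 - s] times one leg minus [s] times the
    other, hence bounded by the two legs together. *)
Lemma cell_lin n x : node n <= x <= node n.+1 ->
  cmod (ga x - (ga (node n) + (x - node n)%:C%C * (ga (node n.+1) - ga (node n)))) <= cell_var n.
Proof.
move=> /andP[]; rewrite le_eqVlt => /orP[/eqP <- _|n1].
  by rewrite subrr mul0r addr0 subrr cmod0 cell_var_ge0.
rewrite le_eqVlt => /orP[/eqP ->|n2].
  have -> : (@node R n.+1 - node n)%:C%C = 1.
    by rewrite /node -(natr1 n.+1) addrAC subrr add0r.
  by rewrite mul1r [X in _ - X]addrC subrK subrr cmod0 cell_var_ge0.
pose s := x - node n.
have s0 : 0 <= s by rewrite subr_ge0 ltW.
have s1 : 0 <= 1 - s by move: n2; rewrite /s /node -(natr1 n.+1); lra.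
have -> : ga x - (ga (node n) + s%:C%C * (ga (node n.+1) - ga (node n))) =
    (1 - s)%:C%C * (ga x - ga (node n)) - s%:C%C * (ga (node n.+1) - ga x).
  rewrite (_ : (1 - s)%:C%C = 1 - s%:C%C); first by ring.
  by apply/eqP; rewrite eq_complex /= subr0 !eqxx.
have nx : node n < x < node n.+1 by rewrite n1.
apply: le_trans (cell_osc_le_var nx); apply: (le_trans (cmodD _ _)).
rewrite cmodN !cmodM !cmodR !ger0_norm// /cell_osc; apply: lerD.
  by rewrite ler_piMl ?cmod_ge0//; lra.
by rewrite ler_piMl ?cmod_ge0//; lra.
Qed.

End Discretization.

(** * Summability of the tree coefficients at light energies *)

Section TreeWeights.
Context {R : realType}.
Local Open Scope complex_scope.
Local Notation cmod := (@Normc.normc R).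
Context (m : nat) (m0 : (0 < m)%N).
Context (c : nat -> R[i]) (theta : nat -> R) (alpha A : R).
Context (alpha0 : 0 < alpha) (alpha1 : alpha <= 1).
Context (cA : forall N, \sum_(j < N) cmod (c j) `^ alpha <= A).

(* The summand [2^-j] keeps the weights positive. *)
Definition jweight j : R := cmod (c j) `^ alpha + 2^-1 ^+ j.
Definition tweight (t : tree) : R := \prod_(j <- labels t) jweight j.
(** The atoms sit at half the frequencies of the subtrees because a denominator vanishes when
    [2 * E] equals a frequency. A tree places its full weight at each of its subtrees. *)
Definition tlist N : seq (R * R) :=
  [seq (tweight t, freq theta u / 2) | t <- trees m N, u <- subtrees t].

Lemma jweight_gt0 j : 0 < jweight j.
Proof. by rewrite /jweight ltr_wpDl ?powR_ge0// exprn_gt0. Qed.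

Lemma tweight_gt0 t : 0 < tweight t.
Proof. by apply: prodr_gt0 => j _; exact: jweight_gt0. Qed.

Lemma sum_jweight N : \sum_(j < N) jweight j <= A + 2.
Proof.
have h1 : (2^-1 : R) < 1 by rewrite invf_lt1// ltr1n.
rewrite big_split /=; apply: lerD; first exact: cA.
have := geometric_le N (_ : 0 <= 2^-1 :> R) h1; rewrite (_ : (1 - 2^-1)^-1 = 2 :> R); last by field.
by apply.
Qed.

Lemma sum_tlist N (F : R -> R) : \sum_(wb <- tlist N) wb.1 * F wb.2 =
  \sum_(t <- trees m N) tweight t * \sum_(u <- subtrees t) F (freq theta u / 2).
Proof. by rewrite big_allpairs_dep /=; apply: eq_bigr => t _; rewrite mulr_sumr. Qed.

Lemma tlist_mono N N' (F : R -> R) : (N <= N')%N -> (forall x, 0 <= F x) ->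
  \sum_(wb <- tlist N) wb.1 * F wb.2 <= \sum_(wb <- tlist N') wb.1 * F wb.2.
Proof.
move=> NN' F0; rewrite !sum_tlist; apply: sum_subset_le; rewrite ?trees_uniq//; last exact: trees_sub.
by move=> t; rewrite mulr_ge0 ?(ltW (tweight_gt0 t))//; apply: sumr_ge0.
Qed.

Lemma tlist_gt0 N wb : wb \in tlist N -> 0 < wb.1.
Proof. by move=> /allpairsPdep[t [u [_ _ ->]]]; exact: tweight_gt0. Qed.

(** The weight is multiplicative. Forgetting the size restriction, a bound [W] for height [h] gives
    the bound [(A + 2) * (1 + W * W)] for the next height. *)
Lemma sum_tweight_bounded : exists2 W, 0 <= W & forall N, \sum_(t <- trees m N) tweight t <= W.
Proof.
have A0 : 0 <= A by apply: le_trans (cA 0); rewrite big_ord0.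
suff H h : exists2 W, 0 <= W & forall N, \sum_(t <- tree_upto m N h) tweight t <= W by exact: (H m).
elim: h => [|h [W W0 IH]]; first by exists 0 => // N; rewrite big_nil.
exists ((A + 2) * (1 + W * W)); first by rewrite mulr_ge0 ?addr_ge0 ?mulr_ge0.
move=> N; rewrite /= big_cat /= mulrDr mulr1; apply: lerD.
  rewrite big_map (_ : iota 0 N = index_iota 0 N) ?big_mkord; last by rewrite /index_iota subn0.
  by apply: le_trans (sum_jweight N); apply: ler_sum => j _; rewrite /tweight /= big_seq1.
rewrite big_filter; apply: (@le_trans _ _ (\sum_(t <- [seq Node j st.1 st.2 | j <- iota 0 N,
   st <- [seq (s, t) | s <- tree_upto m N h, t <- tree_upto m N h]]) tweight t)).
  by rewrite big_mkcond /=; apply: ler_sum => t _; case: ifP => // _; exact: ltW (tweight_gt0 t).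
rewrite big_allpairs_dep /= (_ : iota 0 N = index_iota 0 N) ?big_mkord; last by rewrite /index_iota subn0.
apply: (@le_trans _ _ (\sum_(j < N) jweight j * (W * W))); last first.
  by rewrite -mulr_suml ler_wpM2r ?mulr_ge0// sum_jweight.
apply: ler_sum => j _; rewrite big_allpairs_dep /=.
have E s t : tweight (Node j s t) = jweight j * (tweight s * tweight t).
  by rewrite /tweight /= big_cons big_cat.
under eq_bigr do under eq_bigr do rewrite E.
under eq_bigr do rewrite -mulr_sumr -mulr_sumr.
rewrite -mulr_sumr ler_wpM2l ?(ltW (jweight_gt0 j))// -mulr_suml.
have S0 : 0 <= \sum_(t <- tree_upto m N h) tweight t by apply: sumr_ge0 => t _; exact: ltW (tweight_gt0 t).
by apply: ler_pM.
Qed.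

Lemma tlist_mass : exists W, forall N, \sum_(wb <- tlist N) wb.1 <= W.
Proof.
have [W W0 HW] := sum_tweight_bounded; exists (W * m%:R) => N.
have -> : \sum_(wb <- tlist N) wb.1 = \sum_(wb <- tlist N) wb.1 * 1 by apply: eq_bigr => wb _; rewrite mulr1.
rewrite (sum_tlist N (fun=> 1)); apply: (@le_trans _ _ (\sum_(t <- trees m N) tweight t * m%:R)).
  rewrite big_seq [leRHS]big_seq; apply: ler_sum => t; rewrite mem_trees// => /andP[tm _].
  rewrite ler_wpM2l ?(ltW (tweight_gt0 t))// big_const_seq count_predT iter_addr addr0.
  by rewrite tsize_subtrees ler_nat.
by rewrite -mulr_suml ler_wpM2r.
Qed.

Lemma cmod_tcoef_powR E t : cmod (tcoef c theta E t) `^ alpha <=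
  tweight t * \prod_(u <- subtrees t) `|2 * E - freq theta u| `^ (- alpha).
Proof.
have pV (x : R) : `|x|^-1 `^ alpha = `|x| `^ (- alpha).
  (* At a resonance both sides are 0, by the conventions for the inverse and the powers of 0. *)
  have [->|x0] := eqVneq x 0; first by rewrite normr0 invr0 !powR0 ?oppr_eq0 ?gt_eqF.
  by rewrite -powR_inv1// -powRrM mulN1r.
have cw j : cmod (c j) `^ alpha <= jweight j by rewrite /jweight lerDl exprn_ge0.
have cdiv (z : R[i]) (x : R) : cmod (z / x%:C) = cmod z * `|x|^-1.
  by rewrite cmodM -cmodR -Normc.normcV.
have ge (x : R) : 0 <= `|x|^-1 by rewrite invr_ge0.
elim: t => [j|j s IHs t IHt] /=.
  rewrite cdiv powRM ?cmod_ge0// pV /tweight /= !big_seq1.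
  by rewrite ler_wpM2r ?powR_ge0.
rewrite cdiv !cmodM cmodJ powRM ?mulr_ge0 ?cmod_ge0// powRM ?mulr_ge0 ?cmod_ge0// powRM ?cmod_ge0// pV.
rewrite /tweight /= !big_cons !big_cat /= -!/(tweight _).
set Ps := \prod_(u <- subtrees s) _ in IHs *; set Pt := \prod_(u <- subtrees t) _ in IHt *.
set D := `|_| `^ _.
have -> : jweight j * (\prod_(j <- labels s) jweight j * \prod_(j <- labels t) jweight j) * (D * (Ps * Pt)) =
   jweight j * (tweight s * Ps) * (tweight t * Pt) * D by rewrite /tweight; ring.
apply: ler_pM; rewrite ?powR_ge0 ?mulr_ge0 ?powR_ge0//.
by apply: ler_pM; rewrite ?powR_ge0 ?mulr_ge0 ?powR_ge0//; apply: ler_pM; rewrite ?powR_ge0.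
Qed.

(** The [alpha]-th powers of the coefficients have a sum bounded by the mass plus the Riesz
    potential of order [m * alpha], because the product over the at most [m] denominators is bounded
    by 1 plus a sum of [m]-th powers. Then [alpha <= 1] gives the coefficients themselves. *)
Lemma light_good E s : light tlist s E -> m%:R * alpha < s ->
  (forall t, (tsize t <= m)%N -> 2 * E - freq theta t != 0) /\
  exists Sig, forall N, \sum_(t <- trees m N) cmod (tcoef c theta E t) <= Sig.
Proof.
move=> lE ms.
have b0 : 0 < m%:R * alpha by rewrite mulr_gt0// ltr0n.
have nres t : (tsize t <= m)%N -> 2 * E - freq theta t != 0.
  move=> tm; pose N := (\max_(j <- labels t) j).+1.
  have tN : t \in trees m N.
    rewrite mem_trees// tm; apply/allP => j jt; rewrite ltnS.
    exact: (@leq_bigmax_seq _ (labels t) xpredT id j jt isT).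
  have wb : (tweight t, freq theta t / 2) \in tlist N.
    by apply/allpairsPdep; exists t, t; split => //; case: t {tm N tN} => *; exact: mem_head.
  have := light_ne (beta := m%:R * alpha) tlist_gt0 b0 ms lE wb; apply: contra_neq => /= h.
  by have -> : freq theta t = 2 * E by [move: h; lra]; field.
split=> //.
have [W W0 HW] := sum_tweight_bounded.
have [K HK] := light_bounded tlist_gt0 (svalP (cid tlist_mass)) b0 ms lE.
pose S := W + K; exists (S * S `^ ((1 - alpha) / alpha)) => N.
apply: sum_le_sum_powR => //; first by move=> t; exact: cmod_ge0.
apply: (@le_trans _ _ (\sum_(t <- trees m N) (tweight t +
   tweight t * \sum_(u <- subtrees t) `|E - freq theta u / 2| `^ (- (m%:R * alpha))))); last first.
  rewrite big_split /= /S lerD//; have := HK N; rewrite (sum_tlist N (fun x => `|E - x| `^ _)); exact.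
rewrite big_seq [leRHS]big_seq; apply: ler_sum => t; rewrite mem_trees// => /andP[tm _].
apply: (le_trans (cmod_tcoef_powR E t)); rewrite -[X in X + _]mulr1 -mulrDr.
apply: ler_wpM2l; first exact: ltW (tweight_gt0 t).
apply: le_trans (@prod_le_one_add_sum _ _ _ _ m _ _) _.
- by move=> u; exact: powR_ge0.
- by rewrite tsize_subtrees.
rewrite lerD2l; apply: ler_sum => u _.
have -> : `|2 * E - freq theta u| = 2 * `|E - freq theta u / 2|.
  by rewrite -[X in _ = X * _](@ger0_norm _ 2)// -normrM; congr `|_|; field.
rewrite -powR_mulrn ?powR_ge0// -powRrM mulNr [alpha * _]mulrC powRM// ler_piMl ?powR_ge0//.
rewrite powRN invf_le1 ?powR_gt0//; have : 1 `^ (m%:R * alpha) <= 2 `^ (m%:R * alpha).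
  by apply: ge0_ler_powR; rewrite ?nnegrE ?(ltW b0)// ler1n.
by rewrite powR1.
Qed.

End TreeWeights.

(** * From the operator data to the a priori estimate *)

Section WignerVonNeumannData.
Context {R : realType}.
Local Open Scope complex_scope.
Local Notation leb := (@lebesgue_measure R).
Local Notation cmod := (@Normc.normc R).

Lemma lty_le_EFin (x : \bar R) : (x < +oo)%E -> exists2 r : R, 0 <= r & (x <= r%:E)%E.
Proof.
case: x => [r _| |_]; first by exists `|r| => //; rewrite lee_fin ler_norm.
  by rewrite ltxx.
by exists 0 => //; exact: leNye.
Qed.

(** A value above [V + L + 1] would, by the bound on the variation, keep the modulus above [L + 1]
    everywhere; a single cell would then contribute more than [L] to the integral. *)
Lemma variation_L_p_bounded (ga : R -> R[i]) (V L : R) p : (0 < p)%N -> 0 <= L ->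
  (forall (k : nat) (x : nat -> R), 0 < x 0%N -> (forall j, (j < k)%N -> x j < x j.+1) ->
     \sum_(j < k) cmod (ga (x j.+1) - ga (x j)) <= V) ->
  (\int[leb]_(t in `]0%R, +oo[) (cmod (ga t) ^+ p)%:E <= L%:E)%E ->
  forall x, 0 < x -> cmod (ga x) <= V + L + 1.
Proof.
move=> p0 L0 HV HL x x0; rewrite leNgt; apply/negP => lt.
have f0 t : 0 <= cmod (ga t) ^+ p by rewrite exprn_ge0// cmod_ge0.
have a0 : 0 <= L + 1 by rewrite addr_ge0.
have := @sum_le_integral R (fun t => cmod (ga t) ^+ p) (fun=> L + 1) 1 f0 (fun=> a0).
rewrite big_ord1 => H.
have : ((L + 1)%:E <= L%:E)%E; last by rewrite lee_fin gerDl leNgt ltr01.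
apply: le_trans HL; apply: H => n y /andP[ny _].
have y0 : 0 < y by apply: le_lt_trans ny; rewrite /node.
have d := dist_le_V HV x0 y0.
have t := cmodD (ga x - ga y) (ga y); rewrite subrK in t.
have L1 : L + 1 <= cmod (ga y) by move: lt t d; lra.
apply: (@le_trans _ _ ((L + 1) ^+ p)).
  by rewrite -[leLHS]expr1; apply: ler_weXn2l => //; lra.
by apply: lerXn2r; rewrite ?nnegrE ?cmod_ge0.
Qed.

(** Throughout a cell the sample is at most [cmod (ga x) + v n]. Taking [p]-th powers, [a n] is a
    lower bound for the integrand on the cell, truncated at 0 to stay nonnegative; the correction
    [v n ^+ p] is summable because [v] is. *)
Lemma sum_node_pow (ga : R -> R[i]) (V L : R) p : (0 < p)%N -> 0 <= L ->
  (forall (k : nat) (x : nat -> R), 0 < x 0%N -> (forall j, (j < k)%N -> x j < x j.+1) ->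
     \sum_(j < k) cmod (ga (x j.+1) - ga (x j)) <= V) ->
  (\int[leb]_(t in `]0%R, +oo[) (cmod (ga t) ^+ p)%:E <= L%:E)%E ->
  forall k, \sum_(n < k) cmod (ga (node n)) ^+ p <= 2 ^+ p * (L + V ^+ p).
Proof.
move=> p0 L0 HV HL k; have V0 := V_ge0 HV.
have p2 : 0 < 2 ^+ p :> R by rewrite exprn_gt0.
pose v n := cell_var ga n.
have v0 n : 0 <= v n by exact: cell_var_ge0 HV n.
pose a n : R := Num.max 0 (cmod (ga (node n)) ^+ p / 2 ^+ p - v n ^+ p).
have a0 n : 0 <= a n by rewrite /a le_max lexx.
have sa : \sum_(n < k) a n <= L.
  rewrite -lee_fin; apply: le_trans HL; apply: sum_le_integral => //.
    by move=> x; rewrite exprn_ge0// cmod_ge0.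
  move=> n x nx; rewrite /a ge_max exprn_ge0 ?cmod_ge0//=.
  rewrite lerBlDr ler_pdivrMr// mulrC; apply: le_trans (le_pow_mean _ _ _) => //; last exact: cmod_ge0.
  apply: lerXn2r; rewrite ?nnegrE ?addr_ge0 ?cmod_ge0//.
  have := cmodD (ga (node n) - ga x) (ga x); rewrite subrK => h.
  apply: (le_trans h); rewrite addrC lerD2l -cmodN opprB.
  by apply: le_trans (cell_osc_le_var HV nx); rewrite /cell_osc lerDl cmod_ge0.
have vV n : v n <= V.
  apply: le_trans (sum_cell_var HV n.+1); rewrite big_ord_recr /= lerDr.
  by apply: sumr_ge0 => i _; exact: v0.
have sv : \sum_(n < k) v n ^+ p <= V ^+ p.
  apply: (@le_trans _ _ (\sum_(n < k) v n * V ^+ p.-1)).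
    apply: ler_sum => n _; rewrite -{1}(prednK p0) exprS ler_wpM2l//.
    by apply: lerXn2r; rewrite ?nnegrE.
  rewrite -mulr_suml -{2}(prednK p0) exprS ler_wpM2r ?exprn_ge0//.
  exact: sum_cell_var HV k.
rewrite mulrC -ler_pdivrMr// mulr_suml.
apply: (@le_trans _ _ (\sum_(n < k) (a n + v n ^+ p))); last by rewrite big_split lerD.
by apply: ler_sum => n _; rewrite -lerBlDr /a le_max lexx orbT.
Qed.

(* The amplitudes are sampled at the nodes and rescaled to be at most 1. *)
Lemma wigner_von_neumann_sampling p alpha phi : (0 < p)%N -> 0 < alpha -> alpha <= 1 ->
  wigner_von_neumann p alpha phi ->
  exists (c : nat -> R[i]) (theta : nat -> R) (g : nat -> nat -> R[i]) (v : nat -> nat -> R)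
    (K0 C0 A : R) (eta : nat -> R),
  [/\ [/\ forall j n, cmod (g j n) <= 1, forall j n, 0 <= v j n &
          forall j n, cmod (g j n.+1 - g j n) <= v j n],
      [/\ forall j k, \sum_(n < k) v j n <= K0, forall j k, \sum_(n < k) cmod (g j n) ^+ p <= K0,
          forall N, \sum_(j < N) cmod (c j) <= C0 & forall N, \sum_(j < N) cmod (c j) `^ alpha <= A],
      [/\ forall N, 0 <= eta N & forall e, 0 < e -> exists N, eta N <= e],
      forall x, 0 < x -> cmod (phi x) <= C0 &
      forall N n x, @node R n <= x <= node n.+1 ->
        cmod ('i * phi x - pot c theta g N n x) <= \sum_(j < N) cmod (c j) * v j n + eta N].
Proof.
move=> p0 alpha0 alpha1 [c [theta [ga [cvg_phi supV supL sumc]]]].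
have [V _ HV] := lty_le_EFin supV; have [L L0 HL] := lty_le_EFin supL.
have [A _ HA] := lty_le_EFin sumc.
have {}HV j (k : nat) (x : nat -> R) : 0 < x 0%N -> (forall i, (i < k)%N -> x i < x i.+1) ->
    \sum_(i < k) cmod (ga j (x i.+1) - ga j (x i)) <= V.
  move=> x0 xi; rewrite -lee_fin; apply: le_trans HV.
  apply: (@le_trans _ _ (variation_pos (ga j))); last by apply: ereal_sup_ubound; exists j.
  by apply: ereal_sup_ubound; exists k, x.
have {}HL j : (\int[leb]_(t in `]0%R, +oo[) (cmod (ga j t) ^+ p)%:E <= L%:E)%E.
  by apply: le_trans HL; apply: ereal_sup_ubound; exists j.
have {}HA N : \sum_(j < N) cmod (c j) `^ alpha <= A.
  rewrite -lee_fin; apply: le_trans HA; rewrite -sumEFin -(big_mkord xpredT (fun j => (cmod (c j) `^ alpha)%:E)).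
  by apply: nneseries_lim_ge => k _ _; rewrite lee_fin powR_ge0.
have V0 : 0 <= V := V_ge0 (HV 0%N).
pose B := V + L + 1.
have B1 : 1 <= B by rewrite /B; lra.
have B0 : 0 < B by exact: lt_le_trans B1.
have Bi1 : B^-1 <= 1 by rewrite invf_le1.
have Bi0 : 0 < B^-1 by rewrite invr_gt0.
have gaB j x : 0 < x -> cmod (ga j x) <= B by exact: variation_L_p_bounded p0 L0 (HV j) (HL j) x.
pose c' j := B%:C * c j.
pose g j n := (B^-1)%:C * ga j (node n).
pose v j n := B^-1 * cell_var (ga j) n.
pose T N := \sum_(j < N) cmod (c' j).
have cc' j : cmod (c' j) = B * cmod (c j) by rewrite cmodM cmodR gtr0_norm.
have node0 n : 0 < @node R n by rewrite /node.
have cv0 j n : 0 <= cell_var (ga j) n by exact: cell_var_ge0 (HV j) n.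
have Bcg j n : B%:C * g j n = ga j (node n).
  rewrite /g mulrA (_ : B%:C * _ = 1) ?mul1r//.
  apply/eqP; rewrite eq_complex; apply/andP; split; apply/eqP => /=.
    by rewrite mulr0 subr0 mulfV// gt_eqF.
  by rewrite mulr0 mul0r addr0.
have sa N : \sum_(j < N) cmod (c' j) `^ alpha <= B `^ alpha * A.
  under eq_bigr do rewrite cc' powRM ?cmod_ge0 ?(ltW B0)//.
  by rewrite -mulr_sumr ler_wpM2l ?powR_ge0.
have hT : has_sup (range T).
  split; first by exists (T 0%N), 0%N.
  exists (B `^ alpha * A * (B `^ alpha * A) `^ ((1 - alpha) / alpha)) => _ [N _ <-].
  by apply: sum_le_sum_powR => //; [move=> j; exact: cmod_ge0|exact: sa].
pose C0 := sup (range T).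
have TC N : T N <= C0 by apply: ub_le_sup; [exact: hT.2|exists N].
(* [C0] is the sum of all [cmod (c' j)], and these dominate the terms of the series for [phi]; so
   [eta N] bounds its tail after [N] terms. *)
pose eta N := C0 - T N.
have eta0 N : 0 <= eta N by rewrite subr_ge0.
pose S n x := \sum_(j < n) c j * (cos (theta j * x) -i* sin (theta j * x)) * ga j x.
have tail N x : 0 < x -> cmod (phi x - S N x) <= eta N.
  move=> x0; apply/ler_addgt0Pr => e e0.
  have /cvgrPdist_le /(_ _ e0) [n1 _ Hn1] := cvg_phi x x0.
  have := Hn1 (n1 + N)%N (leq_addr _ _); rewrite /= sub0r normrN ger0_norm ?cmod_ge0// -/(S _ x) => h.
  have -> : phi x - S N x = (S (n1 + N)%N x - S N x) + (phi x - S (n1 + N)%N x) by ring.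
  apply: (le_trans (cmodD _ _)); apply: lerD => //.
  rewrite /eta lerBrDr; apply: le_trans (TC (n1 + N)%N).
  elim: n1 {Hn1 h} => [|k IH]; first by rewrite add0n subrr cmod0 add0r.
  rewrite addSn /S /T !big_ord_recr /= -/(S _ x) -/(T _).
  have -> (z : R[i]) : S (k + N)%N x + z - S N x = (S (k + N)%N x - S N x) + z by ring.
  have h := cmodD (S (k + N)%N x - S N x) (c (k + N)%N * wave (theta (k + N)%N) x * ga (k + N)%N x).
  apply: (le_trans (lerD h (lexx (T N)))); rewrite addrAC; apply: lerD => //.
  by rewrite cc' !cmodM cmod_wave mulr1 mulrC ler_wpM2r ?cmod_ge0// gaB.
exists c', theta, g, v, (V + 2 ^+ p * (L + V ^+ p)), C0, (B `^ alpha * A), eta; split.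
- split=> j n.
  + by rewrite /g cmodM cmodR gtr0_norm// mulrC ler_pdivrMr// mul1r gaB.
  + by rewrite mulr_ge0// ltW.
  + rewrite /g -mulrBr cmodM cmodR gtr0_norm// ler_wpM2l ?(ltW Bi0)//; exact: cell_diff (HV j) n.
- have S0 : 0 <= 2 ^+ p * (L + V ^+ p) by rewrite mulr_ge0 ?addr_ge0 ?exprn_ge0.
  split=> //.
  + move=> j k; rewrite -mulr_sumr ler_wpDr//; apply: le_trans (sum_cell_var (HV j) k).
    by rewrite ler_piMl//; apply: sumr_ge0.
  + move=> j k; rewrite ler_wpDl//; apply: le_trans (sum_node_pow p0 L0 (HV j) (HL j) k).
    apply: ler_sum => n _; apply: lerXn2r; rewrite ?nnegrE ?cmod_ge0//.
    by rewrite /g cmodM cmodR gtr0_norm// ler_piMl ?cmod_ge0.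
- split=> // e e0; have [_ [N _ <-] lt] := sup_adherent e0 hT.
  by exists N; rewrite /eta lerBlDr -lerBlDl ltW.
- by move=> x x0; have := tail 0%N x x0; rewrite /S /eta /T !big_ord0 !subr0.
move=> N n x nx.
have x0 : 0 < x by case/andP: nx => nx _; exact: lt_le_trans nx.
have -> : 'i * phi x - pot c' theta g N n x =
   'i * (\sum_(j < N) c j * (wave (theta j) x * (ga j x - B%:C * lin g j n x)) + (phi x - S N x)).
  rewrite /pot -mulrBr; congr ('i * _).
  have -> : \sum_(j < N) c j * (wave (theta j) x * (ga j x - B%:C * lin g j n x)) =
      S N x - \sum_(j < N) c' j * (wave (theta j) x * lin g j n x).
    by rewrite /S -sumrB; apply: eq_bigr => j _; rewrite /c' /wave; ring.
  by ring.
have i1 : cmod 'i = 1 by rewrite cmodE /= expr0n add0r expr1n sqrtr1.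
rewrite cmodM i1 mul1r; apply: (le_trans (cmodD _ _)); apply: lerD; last exact: tail.
apply: (le_trans (cmod_sum _ _ _)); apply: ler_sum => j _.
rewrite cc' !cmodM cmod_wave mul1r /v mulrACA mulfV ?gt_eqF// mul1r ler_wpM2l ?cmod_ge0//.
have -> : B%:C * lin g j n x =
    ga j (node n) + (x - node n)%:C * (ga j (node n.+1) - ga j (node n)).
  by rewrite /lin -!Bcg; ring.
exact: cell_lin (HV j) n x nx.
Qed.

(** The a priori estimate, with one constant for all intervals, error rates and forcings. It is used
    with [e = 0] for solutions, and with [e] of order [eps] on intervals of length [1 / eps] for the
    resolvent, where the exponential stays bounded. *)
Definition tame (phi : R -> R[i]) (E : R) : Prop :=
  exists2 C : R, 1 <= C & forall (e a b : R) (P Y1 Y2 M : R -> R), 0 <= e -> 0 <= a -> a <= b ->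
    energy_system phi E e a b P Y1 Y2 M ->
    P b <= C * expR (C * e * (b - a)) * (P a + (M b - M a)) /\
    P a <= C * expR (C * e * (b - a)) * (P b + (M b - M a)).

Lemma wigner_von_neumann_tame p alpha phi : (3 <= p)%N -> odd p -> 0 < alpha ->
  alpha < 1 / (p - 2)%:R -> wigner_von_neumann p alpha phi ->
  (exists B, forall x, 0 < x -> cmod (phi x) <= B) /\
  forall sigma, (p - 2)%:R * alpha < sigma -> small_covers sigma [set E | ~ tame phi E].
Proof.
move=> p3 podd alpha0 alpha_lt WvN.
have m0 : (0 < p - 2)%N by rewrite subn_gt0.
have m1 : 1 <= (p - 2)%:R :> R by rewrite ler1n.
have alpha1 : alpha <= 1.
  by rewrite (le_trans (ltW alpha_lt))// ler_pdivrMr ?mul1r// (lt_le_trans ltr01).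
have [c [theta [g [v [K0 [C0 [A [eta]]]]]]]] :=
  wigner_von_neumann_sampling (leq_trans (isT : 0 < 3)%N p3) alpha0 alpha1 WvN.
move=> [[g1 v0 gv] [sv sg sc sA] [eta0 eta_cvg] phiB phi_app].
split; first by exists C0.
move=> sigma bs; set b := (p - 2)%:R * alpha in bs *.
have b0 : 0 < b by rewrite mulr_gt0// (lt_le_trans ltr01).
pose s := (b + sigma) / 2.
have bs1 : b < s by rewrite /s; lra.
have ss : s < sigma by rewrite /s; lra.
move=> e e0.
have [lo [len [h1 h2 h3]]] := not_light_cover
  (@tlist_gt0 R (p - 2) c theta alpha) (@tlist_mono R _ m0 c theta alpha)
  (svalP (cid (@tlist_mass R _ m0 c theta alpha A sA))) b0 bs1 ss e0.
exists lo, len; split => // E nt; apply: h2 => lE; apply: nt.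
have [nres [Sig HSig]] := light_good m0 alpha0 alpha1 sA lE bs1.
have apriori := energy_apriori p3 podd g1 v0 gv sv sg sc eta0 phiB phi_app eta_cvg.
by have [C C1 HC] := apriori _ _ nres HSig; exists C.
Qed.

End WignerVonNeumannData.

(** * Solutions of the Dirac equation *)

Section DiracEnergy.
Context {R : realType}.
Local Open Scope complex_scope.
Local Notation leb := (@lebesgue_measure R).
Local Notation cmod := (@Normc.normc R).
Local Notation C2 := 'cV[R[i]]_2.
Implicit Types (U : R -> C2) (v w h : C2) (phi : R -> R[i]).

Lemma cauchy_schwarz4 (a b c d x y z w : R) :
  `|a * x + b * y + c * z + d * w| <=
  Num.sqrt (a ^+ 2 + b ^+ 2 + c ^+ 2 + d ^+ 2) * Num.sqrt (x ^+ 2 + y ^+ 2 + z ^+ 2 + w ^+ 2).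
Proof.
rewrite -sqrtrM ?addr_ge0 ?sqr_ge0// -sqrtr_sqr ler_wsqrtr// -subr_ge0.
have -> : (a ^+ 2 + b ^+ 2 + c ^+ 2 + d ^+ 2) * (x ^+ 2 + y ^+ 2 + z ^+ 2 + w ^+ 2) -
    (a * x + b * y + c * z + d * w) ^+ 2 =
  (a * y - b * x) ^+ 2 + (a * z - c * x) ^+ 2 + (a * w - d * x) ^+ 2 +
  (b * z - c * y) ^+ 2 + (b * w - d * y) ^+ 2 + (c * w - d * z) ^+ 2 by ring.
by rewrite !addr_ge0// sqr_ge0.
Qed.

Lemma vnormE v : vnorm v = Num.sqrt (complex.Re (v 0 0) ^+ 2 + complex.Im (v 0 0) ^+ 2 +
  complex.Re (v 1 0) ^+ 2 + complex.Im (v 1 0) ^+ 2).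
Proof.
rewrite /vnorm big_ord_recl big_ord1 !cmod_sqr -[RHS]/(Num.sqrt _) !addrA.
by rewrite (_ : lift ord0 ord0 = 1)//; exact/val_inj.
Qed.

Lemma vnorm_ge0 v : 0 <= vnorm v. Proof. exact: sqrtr_ge0. Qed.

Lemma vnorm_sqr v : vnorm v ^+ 2 = complex.Re (v 0 0) ^+ 2 + complex.Im (v 0 0) ^+ 2 +
  complex.Re (v 1 0) ^+ 2 + complex.Im (v 1 0) ^+ 2.
Proof. by rewrite vnormE sqr_sqrtr// !addr_ge0// sqr_ge0. Qed.

Lemma ord2P (Q : 'I_2 -> Prop) : Q 0 -> Q 1 -> forall i, Q i.
Proof.
move=> Q0 Q1 [[|[|i]] // h].
  by have -> : Ordinal h = 0 by exact: val_inj.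
by have -> : Ordinal h = 1 by exact: val_inj.
Qed.

Lemma cmod_le_vnorm v (i : 'I_2) : cmod (v i 0) <= vnorm v.
Proof.
apply: cmod_le; first exact: vnorm_ge0.
rewrite vnorm_sqr; move: i; apply: ord2P; last rewrite -addrA lerDr addr_ge0 ?sqr_ge0//.
by rewrite -addrA lerDl addr_ge0 ?sqr_ge0.
Qed.

Lemma abs_continuous_ac a b U (i : 'I_2) : abs_continuous_on a b U ->
  ac a b (fun x => complex.Re (U x i 0)) /\ ac a b (fun x => complex.Im (U x i 0)).
Proof.
move=> acU; split=> e e0; have [d d0 Hd] := acU e e0; exists d => // n s t st ord lt;
  apply: le_lt_trans (Hd n s t st ord lt); apply: ler_sum => k _;
  apply: le_trans (cmod_le_vnorm _ i); rewrite !mxE.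
- by rewrite -ReN -ReD; exact: cmod_Re.
- by rewrite -ImN -ImD; exact: cmod_Im.
Qed.

Lemma dirac_exprE phi x v w : dirac_expr phi x v w 0 0 = 'i * v 0 0 + phi x * w 1 0 /\
  dirac_expr phi x v w 1 0 = conjc (phi x) * w 0 0 - 'i * v 1 0.
Proof.
by split; rewrite /dirac_expr !mxE !big_ord_recl !big_ord0 !mxE /= (_ : lift ord0 ord0 = 1 :> 'I_2);
  try exact/val_inj; rewrite /= ?mul0r !addr0 ?add0r // mulNr addrC.
Qed.

Definition density U x : R := vnorm (U x) ^+ 2.
Definition cross_re U x : R :=
  2 * (complex.Re (U x 0 0) * complex.Re (U x 1 0) + complex.Im (U x 0 0) * complex.Im (U x 1 0)).
Definition cross_im U x : R :=
  2 * (complex.Im (U x 0 0) * complex.Re (U x 1 0) - complex.Re (U x 0 0) * complex.Im (U x 1 0)).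

(** The difference of the two sides is the square of [|U_1|^2 - |U_2|^2]. *)
Lemma cross_le_density U x : cross_re U x ^+ 2 + cross_im U x ^+ 2 <= density U x ^+ 2.
Proof.
rewrite /cross_re /cross_im /density vnorm_sqr.
set a := complex.Re (U x 0 0); set b := complex.Im (U x 0 0).
set c := complex.Re (U x 1 0); set d := complex.Im (U x 1 0).
by have := sqr_ge0 (a ^+ 2 + b ^+ 2 - c ^+ 2 - d ^+ 2); nra.
Qed.

(** [h] is the residual of the equation. The error in each of the three equations is twice the real
    inner product of [U] with a vector obtained from [h] by permuting its four real components and
    changing signs, hence at most [2 |U| |h|]. *)
Lemma density_system phi E e a b U (M : R -> R) : a <= b -> abs_continuous_on a b U ->
  (forall x y, a <= x -> x <= y -> y <= b -> M x <= M y) ->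
  {ae leb, forall x, a < x < b -> exists v h (nu : R),
    [/\ has_vderive U x v, dirac_expr phi x v (U x) = E%:C *: U x + h,
        is_derive x 1 M nu, 0 <= nu & 2 * (vnorm (U x) * vnorm h) <= e * density U x + nu]} ->
  energy_system phi E e a b (density U) (cross_re U) (cross_im U) M.
Proof.
move=> ab acU ndM HU.
have [ac1 ac2] := abs_continuous_ac 0 acU; have [ac3 ac4] := abs_continuous_ac 1 acU.
have acC (k : R) f : ac a b f -> ac a b (fun x => k * f x).
  by move=> acf; apply: acM => //; apply: (@ac_lipschitz _ _ _ _ 0) => s t _ _ _; rewrite subrr normr0 mul0r.
have densE : density U = fun x => complex.Re (U x 0 0) * complex.Re (U x 0 0) + complex.Im (U x 0 0) * complex.Im (U x 0 0) +
   complex.Re (U x 1 0) * complex.Re (U x 1 0) + complex.Im (U x 1 0) * complex.Im (U x 1 0).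
  by apply/funext => x; rewrite /density vnorm_sqr !expr2.
have crimE : cross_im U = fun x =>
   2 * (complex.Im (U x 0 0) * complex.Re (U x 1 0) + -1 * (complex.Re (U x 0 0) * complex.Im (U x 1 0))).
  by apply/funext => x; rewrite mulN1r.
split=> //.
- split; first by rewrite densE; apply: acD; [apply: acD; [apply: acD|]|]; apply: acM.
    by apply: (acC); apply: acD; apply: acM.
  by rewrite crimE; apply: (acC); apply: acD; [apply: acM|apply: (acC); apply: acM].
- by move=> x _; split; [exact: sqr_ge0|exact: cross_le_density].
apply: (ae_imp HU) => x H axb; have [v [h [nu [dU eqU dM nu0 le]]]] := H axb.
have [d1 d2] := dU 0; have [d3 d4] := dU 1.
have [e0 e1] := dirac_exprE phi x v (U x).
have {e0} q0 : v 0 0 = - 'i * (E%:C * U x 0 0 + h 0 0 - phi x * U x 1 0).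
  have : 'i * v 0 0 + phi x * U x 1 0 = E%:C * U x 0 0 + h 0 0 by rewrite -e0 eqU !mxE.
  move=> <-; rewrite addrK mulrA mulNr -expr2 sqr_i opprK mul1r//.
have {e1} q1 : v 1 0 = 'i * (E%:C * U x 1 0 + h 1 0 - conjc (phi x) * U x 0 0).
  have : conjc (phi x) * U x 0 0 - 'i * v 1 0 = E%:C * U x 1 0 + h 1 0 by rewrite -e1 eqU !mxE.
  by move=> <-; rewrite addrAC subrr sub0r mulrN mulrA -expr2 sqr_i mulN1r opprK.
have D1 := is_derive_add (is_derive_add (is_derive_add (is_derive_mul d1 d1) (is_derive_mul d2 d2))
  (is_derive_mul d3 d3)) (is_derive_mul d4 d4).
have D2 := is_derive_mulc 2 (is_derive_add (is_derive_mul d1 d3) (is_derive_mul d2 d4)).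
have D3 := is_derive_mulc 2 (is_derive_add (is_derive_mul d2 d3) (is_derive_mulc (-1) (is_derive_mul d1 d4))).
rewrite -densE in D1; rewrite -crimE in D3.
eexists _, _, _, nu; split; [by split; [exact: D1|exact: D2|exact: D3|exact: dM]|exact: nu0| | |].
all: rewrite q0 q1; apply: le_trans le; rewrite /density ?vnorm_sqr !vnormE /cross_re /cross_im.
all: move: (U x 0 0) (U x 1 0) (h 0 0) (h 1 0) (phi x) => [u1 u2] [u3 u4] [h1 h2] [h3 h4] [f1 f2] /=.
all: have n2 : `|2 : R| = 2 by rewrite ger0_norm.
- rewrite (_ : _ - _ = 2 * (u1 * h2 + u2 * - h1 + u3 * - h4 + u4 * h3)); last by ring.
  by rewrite normrM n2 ler_pM2l//; apply: le_trans (cauchy_schwarz4 _ _ _ _ _ _ _ _) _;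
    rewrite !sqrrN le_eqVlt; apply/orP; left; apply/eqP; congr (_ * Num.sqrt _); ring.
- rewrite (_ : _ - _ = 2 * (u1 * - h4 + u2 * h3 + u3 * h2 + u4 * - h1)); last by ring.
  by rewrite normrM n2 ler_pM2l//; apply: le_trans (cauchy_schwarz4 _ _ _ _ _ _ _ _) _;
    rewrite !sqrrN le_eqVlt; apply/orP; left; apply/eqP; congr (_ * Num.sqrt _); ring.
- rewrite (_ : _ - _ = 2 * (u1 * - h3 + u2 * - h4 + u3 * - h1 + u4 * - h2)); last by ring.
  by rewrite normrM n2 ler_pM2l//; apply: le_trans (cauchy_schwarz4 _ _ _ _ _ _ _ _) _;
    rewrite !sqrrN le_eqVlt; apply/orP; left; apply/eqP; congr (_ * Num.sqrt _); ring.
Qed.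

(** Every point is compared with the point 1, the two directions of the estimate serving the points
    after and before it. *)
Lemma tame_solution_bounded phi E U : tame phi E -> dirac_solution phi E U -> ~ unbounded_pos U.
Proof.
move=> [C C1 HC] [acU eqU] unb.
have C0 : 0 <= C by exact: le_trans C1.
have sys a b : 0 < a -> a <= b -> energy_system phi E 0 a b (density U) (cross_re U) (cross_im U) (fun=> 0).
  move=> a0 ab; apply: density_system => //.
    by apply: acU => // x /=; rewrite !in_itv /= andbT => /andP[ax _]; exact: lt_le_trans ax.
  apply: (ae_imp eqU) => x H /andP[ax _]; have [v dU eU] := H (lt_trans a0 ax).
  have v0 : vnorm (0 : C2) = 0 by rewrite vnormE !mxE /= expr0n /= !addr0 sqrtr0.
  exists v, 0, 0; split => //; first by rewrite addr0.
    exact: is_derive_cst.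
  by rewrite v0 !mulr0 mul0r addr0.
have le x : 0 < x -> density U x <= C * density U 1.
  move=> x0; have [x1|/ltW x1] := leP 1 x.
    have [h _] := HC _ _ _ _ _ _ _ (lexx 0) ler01 x1 (sys _ _ ltr01 x1).
    by move: h; rewrite mulr0 mul0r expR0 mulr1 subrr addr0.
  have [_ h] := HC _ _ _ _ _ _ _ (lexx 0) (ltW x0) x1 (sys _ _ x0 x1).
  by move: h; rewrite mulr0 mul0r expR0 mulr1 subrr addr0.
have [x x0 lt] := unb (Num.sqrt (C * density U 1)).
have B0 : 0 <= C * density U 1 by rewrite mulr_ge0// sqr_ge0.
have := le x x0; rewrite leNgt => /negP; apply; rewrite /density.
rewrite -[ltLHS](sqr_sqrtr B0).
by apply: ltrXn2r => //; exact: sqrtr_ge0.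
Qed.

End DiracEnergy.

(** * Square-integrable functions *)

Section SquareIntegrable.
Context {R : realType}.
Local Open Scope complex_scope.
Local Notation leb := (@lebesgue_measure R).
Local Notation cmod := (@Normc.normc R).
Local Notation C2 := 'cV[R[i]]_2.
Local Notation D := (`]0%R, +oo[%classic : set R).
Implicit Types (f g h k : R -> C2) (c : R[i]).

Definition lc f c g : R -> C2 := fun x => f x + c *: g x.
Definition inner f g (x : R) : R[i] := \sum_(i < 2) conjc (f x i 0) * g x i 0.
Definition N2 f : R := complex.Re (L2dot f f).

Lemma measurable_pos : measurable (D : set (measurableTypeR R)).
Proof. exact: measurable_itv. Qed.

Lemma measurable_vnorm_sqr f : L2 f -> measurable_fun D (fun x => vnorm (f x) ^+ 2).
Proof.
move=> [mf _]; have -> : (fun x => vnorm (f x) ^+ 2) = (fun x => complex.Re (f x 0 0) ^+ 2 +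
    complex.Im (f x 0 0) ^+ 2 + complex.Re (f x 1 0) ^+ 2 + complex.Im (f x 1 0) ^+ 2).
  by apply/funext => x; rewrite vnorm_sqr.
by repeat apply: measurable_funD; apply: measurable_funX; [exact: (mf 0).1|exact: (mf 0).2|exact: (mf 1).1|exact: (mf 1).2].
Qed.

Lemma integrable_of_bound (u v : R -> R) : measurable_fun D u ->
  (forall x, `|u x| <= v x) -> leb.-integrable D (EFin \o v) -> leb.-integrable D (EFin \o u).
Proof.
move=> mu uv; apply: le_integrable; first exact: measurable_pos.
  exact/measurable_EFinP.
by move=> x _ /=; rewrite lee_fin; apply: (le_trans (uv x)); exact: ler_norm.
Qed.

Lemma L2_integrable f : L2 f -> leb.-integrable D (EFin \o (fun x => vnorm (f x) ^+ 2)).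
Proof.
move=> L2f; have [_ fin] := L2f; apply/integrableP; split.
  by apply/measurable_EFinP; exact: measurable_vnorm_sqr.
apply: le_lt_trans fin; rewrite le_eqVlt; apply/orP; left; apply/eqP; apply: eq_integral => x _ /=.
by rewrite ger0_norm ?sqr_ge0.
Qed.

Lemma innerE f g x : inner f g x = conjc (f x 0 0) * g x 0 0 + conjc (f x 1 0) * g x 1 0.
Proof. by rewrite /inner big_ord_recl big_ord1 (_ : lift ord0 ord0 = 1)//; exact/val_inj. Qed.

Lemma Re_conjM (z w : R[i]) :
  complex.Re (conjc z * w) = complex.Re z * complex.Re w + complex.Im z * complex.Im w.
Proof. by case: z => a b; case: w => c d /=; rewrite mulNr opprK. Qed.

Lemma Im_conjM (z w : R[i]) :
  complex.Im (conjc z * w) = complex.Re z * complex.Im w - complex.Im z * complex.Re w.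
Proof. by case: z => a b; case: w => c d /=; rewrite mulNr. Qed.

Lemma inner_bound f g x :
  `|complex.Re (inner f g x)| <= vnorm (f x) ^+ 2 + vnorm (g x) ^+ 2 /\
  `|complex.Im (inner f g x)| <= vnorm (f x) ^+ 2 + vnorm (g x) ^+ 2.
Proof.
rewrite innerE ReD ImD !Re_conjM !Im_conjM !vnorm_sqr.
move: (f x 0 0) (f x 1 0) (g x 0 0) (g x 1 0) => [a b] [c d] [a' b'] [c' d'] /=.
have le2 (s t : R) : `|s * t| <= (s ^+ 2 + t ^+ 2) / 2.
  rewrite ler_norml; have := sqr_ge0 (s + t); have := sqr_ge0 (s - t); rewrite !expr2 => h1 h2.
  by apply/andP; split; lra.
have sq (s : R) : 0 <= s ^+ 2 by exact: sqr_ge0.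
have := sq a; have := sq b; have := sq c; have := sq d.
have := sq a'; have := sq b'; have := sq c'; have := sq d'.
split; apply: (le_trans (ler_normD _ _)).
  have := ler_normD (a * a') (b * b'); have := ler_normD (c * c') (d * d').
  have := le2 a a'; have := le2 b b'; have := le2 c c'; have := le2 d d'; lra.
have := ler_normB (a * b') (b * a'); have := ler_normB (c * d') (d * c').
have := le2 a b'; have := le2 b a'; have := le2 c d'; have := le2 d c'; lra.
Qed.

Lemma inner_integrable f g : L2 f -> L2 g ->
  leb.-integrable D (EFin \o (fun x => complex.Re (inner f g x))) /\
  leb.-integrable D (EFin \o (fun x => complex.Im (inner f g x))).
Proof.
move=> L2f L2g; have [mf _] := L2f; have [mg _] := L2g.
have intS : leb.-integrable D (EFin \o (fun x => vnorm (f x) ^+ 2 + vnorm (g x) ^+ 2)).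
  have := integrableD measurable_pos (L2_integrable L2f) (L2_integrable L2g).
  by congr (_.-integrable _ _); apply/funext => x.
split; apply: integrable_of_bound intS.
- have -> : (fun x => complex.Re (inner f g x)) = (fun x =>
     (complex.Re (f x 0 0) * complex.Re (g x 0 0) + complex.Im (f x 0 0) * complex.Im (g x 0 0)) +
     (complex.Re (f x 1 0) * complex.Re (g x 1 0) + complex.Im (f x 1 0) * complex.Im (g x 1 0))).
    by apply/funext => x; rewrite innerE ReD !Re_conjM.
  by repeat apply: measurable_funD; apply: measurable_funM;
    (exact: (mf _).1 || exact: (mf _).2 || exact: (mg _).1 || exact: (mg _).2).
- by move=> x; exact: (inner_bound f g x).1.
- have -> : (fun x => complex.Im (inner f g x)) = (fun x =>
     (complex.Re (f x 0 0) * complex.Im (g x 0 0) - complex.Im (f x 0 0) * complex.Re (g x 0 0)) +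
     (complex.Re (f x 1 0) * complex.Im (g x 1 0) - complex.Im (f x 1 0) * complex.Re (g x 1 0))).
    by apply/funext => x; rewrite innerE ImD !Im_conjM.
  by apply: measurable_funD; apply: measurable_funB; apply: measurable_funM;
    (exact: (mf _).1 || exact: (mf _).2 || exact: (mg _).1 || exact: (mg _).2).
- by move=> x; exact: (inner_bound f g x).2.
Qed.

Lemma vnorm_sqr_cmod (v : C2) : vnorm v ^+ 2 = cmod (v 0 0) ^+ 2 + cmod (v 1 0) ^+ 2.
Proof. by rewrite vnorm_sqr !cmod_sqr addrA. Qed.

Lemma vnorm_lc f c g x :
  vnorm (lc f c g x) ^+ 2 <= 2 * vnorm (f x) ^+ 2 + 2 * cmod c ^+ 2 * vnorm (g x) ^+ 2.
Proof.
rewrite !vnorm_sqr_cmod.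
have H (i : 'I_2) : cmod (lc f c g x i 0) ^+ 2 <= 2 * cmod (f x i 0) ^+ 2 + 2 * cmod c ^+ 2 * cmod (g x i 0) ^+ 2.
  rewrite /lc !mxE; have := cmodD (f x i 0) (c * g x i 0); rewrite cmodM => h.
  apply: (@le_trans _ _ ((cmod (f x i 0) + cmod c * cmod (g x i 0)) ^+ 2)).
    by apply: lerXn2r; rewrite ?nnegrE ?addr_ge0 ?mulr_ge0 ?cmod_ge0.
  rewrite -mulrA -exprMn; move: (cmod _ * _) (cmod _) => s t.
  by have := sqr_ge0 (s - t); rewrite !expr2 => h2; lra.
have := H 0; have := H 1; lra.
Qed.

Lemma L2_lc f c g : L2 f -> L2 g -> L2 (lc f c g).
Proof.
move=> L2f L2g; have [mf _] := L2f; have [mg _] := L2g.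
have mlc : forall i : 'I_2,
     measurable_fun D (fun x : R => complex.Re (lc f c g x i 0)) /\
     measurable_fun D (fun x : R => complex.Im (lc f c g x i 0)).
  move=> i; split.
    have -> : (fun x => complex.Re (lc f c g x i 0)) = (fun x => complex.Re (f x i 0) +
       (complex.Re c * complex.Re (g x i 0) - complex.Im c * complex.Im (g x i 0))).
      by apply/funext => x; rewrite /lc !mxE ReD ReM.
    apply: measurable_funD; first exact: (mf i).1.
    by apply: measurable_funB; apply: measurable_funM; (exact: (mg i).1 || exact: (mg i).2 || exact: measurable_cst).
  have -> : (fun x => complex.Im (lc f c g x i 0)) = (fun x => complex.Im (f x i 0) +
     (complex.Re c * complex.Im (g x i 0) + complex.Im c * complex.Re (g x i 0))).
    by apply/funext => x; rewrite /lc !mxE ImD ImM.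
  apply: measurable_funD; first exact: (mf i).2.
  by apply: measurable_funD; apply: measurable_funM; (exact: (mg i).1 || exact: (mg i).2 || exact: measurable_cst).
split=> //.
have intS := integrableD measurable_pos (integrableZl measurable_pos 2 (L2_integrable L2f))
  (integrableZl measurable_pos (2 * cmod c ^+ 2) (L2_integrable L2g)).
apply: (le_lt_trans _ (integrable_lty measurable_pos intS)).
apply: ge0_le_integral_nomeas => x _ /=; first by rewrite lee_fin sqr_ge0.
by rewrite -!EFinM -EFinD lee_fin vnorm_lc.
Qed.

Lemma L2dotE f g : L2dot f g = Rintegral leb D (fun x => complex.Re (inner f g x)) +i*
  Rintegral leb D (fun x => complex.Im (inner f g x)).
Proof. by []. Qed.

Lemma L2dotC f g : L2 f -> L2 g -> L2dot g f = conjc (L2dot f g).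
Proof.
move=> L2f L2g; have [_ iI] := inner_integrable L2f L2g.
rewrite !L2dotE /=; congr (_ +i* _).
  by apply: eq_Rintegral => x _; rewrite !innerE !ReD !Re_conjM; ring.
rewrite -mulN1r -RintegralZl; [|exact: measurable_pos|exact: iI].
by apply: eq_Rintegral => x _; rewrite !innerE !ImD !Im_conjM; ring.
Qed.

Lemma L2dot_lcr f g c h : L2 f -> L2 g -> L2 h ->
  L2dot f (lc g c h) = L2dot f g + c * L2dot f h.
Proof.
move=> L2f L2g L2h; have [r1 i1] := inner_integrable L2f L2g; have [r2 i2] := inner_integrable L2f L2h.
have mD := measurable_pos.
have iZ (a : R) (u : R -> R) : leb.-integrable D (EFin \o u) -> leb.-integrable D (EFin \o (fun x => a * u x)).
  by move=> iu; have := integrableZl mD a iu; congr (_.-integrable _ _); apply/funext => x.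
have iD (u v : R -> R) : leb.-integrable D (EFin \o u) -> leb.-integrable D (EFin \o v) ->
    leb.-integrable D (EFin \o (fun x => u x + v x)).
  by move=> iu iv; have := integrableD mD iu iv; congr (_.-integrable _ _); apply/funext => x.
rewrite !L2dotE; apply/eqP; rewrite eq_complex ReD ImD ReM ImM /=.
rewrite -mulNr -!RintegralZl//.
rewrite -!RintegralD//; try (by apply: iZ); try (by apply: iD; apply: iZ).
by apply/andP; split; apply/eqP; apply: eq_Rintegral => x _; rewrite !innerE /lc !mxE;
  move: (f x 0 0) (f x 1 0) (g x 0 0) (g x 1 0) (h x 0 0) (h x 1 0) c
   => [? ?] [? ?] [? ?] [? ?] [? ?] [? ?] [? ?] /=; ring.
Qed.

Lemma conjcD (z w : R[i]) : conjc (z + w) = conjc z + conjc w.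
Proof. exact: rmorphD. Qed.

Lemma L2dot_lcl f g c h : L2 f -> L2 g -> L2 h ->
  L2dot (lc g c h) f = L2dot g f + conjc c * L2dot h f.
Proof.
move=> L2f L2g L2h; rewrite (L2dotC L2f (L2_lc c L2g L2h)) (L2dot_lcr c L2f L2g L2h).
by rewrite conjcD conjcM -(L2dotC L2f L2g) -(L2dotC L2f L2h).
Qed.

Lemma L2dot_ae f g g' : L2 f -> L2 g -> L2 g' -> ae_eq_pos g g' -> L2dot f g = L2dot f g'.
Proof.
move=> L2f L2g L2g' gg'; have [r1 i1] := inner_integrable L2f L2g.
have [r2 i2] := inner_integrable L2f L2g'.
rewrite !L2dotE /Rintegral; congr (fine _ +i* fine _); apply: ae_eq_integral.
1,5: exact: measurable_pos.
1,2,4,5: by [case/integrableP: r1|case/integrableP: r2|case/integrableP: i1|case/integrableP: i2].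
all: apply: (ae_imp gg') => x H /=; rewrite in_itv /= andbT => x0; by rewrite /inner H.
Qed.

Lemma N2E f : N2 f = Rintegral leb D (fun x => vnorm (f x) ^+ 2).
Proof.
rewrite /N2 L2dotE /=; apply: eq_Rintegral => x _.
by rewrite innerE ReD !Re_conjM vnorm_sqr; ring.
Qed.

Lemma N2_EFin f : L2 f -> ((N2 f)%:E = \int[leb]_(x in D) (vnorm (f x) ^+ 2)%:E)%E.
Proof.
move=> L2f; rewrite N2E /Rintegral fineK//.
have := integrable_fin_num measurable_pos (L2_integrable L2f); exact.
Qed.

Lemma N2_ge0 f : 0 <= N2 f.
Proof. by rewrite N2E; apply: Rintegral_ge0 => x _; exact: sqr_ge0. Qed.

Lemma L2dotff f : L2 f -> L2dot f f = (N2 f)%:C.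
Proof.
move=> L2f; have := L2dotC L2f L2f; rewrite /N2; case: (L2dot f f) => a b [] /= h.
by congr (_ +i* _); lra.
Qed.

Lemma N2_lc f c g : L2 f -> L2 g ->
  N2 (lc f c g) = N2 f + 2 * complex.Re (c * L2dot f g) + cmod c ^+ 2 * N2 g.
Proof.
move=> L2f L2g; rewrite {1}/N2 (L2dot_lcl c (L2_lc c L2f L2g) L2f L2g).
rewrite (L2dot_lcr c L2f L2f L2g) (L2dot_lcr c L2g L2f L2g) (L2dotC L2f L2g).
rewrite (L2dotff L2f) (L2dotff L2g) cmod_sqr.
by case: c => a b; case: (L2dot f g) => u v /=; ring.
Qed.

Lemma N2_lc_le f c g : L2 f -> L2 g -> N2 (lc f c g) <= 2 * N2 f + 2 * cmod c ^+ 2 * N2 g.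
Proof.
move=> L2f L2g; have := N2_ge0 (lc f (- c) g); rewrite !N2_lc// cmodN mulNr ReN; lra.
Qed.

(** When [N2 g = 0], the square norm of [f + s c g] is affine in the real number [s], and
    nonnegativity forces its slope to vanish. A nonzero slope would allow the value -1, which is how
    [s] is chosen. *)
Lemma N2_eq0_dot f g : L2 f -> L2 g -> N2 g = 0 -> L2dot f g = 0.
Proof.
move=> L2f L2g g0.
have H c : complex.Re (c * L2dot f g) = 0.
  set b := complex.Re _; apply: contrapT => /eqP b0.
  pose s := - (N2 f + 1) / (2 * b).
  have := N2_ge0 (lc f (s%:C * c) g); rewrite N2_lc// g0 mulr0 addr0.
  have -> : complex.Re (s%:C * c * L2dot f g) = s * b.
    by rewrite /b -mulrA ReM /= mul0r subr0.
  have -> : 2 * (s * b) = - (N2 f + 1) by rewrite /s; field.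
  lra.
have := H 1; have := H (- 'i); rewrite mul1r; case: (L2dot f g) => a b /=.
by rewrite !(oppr0, mul0r, mulNr, mul1r, opprK, sub0r) => -> ->.
Qed.

Lemma N2_ae (f g : R -> C2) : L2 f -> L2 g -> ae_eq_pos f g -> N2 f = N2 g.
Proof.
move=> L2f L2g fg; rewrite /N2 (L2dot_ae L2f L2f L2g fg) (L2dotC L2g L2f).
by rewrite (L2dot_ae L2g L2f L2g fg); case: (L2dot g g).
Qed.

Lemma N2_eq0_dotl (f g : R -> C2) : L2 f -> L2 g -> N2 f = 0 -> L2dot f g = 0.
Proof. by move=> L2f L2g f0; rewrite L2dotC// N2_eq0_dot//; exact: conjc0. Qed.

End SquareIntegrable.

(** * Spectral resolutions *)

Section SpectralCalculus.
Context {R : realType}.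
Local Open Scope complex_scope.
Local Notation cmod := (@Normc.normc R).
Local Notation C2 := 'cV[R[i]]_2.
Local Notation T := (measurableTypeR R).
Implicit Types (B I J : set T).
Opaque L2 L2dot.
Context (A : (R -> C2) -> (R -> C2) -> Prop).
Context (A0 : A (fun=> 0) (fun=> 0)).
Context (A_lc : forall f h g k c, A f h -> A g k -> A (lc f c g) (lc h c k)).
Context (A_L2 : forall f h, A f h -> L2 f /\ L2 h).
Context (E : set T -> (R -> C2) -> R -> C2) (mu : (R -> C2) -> {measure set T -> \bar R}).
Context (res : spectral_resolution A E mu).

Let pvm : projection_valued_measure E mu. Proof. by case: res. Qed.

Lemma E_L2 B f : measurable B -> L2 f -> L2 (E B f).
Proof. by move=> mB; case: pvm => /(_ B mB) [H _ _] _ _; exact: H. Qed.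

Lemma dot_EE B f g : measurable B -> L2 f -> L2 g -> L2dot (E B f) (E B g) = L2dot f (E B g).
Proof.
move=> mB L2f L2g; case: pvm => /(_ B mB) [HL HE HS] _ _.
by rewrite (HS _ _ L2f (HL _ L2g)); exact: L2dot_ae L2f (HL _ (HL _ L2g)) (HL _ L2g) (HE _ L2g).
Qed.

Lemma dot_E B f g : measurable B -> L2 f -> L2 g -> L2dot (E B f) g = L2dot f (E B g).
Proof. by move=> mB L2f L2g; case: pvm => /(_ B mB) [HL HE HS] _ _; exact: HS. Qed.

Lemma muE f B : measurable B -> L2 f -> mu f B = (N2 (E B f))%:E.
Proof.
move=> mB L2f; case: (pvm) => _ _ H; rewrite (H f B L2f mB) /N2 dot_EE//.
Qed.

Lemma muT f : L2 f -> mu f setT = (N2 f)%:E.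
Proof.
move=> L2f; rewrite muE//; case: (pvm) => _ /(_ f L2f) H _; congr (_%:E).
by apply: N2_ae H => //; exact: E_L2.
Qed.

Lemma N2T f : L2 f -> N2 (E setT f) = N2 f.
Proof. by move=> L2f; have := muE measurableT L2f; rewrite muT// => -[]. Qed.

Lemma mu_fin f B : measurable B -> L2 f -> (mu f B < +oo)%E.
Proof. by move=> mB L2f; rewrite muE// ltry. Qed.

Lemma muC f B : measurable B -> L2 f -> N2 (E (~` B) f) = N2 f - N2 (E B f).
Proof.
move=> mB L2f; have mC := measurableC mB.
have : mu f (B `|` ~` B) = (mu f B + mu f (~` B))%E by apply: measureU => //; exact: setICr.
by rewrite setUCr muT// !muE// => -[->]; rewrite [X in X - _]addrC addrK.
Qed.

Lemma muU f B I : measurable B -> measurable I -> B `&` I = set0 -> L2 f ->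
  N2 (E (B `|` I) f) = N2 (E B f) + N2 (E I f).
Proof.
move=> mB mI BI L2f; have mU := measurableU _ _ mB mI.
have : mu f (B `|` I) = (mu f B + mu f I)%E by exact: measureU.
by rewrite !muE// => -[].
Qed.

Lemma mu_mono f B I : measurable B -> measurable I -> B `<=` I -> L2 f -> N2 (E B f) <= N2 (E I f).
Proof. by move=> mB mI BI L2f; rewrite -lee_fin -!muE//; apply: le_measure => //; rewrite inE. Qed.

(** Symmetry moves the projections across inner products until they act on [k] and [k'] separately,
    where the combination can be expanded. *)
Lemma mu_lcl k c k' B : measurable B -> L2 k -> L2 k' -> N2 (E B k') = 0 ->
  N2 (E B (lc k c k')) = N2 (E B k).
Proof.
move=> mB L2k L2k' k0; have L2w := L2_lc c L2k L2k'.
have EL f : L2 f -> L2 (E B f) by exact: E_L2.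
rewrite -![N2 _]/(complex.Re _) (dot_EE mB L2w L2w) (dot_EE mB L2k L2k).
rewrite (L2dot_lcl c (EL _ L2w) L2k L2k').
rewrite -(dot_E mB L2k' L2w) (N2_eq0_dotl (EL _ L2k') L2w k0) mulr0 addr0.
rewrite -(dot_E mB L2k L2w) (L2dot_lcr c (EL _ L2k) L2k L2k').
by rewrite (dot_E mB L2k L2k') (N2_eq0_dot L2k (EL _ L2k') k0) mulr0 addr0 (dot_E mB L2k L2k).
Qed.

Lemma mu_lcr k c k' B : measurable B -> L2 k -> L2 k' -> conjc c * c = 1 -> N2 (E B k) = 0 ->
  N2 (E B (lc k c k')) = N2 (E B k').
Proof.
move=> mB L2k L2k' cc k0; have L2w := L2_lc c L2k L2k'.
have EL f : L2 f -> L2 (E B f) by exact: E_L2.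
rewrite -![N2 _]/(complex.Re _) (dot_EE mB L2w L2w) (dot_EE mB L2k' L2k').
rewrite (L2dot_lcl c (EL _ L2w) L2k L2k').
rewrite -(dot_E mB L2k L2w) (N2_eq0_dotl (EL _ L2k) L2w k0) add0r.
rewrite -(dot_E mB L2k' L2w) (L2dot_lcr c (EL _ L2k') L2k L2k').
by rewrite (dot_E mB L2k' L2k) (N2_eq0_dot L2k' (EL _ L2k) k0) add0r mulrA cc mul1r (dot_E mB L2k' L2k').
Qed.

(* [k] lies in the range of [E I]. *)
Definition conc I k : Prop := L2 k /\ N2 (E (~` I) k) = 0.

(** Since [E I] is idempotent, [I] carries the full mass of the spectral measure of [E I f], and
    additivity leaves nothing for the complement. This stands in for the multiplicativity of [E]. *)
Lemma conc_E I f : measurable I -> L2 f -> conc I (E I f).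
Proof.
move=> mI L2f; split; first exact: E_L2.
have L2E := E_L2 mI L2f; rewrite muC//.
have -> : N2 (E I (E I f)) = N2 (E I f).
  have [H0 _ _] := pvm; have [_ H _] := H0 I mI.
  exact: N2_ae (E_L2 mI L2E) L2E (H _ L2f).
by rewrite subrr.
Qed.

Lemma conc_null I k B : measurable I -> measurable B -> conc I k -> B `&` I = set0 -> N2 (E B k) = 0.
Proof.
move=> mI mB [L2k k0] BI; apply/eqP; rewrite eq_le N2_ge0 andbT -k0.
by apply: mu_mono => //; [exact: measurableC|move=> x Bx Ix; have : (B `&` I) x by []; rewrite BI].
Qed.

Lemma conc_lc I k c k' : measurable I -> conc I k -> conc I k' -> conc I (lc k c k').
Proof.
by move=> mI [L2k k0] [L2k' k0']; split; [exact: L2_lc|rewrite mu_lcl//; exact: measurableC].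
Qed.

(** Split [B] along [J]: [k] has no mass inside [J] and [k'] none outside, so only one of the two
    vectors counts on each piece. *)
Lemma mu_disjoint I J k c k' B : measurable I -> measurable J -> measurable B -> I `&` J = set0 ->
  conc I k -> conc J k' -> conjc c * c = 1 -> N2 (E B (lc k c k')) = N2 (E B k) + N2 (E B k').
Proof.
move=> mI mJ mB IJ ck ck' c1; have [L2k k0] := ck; have [L2k' k0'] := ck'.
have L2w := L2_lc c L2k L2k'.
have BE : B = (B `&` J) `|` (B `\` J) by rewrite setUIDK.
have mBJ := measurableI _ _ mB mJ; have mBD := measurableD mB mJ.
have dis : (B `&` J) `&` (B `\` J) = set0 by rewrite setDE setIACA setICr setI0.
have e1 : N2 (E (B `&` J) k) = 0.
  by apply: conc_null ck _ => //; rewrite -setIA (setIC J) IJ setI0.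
have e2 : N2 (E (B `\` J) k') = 0.
  by apply: conc_null ck' _ => //; rewrite setDE -setIA setICl setI0.
rewrite BE !muU// (mu_lcl c mBD L2k L2k' e2) (mu_lcr mBJ L2k L2k' c1 e1) e1 e2.
by rewrite add0r addr0 addrC.
Qed.

Let c1 : conjc 1 * 1 = 1 :> R[i].
Proof. by rewrite mulr1; exact: conjc1. Qed.
Let ci : conjc 'i * 'i = 1 :> R[i].
Proof. by apply/eqP; rewrite eq_complex /=; apply/andP; split; apply/eqP; ring. Qed.
Let cmod1 c : conjc c * c = 1 -> cmod c ^+ 2 = 1.
Proof. by rewrite cmod_sqr; case: c => a b /(congr1 (@complex.Re R)) /= <-; ring. Qed.

Lemma eq0_of_Re (z : R[i]) : complex.Re z = 0 -> complex.Re ('i * z) = 0 -> z = 0.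
Proof. by case: z => a b /= ->; rewrite mul0r mul1r sub0r => /eqP; rewrite oppr_eq0 => /eqP ->. Qed.

(** On the whole line [mu_disjoint] says that the square norm of [k + c k'] is the sum of the two;
    [c = 1] and [c = 'i] remove both parts of the inner product. *)
Lemma dot_disjoint I J k k' : measurable I -> measurable J -> I `&` J = set0 ->
  conc I k -> conc J k' -> L2dot k k' = 0.
Proof.
move=> mI mJ IJ ck ck'; have [L2k k0] := ck; have [L2k' k0'] := ck'.
have H c : conjc c * c = 1 -> complex.Re (c * L2dot k k') = 0.
  move=> cc; have := mu_disjoint mI mJ measurableT IJ ck ck' cc.
  rewrite (N2T L2k) (N2T L2k') (N2T (L2_lc c L2k L2k')).
  by rewrite N2_lc// (cmod1 cc) mul1r => h; lra.
by apply: eq0_of_Re; [rewrite -[L2dot _ _]mul1r|]; exact: H.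
Qed.

Lemma norm_le_sqr (x : R) : `|x| <= 1 + x ^+ 2.
Proof.
rewrite ler_norml; have := sqr_ge0 (x - 1); have := sqr_ge0 (x + 1); have := sqr_ge0 x.
by rewrite !expr2 => *; apply/andP; split; lra.
Qed.

Lemma realCBM (a b l : R) : a%:C + - l%:C * b%:C = (a - l * b)%:C.
Proof. by apply/eqP; rewrite eq_complex /=; apply/andP; split; apply/eqP; ring. Qed.

Lemma id_integrable k h : A k h -> (mu k).-integrable setT (EFin \o (fun l : T => l)).
Proof.
move=> Akh; have [L2k _] := A_L2 Akh; case: (res) => _ /(_ k L2k) [/(_ (ex_intro _ h Akh)) fin _] _.
have m2 : measurable_fun setT (fun l : T => l ^+ 2) by apply: measurable_funX; exact: measurable_id.
have i2 : (mu k).-integrable setT (EFin \o (fun l : T => l ^+ 2)).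
  apply/integrableP; split; first exact/measurable_EFinP.
  apply: le_lt_trans fin; rewrite le_eqVlt; apply/orP; left; apply/eqP; apply: eq_integral => x _ /=.
  by rewrite ger0_norm ?sqr_ge0.
have i1 : (mu k).-integrable setT (EFin \o (fun=> 1)).
  apply: measurable_bounded_integrable => //; first exact: mu_fin.
  by exists 1; split => // M M1 x _ /=; rewrite normr1 ltW.
have := integrableD measurableT i1 i2; apply: le_integrable => //.
  by apply/measurable_EFinP; exact: measurable_id.
move=> l _ /=; rewrite lee_fin.
by rewrite [leRHS]ger0_norm ?norm_le_sqr// addr_ge0// sqr_ge0.
Qed.

(* The spectral measure of [k + c k'] is the sum of those of [k] and [k'], so
   that the cross terms of [<k + c k', A (k + c k')>] cancel. *)
Lemma dot_A_disjoint I J k h k' h' : measurable I -> measurable J -> I `&` J = set0 ->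
  conc I k -> conc J k' -> A k h -> A k' h' -> L2dot k h' = 0.
Proof.
move=> mI mJ IJ ck ck' Ak Ak'.
have [L2k L2h] := A_L2 Ak; have [L2k' L2h'] := A_L2 Ak'.
have dotA f g : A f g -> L2dot f g = (Rintegral (mu f) setT (fun l => l))%:C.
  by case: (res) => _ _ /(_ f g).
have H c : conjc c * c = 1 -> c * L2dot k h' + conjc c * L2dot k' h = 0.
  move=> cc; have Aw := A_lc c Ak Ak'; have := dotA _ _ Aw.
  have -> : Rintegral (mu (lc k c k')) setT (fun l => l) =
      Rintegral (mu k) setT (fun l => l) + Rintegral (mu k') setT (fun l => l).
    have ik := id_integrable Ak; have ik' := id_integrable Ak'.
    rewrite /Rintegral -fineD; [|exact: integrable_fin_num ik|exact: integrable_fin_num ik'].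
    rewrite -(integral_measure_add measurableT ik ik'); congr fine.
    apply: eq_measure_integral => B mB _; rewrite /measure_add /= /msum !big_ord_recl big_ord0 /= adde0.
    by rewrite (muE mB (L2_lc c L2k L2k')) (muE mB L2k) (muE mB L2k') (mu_disjoint mI mJ mB IJ ck ck' cc).
  have -> : (Rintegral (mu k) setT (fun l => l) + Rintegral (mu k') setT (fun l => l))%:C =
    L2dot k h + L2dot k' h' by rewrite !dotA//; apply/eqP; rewrite eq_complex /= addr0 !eqxx.
  rewrite L2dot_lcl; [|exact: L2_lc|exact: L2k|exact: L2k'].
  rewrite !L2dot_lcr// mulrDr mulrA cc mul1r => /eqP.
  rewrite -subr_eq0 => /eqP <-; ring.
have := H _ c1; have := H _ ci; case: (L2dot k h') => a1 a2; case: (L2dot k' h) => b1 b2.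
move=> e1 e2; have := congr1 (@complex.Re R) e1; have := congr1 (@complex.Im R) e1.
have := congr1 (@complex.Re R) e2; have := congr1 (@complex.Im R) e2 => /=.
by move=> *; apply/eqP; rewrite eq_complex /=; apply/andP; split; apply/eqP; lra.
Qed.

Lemma conc_ae I k (P : T -> Prop) : measurable I -> conc I k -> (forall l, I l -> P l) ->
  {ae mu k, forall l, P l}.
Proof.
move=> mI [L2k k0] IP; exists (~` I); split; first exact: measurableC.
  by rewrite muE ?k0//; exact: measurableC.
by move=> l nP Il; apply: nP; exact: IP.
Qed.

Lemma conc_dom I k (N : R) : measurable I -> conc I k -> (forall l, I l -> `|l| <= N) ->
  exists h, A k h.
Proof.
move=> mI ck IN; have [L2k _] := ck; case: (res) => _ /(_ k L2k) [_ dom] _; apply: dom.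
have N0 l : I l -> l ^+ 2 <= N ^+ 2.
  by move=> /IN lN; rewrite -ler_sqrt ?sqr_ge0// !sqrtr_sqr (le_trans lN)// ler_norm.
have m2 : measurable_fun setT (fun l : T => l ^+ 2) by apply: measurable_funX; exact: measurable_id.
(* The measure of [k] does not charge the complement of [I], and the minimum turns the bound valid
   on [I] into one valid everywhere. *)
have -> : (\int[mu k]_l (l ^+ 2)%:E = \int[mu k]_l (Num.min (l ^+ 2) (N ^+ 2))%:E)%E.
  apply: ae_eq_integral => //; try exact/measurable_EFinP.
    by apply/measurable_EFinP; apply: measurable_minr => //; exact: measurable_cst.
  apply: (conc_ae mI ck) => l Il _; congr (_%:E); apply/esym/min_idPl; exact: N0.
apply: (@le_lt_trans _ _ (\int[mu k]_l (cst (N ^+ 2)%:E l))%E).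
  apply: ge0_le_integral_nomeas => l _; first by rewrite lee_fin le_min !sqr_ge0.
  by rewrite lee_fin ge_min lexx orbT.
by rewrite integral_cst// muT// -EFinM ltry.
Qed.

Lemma dot_A_bound I k h (l0 r : R) : measurable I -> conc I k -> A k h -> 0 <= r ->
  (forall l, I l -> `|l - l0| <= r) ->
  exists2 x, L2dot k (lc h (- l0%:C) k) = x%:C & - (r * N2 k) <= x <= r * N2 k.
Proof.
move=> mI ck Ak r0 Ir; have [L2k L2h] := A_L2 Ak.
pose x := Rintegral (mu k) setT (fun l => l) - l0 * N2 k; exists x.
  rewrite L2dot_lcr// L2dotff//; case: (res) => _ _ /(_ _ _ Ak) ->.
  exact: realCBM.
(* [F] clamps the identity to [[l0 - r, l0 + r]]; it is bounded, hence integrable, and equals the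
   identity on [I]. *)
pose F (l : T) : R := Num.max (l0 - r) (Num.min l (l0 + r)).
have mF : measurable_fun setT F.
  apply: measurable_maxr; first exact: measurable_cst.
  by apply: measurable_minr; [exact: measurable_id|exact: measurable_cst].
have Fl l : l0 - r <= F l by rewrite /F le_max lexx.
have Fu l : F l <= l0 + r.
  by rewrite /F ge_max ge_min lexx orbT andbT; lra.
have FE : Rintegral (mu k) setT (fun l => l) = Rintegral (mu k) setT F.
  rewrite /Rintegral; congr fine; apply: ae_eq_integral => //.
    exact/measurable_EFinP.
  apply: (conc_ae mI ck) => l /Ir; rewrite ler_norml => /andP[h1 h2] _; congr (_%:E).
  have e1 : Num.min (l : R) (l0 + r) = l by apply/min_idPl; lra.
  by rewrite /F e1; apply/esym/max_idPr; lra.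
have muk : (mu k setT < +oo)%E by exact: mu_fin.
have ib (G : T -> R) (K : R) : measurable_fun setT G -> (forall l, `|G l| <= K) ->
    (mu k).-integrable setT (EFin \o G).
  move=> mG GK; apply: measurable_bounded_integrable => //.
  by exists K; split; [exact: num_real|move=> M M1 l _; exact: le_trans (GK l) (ltW M1)].
have iF : (mu k).-integrable setT (EFin \o F).
  apply: (ib _ (`|l0| + r)) => // l; have := Fl l; have := Fu l.
  have := ler_norm l0; have := ler_norm (- l0); rewrite normrN ler_norml => *.
  by apply/andP; split; lra.
have ic (a : R) : (mu k).-integrable setT (EFin \o (fun=> a)) by apply: (ib _ `|a|).
have ic2 (a : R) : Rintegral (mu k) setT (fun=> a) = a * N2 k by rewrite Rintegral_cst// muT.
have h1 := le_Rintegral measurableT (ic (l0 - r)) iF (fun l _ => Fl l).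
have h2 := le_Rintegral measurableT iF (ic (l0 + r)) (fun l _ => Fu l).
by rewrite ic2 in h1; rewrite ic2 in h2; rewrite /x FE; apply/andP; split; lra.
Qed.

(** For bounded [J] disjoint from [I] the vector [E J t] lies in the domain, so [dot_A_disjoint]
    makes it orthogonal to [t], that is, [E J t] has norm 0. The bounded sets [J n] exhaust the
    complement of [I]. *)
Lemma conc_A I g h (l0 N : R) : measurable I -> conc I g -> A g h -> (forall l, I l -> `|l| <= N) ->
  conc I (lc h (- l0%:C) g).
Proof.
move=> mI cg Ag IN; have [L2g L2h] := A_L2 Ag; set t := lc h _ g.
have L2t : L2 t by exact: L2_lc.
have mC := measurableC mI; split=> //.
pose J (n : nat) : set T := ~` I `&` `[- n%:R, n%:R].
have mJ n : measurable (J n) by apply: measurableI => //; exact: measurable_itv.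
have J0 n : mu t (J n) = 0%E.
  have cJ := conc_E (mJ n) L2t; have L2J := E_L2 (mJ n) L2t.
  have JI : J n `&` I = set0 by rewrite /J setIAC setICl set0I.
  have [hk Ak] : exists hk, A (E (J n) t) hk.
    by apply: (conc_dom (mJ n) cJ (N := n%:R)) => l [_]; rewrite /= in_itv /= ler_norml.
  have z : L2dot (E (J n) t) t = 0.
    rewrite {2}/t L2dot_lcr// (dot_A_disjoint (mJ n) mI JI cJ cg Ak Ag).
    by rewrite (dot_disjoint (mJ n) mI JI cJ cg) mulr0 addr0.
  by rewrite muE// -[N2 _]/(complex.Re _) dot_EE// -dot_E// z.
have CE : ~` I = \bigcup_n J n.
  rewrite /J -setI_bigcupr; apply/seteqP; split=> l; last by case.
  move=> nI; split=> //; exists (Num.truncn `|l|).+1 => //=; rewrite in_itv /= -ler_norml.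
  by have /truncn_itv/andP[_ /ltW] := normr_ge0 l.
have : mu t (~` I) = 0%E.
  by apply/(negligibleP _ mC); rewrite CE; apply: negligible_bigcup => n; apply/(negligibleP _ (mJ n)); exact: J0.
by rewrite muE// => -[].
Qed.

(* With [t = (A - l0) g], expand the form [<w, (A - l0) w>], which is real and at
   most [r ||w||^2] on the range of [E I], at [w = g + t / r], [g - t / r] and [g + i t]. *)
Lemma conc_A_bound I g h (l0 N r : R) : measurable I -> conc I g -> A g h ->
  (forall l, I l -> `|l| <= N) -> 0 < r -> (forall l, I l -> `|l - l0| <= r) ->
  N2 (lc h (- l0%:C) g) <= r ^+ 2 * N2 g.
Proof.
move=> mI cg Ag IN r0 Ir; have [L2g L2h] := A_L2 Ag; set t := lc h _ g.
have ct : conc I t by exact: conc_A cg Ag IN.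
have [L2t _] := ct.
have [ht At] := conc_dom mI ct IN; have [_ L2ht] := A_L2 At.
pose t2 := lc ht (- l0%:C) t.
have L2t2 : L2 t2 by exact: L2_lc.
have q c : exists2 x, L2dot (lc g c t) (lc t c t2) = x%:C &
    - (r * N2 (lc g c t)) <= x <= r * N2 (lc g c t).
  have -> : lc t c t2 = lc (lc h c ht) (- l0%:C) (lc g c t).
    apply/funext => x; rewrite /t2 /t /lc !scalerDr !addrA.
    by rewrite !scalerA [c * _]mulrC -!addrA; congr (_ + _); rewrite addrCA.
  exact: (dot_A_bound mI (conc_lc c mI cg ct) (A_lc c Ag At) (ltW r0) Ir).
have [a ea _] := dot_A_bound mI cg Ag (ltW r0) Ir.
have [b eb _] := dot_A_bound mI ct At (ltW r0) Ir.
have ex c : L2dot (lc g c t) (lc t c t2) =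
    a%:C + c * L2dot g t2 + conjc c * ((N2 t)%:C + c * b%:C).
  rewrite (L2dot_lcl c (L2_lc c L2t L2t2) L2g L2t).
  by rewrite (L2dot_lcr c L2g L2t L2t2) (L2dot_lcr c L2t L2t L2t2) (L2dotff L2t) ea eb.
have [x1 e1 /andP[_ b1]] := q (r^-1)%:C; have [x2 e2 /andP[b2 _]] := q (- (r^-1)%:C).
have [x3 e3 _] := q 'i.
move: (etrans (esym (ex _)) e1) (etrans (esym (ex _)) e2) (etrans (esym (ex _)) e3).
have s0 : `|r^-1| = r^-1 by rewrite gtr0_norm// invr_gt0.
move: b1 b2; rewrite !(N2_lc _ L2g L2t) cmodN !cmodR s0.
case: (L2dot g t2) => X Y; case: (L2dot g t) => u w.
move=> b1 b2 {e1 e2 e3} e1 e2 e3.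
have := congr1 (@complex.Re R) e1; have := congr1 (@complex.Re R) e2; have := congr1 (@complex.Im R) e3.
rewrite /= in b1 b2 * => f3 f2 f1.
have XN : X = N2 t by lra.
have rr : r * r^-1 = 1 by rewrite mulfV// gt_eqF.
rewrite XN in f1 f2.
have d : 4 * (r^-1 * N2 t) <= r * (2 * N2 g + 2 * (r^-1 ^+ 2 * N2 t)) by nra.
have : r * (4 * (r^-1 * N2 t)) <= r * (r * (2 * N2 g + 2 * (r^-1 ^+ 2 * N2 t))) by rewrite ler_pM2l.
have -> : r * (4 * (r^-1 * N2 t)) = 4 * N2 t * (r * r^-1) by ring.
have -> : r * (r * (2 * N2 g + 2 * (r^-1 ^+ 2 * N2 t))) = 2 * (r ^+ 2 * N2 g) + 2 * (r * r^-1) ^+ 2 * N2 t by ring.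
rewrite rr; lra.
Qed.

Fixpoint lsum (c : nat -> R[i]) (G : nat -> R -> C2) K : R -> C2 :=
  if K is K'.+1 then lc (lsum c G K') (c K') (G K') else fun=> 0.

Let L20 : L2 (fun _ : R => 0 : C2). Proof. by have [] := A_L2 A0. Qed.

Lemma N2_0 : N2 (fun _ : R => 0 : C2) = 0.
Proof.
rewrite N2E /Rintegral integral0_eq// => x _.
by rewrite vnorm_sqr !mxE /= !expr0n /= !addr0.
Qed.

Lemma lsum_A c g h K : (forall k, A (g k) (h k)) -> A (lsum c g K) (lsum c h K).
Proof. by move=> Agh; elim: K => [|K IH] /=; [exact: A0|exact: A_lc]. Qed.

Lemma lsum_L2 c g K : (forall k, L2 (g k)) -> L2 (lsum c g K).
Proof. by move=> L2g; elim: K => [|K IH] /=; [exact: L20|exact: L2_lc]. Qed.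

Lemma dot_lsum c g K f : L2 f -> (forall k, L2 (g k)) ->
  L2dot (lsum c g K) f = \sum_(k < K) conjc (c k) * L2dot (g k) f.
Proof.
move=> L2f L2g; elim: K => [|K IH].
  by rewrite big_ord0 /=; exact: N2_eq0_dotl L20 L2f N2_0.
by rewrite big_ord_recr /= -IH; exact: L2dot_lcl L2f (lsum_L2 _ _ L2g) (L2g K).
Qed.

Lemma N2_lsum c g K : (forall k, L2 (g k)) -> (forall j k, (j < k)%N -> L2dot (g j) (g k) = 0) ->
  N2 (lsum c g K) = \sum_(k < K) cmod (c k) ^+ 2 * N2 (g k).
Proof.
move=> L2g orth; elim: K => [|K IH]; first by rewrite big_ord0 /= N2_0.
rewrite big_ord_recr -IH /= (N2_lc _ (lsum_L2 _ _ L2g) (L2g K)) dot_lsum// big1 ?mulr0 ?addr0//.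
by move=> j _; rewrite orth ?mulr0.
Qed.

Lemma cmod_resolvent (l E0 eps : R) : 0 < eps ->
  cmod (l%:C - (E0 +i* eps))^-1 ^+ 2 = ((l - E0) ^+ 2 + eps ^+ 2)^-1.
Proof.
move=> e0; rewrite Normc.normcV exprVn cmod_sqr /=; congr (_^-1); ring.
Qed.

Lemma resolvent_step (a l z : R[i]) (X Y Z W : C2) :
  X + a *: (Y + - l *: Z) + (W + (a * (l - z)) *: Z) = X + W + (a *: Y + (- z * a) *: Z).
Proof. by apply/matrixP => i j; rewrite !mxE; ring. Qed.

Lemma exhaust_mass f (rho : R) : L2 f -> 0 < rho ->
  exists n : nat, N2 f - N2 (E `[- n%:R, n%:R[%classic f) <= rho.
Proof.
move=> L2f r0; pose F n : set T := `[- n%:R, n%:R[%classic.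
have mF n : measurable (F n) by exact: measurable_itv.
have UF : \bigcup_n F n = setT.
  apply/seteqP; split=> // l _; exists (Num.truncn `|l : R|).+1 => //=; rewrite /F /= in_itv /=.
  have /truncn_itv/andP[_] := normr_ge0 (l : R); set n := (_.+1)%:R => lt.
  by have := ler_norm (l : R); have := ler_norm (- (l : R)); rewrite normrN => *; apply/andP; split; lra.
have ndF : {homo F : n m / (n <= m)%N >-> (n <= m)%O}.
  move=> n m nm; apply/subsetPset => l; rewrite /F /= !in_itv /= => /andP[h1 h2].
  have nm' : n%:R <= m%:R :> R by rewrite ler_nat.
  by apply/andP; split; lra.
have mU : measurable (\bigcup_n F n) by rewrite UF.
have := @nondecreasing_cvg_mu _ _ _ (mu f) F mF mU ndF.
rewrite UF muT// => /fine_cvgP[_ /cvgrPdist_le /(_ _ r0) [n _ /(_ n (leqnn n)) h]].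
exists n; move: h; rewrite /= muE//= => h; apply: le_trans h; exact: ler_norm.
Qed.

(** [u] is the Riemann sum of [(p k - z)^-1 E (I k) f] over short spectral cells. The residual
    consists of the vectors [(A - p k) g k], which are mutually orthogonal and small by
    [conc_A_bound], and of the mass of [f] outside the cells. *)
Lemma approx_resolvent f (E0 eps rho : R) : L2 f -> 0 < eps -> 0 < rho -> exists u w,
  [/\ A u w, N2 (lc (lc w (- (E0 +i* eps)) u) (- 1) f) <= rho &
      ((N2 u)%:E <= \int[mu f]_l (2 / ((l - E0) ^+ 2 + eps ^+ 2))%:E)%E].
Proof.
move=> L2f e0 r0; set z := E0 +i* eps.
have r4 : 0 < rho / 4 by rewrite divr_gt0.
have [n Hn] := exhaust_mass L2f r4.
have Nf0 := N2_ge0 f.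
(* The mesh is at most 1 so that its square can be replaced by itself, at most [eps / 4] for the
   comparison with the integral, and at most the third quantity so that the orthogonal part of the
   residual is below [rho / 4]. *)
have [M lenM] : exists M : nat, M.+1%:R^-1 <= Num.min 1 (Num.min (eps / 4) (rho * eps ^+ 2 / (4 * (N2 f + 1)))).
  set q := Num.min _ _; have q0 : 0 < q.
    by rewrite /q !lt_min ltr01 !divr_gt0 ?mulr_gt0 ?exprn_gt0// ltr_wpDl.
  exists (Num.truncn q^-1); rewrite invf_ple ?posrE//.
  by have /truncn_itv/andP[_ /ltW] : 0 <= q^-1 by rewrite invr_ge0 ltW.
pose len : R := M.+1%:R^-1.
have len0 : 0 < len by rewrite invr_gt0.
move: lenM; rewrite -/len !le_min => /and3P[len1 lene lenr].
pose K := (2 * n * M.+1)%N.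
pose a : R := - n%:R.
pose p k : R := a + k%:R * len.
have pK : p K = n%:R.
  by rewrite /p /a /K /len !natrM mulfK ?pnatr_eq0//; lra.
have pS k : p k.+1 = p k + len by rewrite /p -natr1 mulrDl mul1r addrA.
have p0 : p 0%N = a by rewrite /p mul0r addr0.
have ple j k : (j <= k)%N -> p j <= p k by move=> jk; rewrite /p lerD2l ler_pM2r// ler_nat.
pose I k : set T := `[p k, p k.+1[%classic.
have mI k : measurable (I k) by exact: measurable_itv.
have disI j k : (j < k)%N -> I j `&` I k = set0.
  move=> jk; apply/seteqP; split=> // l []; rewrite /I /= !in_itv /= => /andP[_ h1] /andP[h2 _].
  by have := ple _ _ jk; have := lt_le_trans h1 (le_trans (ple _ _ jk) h2); rewrite ltxx.
pose g k := E (I k) f.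
have cg k : conc (I k) (g k) by exact: conc_E.
have L2g k : L2 (g k) by exact: E_L2.
have bI k l : I k l -> `|l| <= `|p k| + len.
  rewrite /I /= in_itv /= pS => /andP[h1 h2]; have := ler_norm (p k); have := ler_norm (- p k).
  by rewrite normrN ler_norml => *; apply/andP; split; lra.
have bI2 k l : I k l -> `|l - p k| <= len.
  by rewrite /I /= in_itv /= pS => /andP[h1 h2]; rewrite ler_norml; apply/andP; split; lra.
have [h Agh] : exists h, forall k, A (g k) (h k).
  have H k : exists h, A (g k) h := conc_dom (mI k) (cg k) (@bI k).
  by exists (fun k => sval (cid (H k))) => k; exact: svalP (cid (H k)).
pose t k := lc (h k) (- (p k)%:C) (g k).
have ct k : conc (I k) (t k) := conc_A (p k) (mI k) (cg k) (Agh k) (@bI k).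
have bt k : N2 (t k) <= len ^+ 2 * N2 (g k) :=
  conc_A_bound (mI k) (cg k) (Agh k) (@bI k) len0 (@bI2 k).
have L2t k : L2 (t k) by case: (ct k).
have orthg j k : (j < k)%N -> L2dot (g j) (g k) = 0.
  by move=> jk; exact: dot_disjoint (mI j) (mI k) (disI _ _ jk) (cg j) (cg k).
have ortht j k : (j < k)%N -> L2dot (t j) (t k) = 0.
  by move=> jk; exact: dot_disjoint (mI j) (mI k) (disI _ _ jk) (ct j) (ct k).
pose c k := ((p k)%:C - z)^-1.
have cE k : cmod (c k) ^+ 2 = ((p k - E0) ^+ 2 + eps ^+ 2)^-1 by exact: cmod_resolvent.
have split_union k : `[a, p k.+1[%classic = `[a, p k[%classic `|` I k.
  have := ple _ _ (leq0n k); rewrite p0 => ak.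
  apply/seteqP; split=> l; rewrite /I /= !in_itv /=.
    by move=> /andP[-> h2]; have [lp|lp] := ltP l (p k); [left|right].
  by move=> [/andP[-> lp]|/andP[kl lp]]; [rewrite pS /=; lra|rewrite lp (le_trans ak)].
have dis_union k : `[a, p k[%classic `&` I k = set0.
  apply/seteqP; split=> // l []; rewrite /I /= !in_itv /= => /andP[_ h1] /andP[h2 _].
  by have := lt_le_trans h1 h2; rewrite ltxx.
have massK k : \sum_(j < k) N2 (g j) = N2 (E `[a, p k[%classic f).
  elim: k => [|k IH].
    rewrite big_ord0 p0 set_itvco0; apply/esym; have := muE measurable0 L2f.
    by rewrite measure0 => -[].
  by rewrite big_ord_recr /= IH split_union muU//; exact: measurable_itv.
have massle k : \sum_(j < k) N2 (g j) <= N2 f.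
  have mP : measurable (`[a, p k[%classic : set T) by exact: measurable_itv.
  rewrite massK -(N2T L2f); exact: mu_mono mP measurableT (@subsetT _ _) L2f.
exists (lsum c g K), (lsum c h K); split; first exact: lsum_A.
(* Each summand gives [(A - z) (c k g k) = c k t k + g k], because [c k * (p k - z) = 1]. *)
- have alg k : lc (lsum c h k) (- z) (lsum c g k) = lc (lsum c t k) 1 (lsum (fun=> 1) g k).
    elim: k => [|k IH]; first by apply/funext => x; rewrite /lc /= !scaler0.
    apply/funext => x; have /(congr1 (fun F => F x)) := IH; rewrite /lc /= => e1.
    have cz : c k * ((p k)%:C - z) = 1.
      apply: mulVf; apply/eqP => /(congr1 (@complex.Im R)) /= /eqP.
      by rewrite sub0r oppr_eq0 gt_eqF.
    rewrite /lc /t /lc scale1r in e1 *.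
    have -> : 1 *: (lsum (fun=> 1) g k x + 1 *: g k x) = lsum (fun=> 1) g k x + (c k * ((p k)%:C - z)) *: g k x.
      by rewrite cz !scale1r.
    rewrite resolvent_step.
    by rewrite -e1 scalerDr scalerA addrACA.
  have Lt := lsum_L2 c K L2t; have Lg := lsum_L2 (fun=> 1) K L2g.
  have Ly := L2_lc (- 1) Lg L2f.
  rewrite alg (_ : lc (lc _ 1 _) _ f = lc (lsum c t K) 1 (lc (lsum (fun=> 1) g K) (- 1) f)); last first.
    by apply/funext => x; rewrite /lc !scale1r addrA.
  apply: (le_trans (N2_lc_le _ Lt Ly)).
  have n1 : cmod 1 = 1 :> R by rewrite cmodE /= expr0n addr0 expr1n sqrtr1.
  have b1 : N2 (lsum c t K) <= rho / 4.
    rewrite N2_lsum//; apply: (@le_trans _ _ (\sum_(k < K) eps ^- 2 * len * N2 (g k))).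
      apply: ler_sum => k _; rewrite -mulrA; apply: ler_pM; rewrite ?sqr_ge0 ?N2_ge0//.
        by rewrite cE lef_pV2 ?posrE ?exprn_gt0 ?ltr_wpDl ?sqr_ge0 ?exprn_gt0// lerDr sqr_ge0.
      apply: (le_trans (bt k)); apply: ler_wpM2r; first exact: N2_ge0.
      by rewrite expr2 ler_piMl// ltW.
    rewrite -mulr_sumr; apply: (@le_trans _ _ (eps ^- 2 * len * (N2 f + 1))).
      apply: ler_wpM2l; first by rewrite mulr_ge0 ?invr_ge0 ?exprn_ge0// ltW.
      by rewrite (le_trans (massle K))// lerDl.
    rewrite ler_pdivlMr ?mulr_gt0 ?ltr_wpDl// in lenr.
    have en0 : eps != 0 by rewrite gt_eqF.
    have -> : eps ^- 2 * len * (N2 f + 1) = (len * (4 * (N2 f + 1))) / (4 * eps ^+ 2) by field.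
    rewrite ler_pdivrMr ?mulr_gt0 ?exprn_gt0//; apply: (le_trans lenr).
    by rewrite le_eqVlt; apply/orP; left; apply/eqP; field.
  have b2 : N2 (lc (lsum (fun=> 1) g K) (- 1) f) <= rho / 4.
    rewrite (N2_lc _ Lg L2f) cmodN n1 expr1n mul1r dot_lsum// N2_lsum//.
    have -> : \sum_(k < K) conjc 1 * L2dot (g k) f = (\sum_(k < K) N2 (g k))%:C.
      rewrite rmorph_sum; apply: eq_bigr => k _.
      by rewrite conjc1 mul1r (dot_E (mI k) L2f L2f) -(dot_EE (mI k) L2f L2f) (L2dotff (L2g k)).
    under eq_bigr do rewrite n1 expr1n mul1r.
    rewrite massK pK mulN1r ReN /=; move: Hn; rewrite -/a; lra.
  by rewrite n1 expr1n mulr1; lra.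
- rewrite N2_lsum//.
  pose q (l : T) : \bar R := (2 / ((l - E0) ^+ 2 + eps ^+ 2))%:E.
  have d0 (l : R) : 0 < (l - E0) ^+ 2 + eps ^+ 2 by rewrite ltr_wpDl ?sqr_ge0 ?exprn_gt0.
  have q0 l : (0 <= q l)%E by rewrite lee_fin divr_ge0// ltW.
  have mq : measurable_fun setT q.
    apply/measurable_EFinP; apply: continuous_measurable_fun => l.
    apply: cvgM; first exact: cvg_cst.
    apply: cvgV; first by rewrite gt_eqF.
    apply: cvgD; last exact: cvg_cst.
    have cB : (x - E0) @[x --> (l : R)] --> (l : R) - E0 by apply: cvgB; [exact: cvg_id|exact: cvg_cst].
    exact: (cvgM cB cB).
  have step k : ((\sum_(j < k) cmod (c j) ^+ 2 * N2 (g j))%:E <= \int[mu f]_(l in `[a, p k[%classic) q l)%E.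
    elim: k => [|k IH]; first by rewrite big_ord0; exact: integral_ge0.
    rewrite split_union ge0_integral_setU//; last 2 first.
    - exact: measurable_funTS mq.
    - by apply/disj_set2P; exact: dis_union.
    rewrite big_ord_recr /= EFinD; apply: leeD => //.
    apply: (@le_trans _ _ (\int[mu f]_(l in I k) (cst (cmod (c k) ^+ 2)%:E l))%E).
      by rewrite integral_cst// muE// -EFinM.
    apply: ge0_le_integral_nomeas => l Il; first by rewrite lee_fin sqr_ge0.
    rewrite lee_fin cE ler_pdivlMr//; rewrite mulrC ler_pdivrMr//.
    move: Il; rewrite /I /= in_itv /= pS => /andP[h1 h2].
    (* This is [(l - E0)^2 <= 2 (p k - E0)^2 + 2 (l - p k)^2]; with the last term small against
       [eps^2] it accounts for the factor 2 in the integrand. *)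
    have : 0 <= (p k - E0 - (l - p k)) ^+ 2 by exact: sqr_ge0.
    have : (l - p k) ^+ 2 <= (eps / 4) ^+ 2 by apply: lerXn2r; rewrite ?nnegrE; lra.
    rewrite !expr2; move: (sqr_ge0 eps); rewrite expr2; lra.
  apply: (le_trans (step K)); apply: ge0_subset_integral => //; exact: measurable_itv.
Qed.

End SpectralCalculus.

(** * A lower bound for the resolvent *)

Section DiracResolvent.
Context {R : realType}.
Local Open Scope complex_scope.
Local Notation leb := (@lebesgue_measure R).
Local Notation cmod := (@Normc.normc R).
Local Notation C2 := 'cV[R[i]]_2.
Local Notation D := (`]0%R, +oo[%classic : set R).
Context (phi : R -> R[i]) (omega : R[i]).

Lemma vnormZ (c : R[i]) (v : C2) : vnorm (c *: v) = cmod c * vnorm v.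
Proof.
apply/eqP; rewrite -(eqrXn2 (n := 2)) ?vnorm_ge0 ?mulr_ge0 ?cmod_ge0 ?vnorm_ge0//.
by rewrite exprMn !vnorm_sqr_cmod !mxE !cmodM !exprMn mulrDr.
Qed.

Lemma vnormD (v w : C2) : vnorm (v + w) <= vnorm v + vnorm w.
Proof.
rewrite -ler_sqr ?nnegrE ?addr_ge0 ?vnorm_ge0// sqrrD !vnorm_sqr !mxE !ReD !ImD.
have := cauchy_schwarz4 (complex.Re (v 0 0)) (complex.Im (v 0 0)) (complex.Re (v 1 0)) (complex.Im (v 1 0))
  (complex.Re (w 0 0)) (complex.Im (w 0 0)) (complex.Re (w 1 0)) (complex.Im (w 1 0)).
rewrite -!vnormE => /(le_trans (ler_norm _)); rewrite -mulr_natl !expr2; lra.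
Qed.

Lemma ac_lc a b (f g : R -> C2) c : abs_continuous_on a b f -> abs_continuous_on a b g ->
  abs_continuous_on a b (lc f c g).
Proof.
move=> acf acg e e0; set K := cmod c + 1.
have K0 : 0 < K by rewrite /K ltr_wpDl ?cmod_ge0.
have eK : 0 < e / (2 * K) by rewrite divr_gt0// mulr_gt0.
have [d1 d10 H1] := acf _ (divr_gt0 e0 (ltr0n R 2)); have [d2 d20 H2] := acg _ eK.
exists (Num.min d1 d2); first by rewrite lt_min d10.
move=> n s t st ord; rewrite lt_min => /andP[l1 l2].
have {H1 l1} := H1 n s t st ord l1; have {H2 l2} := H2 n s t st ord l2 => h2 h1.
apply: (@le_lt_trans _ _ (\sum_(i < n) vnorm (f (t i) - f (s i)) + K * \sum_(i < n) vnorm (g (t i) - g (s i)))).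
  rewrite mulr_sumr -big_split /=; apply: ler_sum => i _.
  have -> : lc f c g (t i) - lc f c g (s i) = (f (t i) - f (s i)) + c *: (g (t i) - g (s i)).
    by rewrite /lc scalerBr opprD addrACA.
  apply: (le_trans (vnormD _ _)); rewrite vnormZ lerD2l ler_wpM2r ?vnorm_ge0// /K lerDl//.
have := h2; rewrite ltr_pdivlMr ?mulr_gt0// => h3; lra.
Qed.

Lemma has_vderive_lc (f g : R -> C2) c x v w : has_vderive f x v -> has_vderive g x w ->
  has_vderive (lc f c g) x (v + c *: w).
Proof.
move=> df dg i; have [f1 f2] := df i; have [g1 g2] := dg i.
have := cderiveD (conj f1 f2 : cderive (fun t => f t i 0) x (v i 0))
  (cderiveM (cderive_cst x c) (conj g1 g2 : cderive (fun t => g t i 0) x (w i 0))).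
have -> : (fun t => f t i 0 + c * g t i 0) = (fun t => lc f c g t i 0).
  by apply/funext => t; rewrite /lc !mxE.
by rewrite mul0r add0r !mxE.
Qed.

Lemma dirac_expr_lc x v v' w w' c :
  dirac_expr phi x (v + c *: v') (w + c *: w') = dirac_expr phi x v w + c *: dirac_expr phi x v' w'.
Proof.
by rewrite /dirac_expr !mulmxDr -!scalemxAr scalerDr addrACA.
Qed.

Lemma L2_0 : L2 (fun _ : R => 0 : C2).
Proof.
split; first by move=> i; split; rewrite (_ : (fun=> _) = cst 0) ?mxE//; try exact: measurable_cst.
rewrite integral0_eq ?ltry// => x _.
by rewrite vnorm_sqr !mxE /= !expr0n /= !addr0.
Qed.

Lemma dirac_op0 : dirac_op phi omega (fun=> 0) (fun=> 0).
Proof.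
have z0 : vnorm (0 : C2) = 0 by rewrite vnormE !mxE /= expr0n /= !addr0 sqrtr0.
have ae_all (P : R -> Prop) : (forall x, P x) -> {ae leb, forall x, P x}.
  by move=> HP; exists set0; split => // x /= nP; exfalso; exact: nP.
split; [exact: L2_0|exact: L2_0|exists (fun=> 0), (fun=> 0); split].
- split; [|exact: L2_0|exact: L2_0|].
    move=> a b _ _ e e0; exists 1 => // n s t _ _ _.
    by rewrite big1// => i _; rewrite subrr z0.
  apply: ae_all => x _ i; rewrite !mxE /=; split; exact: is_derive_cst.
- by rewrite !mxE !mulr0 addr0.
- exact: ae_all.
- by apply: ae_all => x _; rewrite /dirac_expr !mulmx0 addr0.
Qed.

Lemma dirac_op_lc f h g k c : dirac_op phi omega f h -> dirac_op phi omega g k ->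
  dirac_op phi omega (lc f c g) (lc h c k).
Proof.
move=> [L2f L2h [u [u' [[acu L2u L2u' du] bu fu hu]]]] [L2g L2k [v [v' [[acv L2v L2v' dv] bv gv kv]]]].
split; [exact: L2_lc|exact: L2_lc|exists (lc u c v), (lc u' c v'); split].
- split; [|exact: L2_lc|exact: L2_lc|].
    by move=> a b ab sub; apply: ac_lc; [exact: acu|exact: acv].
  apply: (ae_imp (ae_and du dv)) => x [d1 d2] x0.
  exact: has_vderive_lc (d1 x0) (d2 x0).
- rewrite /lc !mxE !mulrDr !(mulrCA _ c) addrACA bu add0r -mulrDr bv mulr0//.
- by apply: (ae_imp (ae_and fu gv)) => x [e1 e2] x0; rewrite /lc e1// e2.
- apply: (ae_imp (ae_and hu kv)) => x [e1 e2] x0.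
  by rewrite /lc e1// e2// dirac_expr_lc.
Qed.

(** [M] is the primitive of [|r|^2], extended by 0 to the left of 0, and Lebesgue differentiation
    gives its derivative almost everywhere. It supplies the forcing term for the residual. *)
Lemma energy_integral (r : R -> C2) : L2 r -> exists M : R -> R,
  [/\ forall x y, x <= y -> M x <= M y, forall x y, x <= y -> M y - M x <= N2 r &
      {ae leb, forall x : R, 0 < x -> is_derive x 1 M (vnorm (r x) ^+ 2)}].
Proof.
move=> L2r; pose F : R -> R := (fun x => vnorm (r x) ^+ 2) \_ D.
have F0 x : 0 <= F x by rewrite /F /patch; case: ifP => // _; exact: sqr_ge0.
have iF : leb.-integrable setT (EFin \o F).
  have /(integrable_mkcond _ measurable_pos) := L2_integrable L2r.
  by congr (_.-integrable _ _); rewrite /F -restrict_EFin.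
have iFy (y : R) : leb.-integrable `]-oo, y] (EFin \o F).
  apply: integrableS iF => //; exact: measurable_itv.
pose M x := Rintegral leb `]-oo, x] F.
have mF := measurable_int _ iF.
have ivl (x y : R) : x <= y -> M y - M x = Rintegral leb `]x, y] F.
  move=> xy; rewrite /M (_ : `]-oo, y]%classic = `]-oo, x]%classic `|` `]x, y]%classic); last first.
    apply/seteqP; split=> t /=; rewrite !in_itv /=.
      by move=> ty; have [tx|tx] := leP t x; [left|right].
    by move=> [tx|/andP[_ //]]; exact: le_trans xy.
  rewrite Rintegral_setU.
  - by rewrite addrAC subrr add0r.
  - exact: measurable_itv.
  - exact: measurable_itv.
  - apply: integrableS iF => //; apply: measurableU; exact: measurable_itv.
  - apply/disj_set2P/seteqP; split=> // t [] /=; rewrite !in_itv /= => tx /andP[xt _].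
    by have := le_lt_trans tx xt; rewrite ltxx.
exists M; split.
- by move=> x y xy; rewrite -subr_ge0 ivl//; apply: Rintegral_ge0 => t _; exact: F0.
- have NE : N2 r = Rintegral leb setT F by rewrite N2E Rintegral_mkcond.
  move=> x y xy; rewrite ivl// NE /Rintegral; apply: fine_le.
  + have mxy : measurable (`]x, y]%classic : set (measurableTypeR R)) by exact: measurable_itv.
    have ixy : leb.-integrable `]x, y] (EFin \o F) by apply: integrableS iF.
    by have := integrable_fin_num mxy ixy.
  + by have := integrable_fin_num measurableT iF.
  + by apply: ge0_subset_integral => // t _; rewrite lee_fin.
have locF : locally_integrable [set: R] F.
  exact: integrable_locally_restrict measurable_pos (L2_integrable L2r).
apply: (ae_imp (FTC1Ny iFy locF)) => x [dM eM] x0; apply: DeriveDef; first exact: dM.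
rewrite -derive1E eM /F /patch ifT// inE /= in_itv /= x0//.
Qed.

(* The vector is chosen so that the boundary functional of the forcing term
   [(- i, i) * source_vec] equals 2. *)
Definition source_vec : C2 := \col_(i < 2) if i == 0 then 'i * conjc omega else - 'i * omega.
Definition source (d : R) : R -> C2 := fun x => (\1_(`]-oo, d]%classic : set R) x)%:C *: source_vec.

Lemma source_vecE : source_vec 0 0 = 'i * conjc omega /\ source_vec 1 0 = - 'i * omega.
Proof. by rewrite !mxE. Qed.

Context (omega1 : cmod omega = 1).

Let cmod_i : cmod ('i : R[i]) = 1.
Proof. by rewrite cmodE /= expr0n add0r expr1n sqrtr1. Qed.

Lemma vnorm_source_vec : vnorm source_vec ^+ 2 = 2.
Proof.
have [e0 e1] := source_vecE.
by rewrite vnorm_sqr_cmod e0 e1 !cmodM cmodN cmod_i cmodJ omega1 !mul1r expr1n.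
Qed.

Lemma vnorm_source_le d x : vnorm (source d x) ^+ 2 <= 2.
Proof.
rewrite /source vnormZ exprMn vnorm_source_vec cmodR indicE; case: (x \in _) => /=.
  by rewrite normr1 expr1n mul1r.
by rewrite normr0 expr0n mul0r.
Qed.

Lemma source_in d x : x <= d -> source d x = source_vec.
Proof. by move=> xd; rewrite /source indicE mem_set ?scale1r//= in_itv. Qed.

Lemma source_out d x : d < x -> source d x = 0.
Proof.
by move=> dx; rewrite /source indicE memNset ?scale0r//= in_itv /= => xd; have := lt_le_trans dx xd; rewrite ltxx.
Qed.

Lemma L2_source d : L2 (source d).
Proof.
have mI : measurable (`]-oo, d]%classic : set R) by exact: measurable_itv.
split.
  move=> i; split.
    have -> : (fun x => complex.Re (source d x i 0)) = (fun x => \1_(`]-oo, d]%classic : set R) x * complex.Re (source_vec i 0)).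
      by apply/funext => x; rewrite /source mxE ReM /= mul0r subr0.
    by apply: measurable_funM; [exact: measurable_indic|exact: measurable_cst].
  have -> : (fun x => complex.Im (source d x i 0)) = (fun x => \1_(`]-oo, d]%classic : set R) x * complex.Im (source_vec i 0)).
    by apply/funext => x; rewrite /source mxE ImM /= mul0r addr0.
  by apply: measurable_funM; [exact: measurable_indic|exact: measurable_cst].
pose m := Num.max d 0.
have iI : leb.-integrable D (EFin \o (fun x => 2 * \1_(`]0, m]%classic : set R) x)).
  have i1 : leb.-integrable D (EFin \o \1_(`]0, m]%classic : set R)).
    apply: integrableS (integrable_indic_itv 0 m false false) => //; exact: measurable_pos.
  have := integrableZl (measurable_pos (R := R)) 2 i1.
  by congr (_.-integrable _ _); apply/funext => x.
have := integrable_lty (measurable_pos (R := R)) iI; apply: le_lt_trans.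
apply: ge0_le_integral_nomeas => x; rewrite /= in_itv /= andbT => x0; rewrite lee_fin ?sqr_ge0//.
have [xd|dx] := leP x d.
  by rewrite indicE mem_set ?mulr1 ?vnorm_source_le//= in_itv /= x0 /m le_max xd.
by rewrite source_out// vnorm_sqr !mxE /= !expr0n /= !addr0 mulr_ge0.
Qed.

Lemma le_integral_itv (P : R -> R) (a b c : R) : 0 < a -> a < b -> (forall x, 0 <= P x) -> 0 <= c ->
  (forall x, a < x <= b -> c <= P x) ->
  ((c * (b - a))%:E <= \int[leb]_(x in D) (P x)%:E)%E.
Proof.
move=> a0 ab P0 c0 cP; pose C : set R := `]a, b]%classic.
have mC : measurable (C : set (measurableTypeR R)) by exact: measurable_itv.
have CD : C `&` D = C.
  apply/setIidl => x; rewrite /C /= !in_itv /= andbT => /andP[+ _]; exact: lt_trans.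
have lebC : leb C = (b - a)%:E.
  suff : lebesgue_measure C = (b - a)%:E by [].
  by rewrite /C lebesgue_measure_itv /= lte_fin ab.
have int1 : (\int[leb]_(x in D) (\1_C x)%:E)%E = (b - a)%:E.
  have := @integral_indic _ _ _ leb _ (measurable_pos (R := R)) _ mC; rewrite CD [RHS]lebC; exact.
have intc : (\int[leb]_(x in D) (c%:E * (\1_C x)%:E))%E = (c * (b - a))%:E.
  rewrite ge0_integralZl_EFin//; first by rewrite EFinM; congr (_ * _)%E; exact: int1.
  by apply/measurable_EFinP; apply: measurable_indic.
rewrite -intc; apply: ge0_le_integral_nomeas => x _; first by rewrite mule_ge0// lee_fin.
rewrite -EFinM lee_fin indicE; case: (boolP (x \in C)) => [|_]; last by rewrite mulr0.
by rewrite inE /C /= in_itv /= => xab; rewrite mulr1 cP.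
Qed.

Lemma solve_imul (z a b : R[i]) : 'i * z + a = b -> z = - 'i * (b - a).
Proof. by move=> <-; rewrite addrK mulrA mulNr -expr2 sqr_i opprK mul1r. Qed.

Lemma solve_imul2 (z a b : R[i]) : a - 'i * z = b -> z = 'i * (b - a).
Proof. by move=> <-; rewrite addrAC subrr sub0r mulrN mulrA -expr2 sqr_i mulN1r opprK. Qed.

Lemma residual_eq (z e : R[i]) (v w s : C2) :
  w = z *: v + (e *: v + s + (w + - (z + e) *: v + - 1 *: s)).
Proof. by apply/matrixP => i j; rewrite !mxE; ring. Qed.

Section LowerBound.
Context (B N0 : R) (phiB : forall x, 0 < x -> cmod (phi x) <= B) (N00 : 0 <= N0).

Let B0 : 0 <= B. Proof. exact: le_trans (cmod_ge0 _) (phiB ltr01). Qed.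
(* [d] is so small that [|U| <= 1 / (4 K)] on [[0, d]] as long as
   [|U d|^2 < d^2 / 16]; it must not depend on the energy. *)
Let kappa : R := 4 + 4 * B.
Let K : R := N0 + 1 + B.
Let d : R := Num.min 1 (64 * expR kappa * K ^+ 2)^-1.
Let K1 : 1 <= K. Proof. by rewrite /K; move: N00 B0; lra. Qed.
Let den0 : 0 < 64 * expR kappa * K ^+ 2.
Proof. by rewrite !mulr_gt0 ?expR_gt0 ?exprn_gt0 ?(lt_le_trans ltr01 K1). Qed.
Let d0 : 0 < d. Proof. by rewrite lt_min ltr01 invr_gt0 den0. Qed.
Let d1 : d <= 1. Proof. by rewrite ge_min lexx. Qed.

Section OneSolution.
Context (E eps : R) (EN : `|E| <= N0) (e0 : 0 < eps) (e1 : eps <= 1) (ed : eps ^+ 2 <= d / 4).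
Context (U U' r : R -> C2) (HU : H1 U U').
Context (bU : omega * U 0 0 0 + conjc omega * U 0 1 0 = 0) (L2r : L2 r) (rE : N2 r <= eps ^+ 2).
Context (eqU : {ae leb, forall x, 0 < x ->
  dirac_expr phi x (U' x) (U x) = E%:C *: U x + ((0 +i* eps) *: U x + source d x + r x)}).

Let acU a b : 0 <= a -> a <= b -> abs_continuous_on a b U.
Proof.
move=> a0 ab; case: HU => acU _ _ _; apply: acU => // x /=.
by rewrite !in_itv /= andbT => /andP[ax _]; exact: le_trans ax.
Qed.

Let dU : {ae leb, forall x : R, 0 < x -> has_vderive U x (U' x)}.
Proof. by case: HU. Qed.

Let cmod_ie : cmod (0 +i* eps) = eps.
Proof. by rewrite cmodE /= expr0n add0r sqrtr_sqr gtr0_norm. Qed.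

Let Mr := sval (cid (energy_integral L2r)).
Let Mr_mono x y : x <= y -> Mr x <= Mr y.
Proof. by case: (svalP (cid (energy_integral L2r))) => H _ _; exact: H. Qed.
Let Mr_le x y : x <= y -> Mr y - Mr x <= eps ^+ 2.
Proof. by move=> xy; apply: le_trans rE; case: (svalP (cid (energy_integral L2r))) => _ H _; exact: H. Qed.
Let dMr : {ae leb, forall x : R, 0 < x -> is_derive x 1 Mr (vnorm (r x) ^+ 2)}.
Proof. by case: (svalP (cid (energy_integral L2r))). Qed.

(** With [u], [s], [w] the norms of [U], the source and [r], the error is
    [2 u (eps u + s + w) <= 4 u^2 + s^2 + w^2], and [s^2 <= 2]. *)
Lemma near_system : energy_system phi E 4 0 d (density U) (cross_re U) (cross_im U) (fun x => Mr x + 2 * x).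
Proof.
apply: density_system; [exact: ltW|exact: acU (lexx 0) (ltW d0)| |].
  by move=> x y _ xy _; have := Mr_mono xy; lra.
apply: (ae_imp (ae_and (ae_and dU eqU) dMr)) => x [[h1 h2] h3] /andP[x0 _].
exists (U' x), ((0 +i* eps) *: U x + source d x + r x), (vnorm (r x) ^+ 2 + 2); split.
- exact: h1.
- exact: h2.
- have := is_derive_add (h3 x0) (is_derive_mulc 2 (is_derive_id x (1 : R))).
  by rewrite mulr1.
- by rewrite addr_ge0// sqr_ge0.
have := vnormD ((0 +i* eps) *: U x + source d x) (r x).
have := vnormD ((0 +i* eps) *: U x) (source d x); rewrite vnormZ cmod_ie.
have := vnorm_source_le d x; rewrite /density.
have := vnorm_ge0 (U x); have := vnorm_ge0 (source d x); have := vnorm_ge0 (r x).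
set u := vnorm (U x); set s := vnorm (source d x); set w := vnorm (r x); set h := vnorm (_ + r x).
move=> w0 s0 u0 s2 t1 t2.
have : u * h <= u * (eps * u + s + w) by rewrite ler_wpM2l//; lra.
have := sqr_ge0 (u - s); have := sqr_ge0 (u - w).
have : eps * (u * u) <= u * u by rewrite ler_piMl// mulr_ge0.
rewrite !expr2 in s2 *; lra.
Qed.

(** Beyond [d] the source vanishes and [2 u (eps u + w) <= 3 eps u^2 + w^2 / eps]. Over a length
    [1 / eps] the rate costs a bounded factor, and [N2 r <= eps ^+ 2] keeps the total forcing below
    [eps]. *)
Lemma far_system b : d <= b ->
  energy_system phi E (3 * eps) d b (density U) (cross_re U) (cross_im U) (fun x => eps^-1 * Mr x).
Proof.
move=> db; apply: density_system => //; first exact: acU (ltW d0) db.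
  by move=> x y _ xy _; rewrite ler_pM2l ?invr_gt0// Mr_mono.
apply: (ae_imp (ae_and (ae_and dU eqU) dMr)) => x [[h1 h2] h3] /andP[dx _].
have x0 : 0 < x by exact: lt_trans dx.
exists (U' x), ((0 +i* eps) *: U x + source d x + r x), (eps^-1 * vnorm (r x) ^+ 2); split.
- exact: h1.
- exact: h2.
- exact: is_derive_mulc (h3 x0).
- by rewrite mulr_ge0 ?sqr_ge0// invr_ge0 ltW.
rewrite source_out// addr0.
have := vnormD ((0 +i* eps) *: U x) (r x); rewrite vnormZ cmod_ie /density.
have := vnorm_ge0 (U x); have := vnorm_ge0 (r x).
set u := vnorm (U x); set w := vnorm (r x); set h := vnorm (_ + r x).
move=> w0 u0 t.
have : u * h <= u * (eps * u + w) by rewrite ler_wpM2l.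
have ei : eps * eps^-1 = 1 by rewrite mulfV// gt_eqF.
have : 0 <= eps^-1 * (eps * u - w) ^+ 2 by rewrite mulr_ge0 ?sqr_ge0// invr_ge0 ltW.
have -> : eps^-1 * (eps * u - w) ^+ 2 = (eps * eps^-1) * (eps * u ^+ 2 - 2 * u * w) + eps^-1 * w ^+ 2 by ring.
rewrite ei !expr2; lra.
Qed.

(* The energy does not enter the equation for [|U|^2]. *)
Lemma near_gronwall x : 0 <= x -> x <= d ->
  density U x <= expR kappa * (density U d + (eps ^+ 2 + 2 * d)).
Proof.
move=> x0 xd; have [[acP _ _] PY ndM HP] := near_system.
have k0 : 0 <= kappa by rewrite /kappa addr_ge0// mulr_ge0.
have mon y z : x <= y -> y <= z -> z <= d -> Mr y + 2 * y <= Mr z + 2 * z.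
  by move=> _ yz _; have := Mr_mono yz; lra.
have [|_ h] := gronwall xd k0 (ac_sub x0 (lexx d) acP) mon.
  apply: (ae_imp HP) => y H /andP[xy yd].
  have y0 : 0 < y by exact: le_lt_trans xy.
  have [p' [_ [_ [nu [[dp _ _ dM] nu0 le _ _]]]]] := H (introT andP (conj y0 yd)).
  exists p', nu; split => //.
  have [Pp YP] : 0 <= density U y /\ cross_re U y ^+ 2 + cross_im U y ^+ 2 <= density U y ^+ 2.
    by apply: PY; rewrite !ltW.
  have [Y1 Y2] := sqr_sum_le_norm Pp YP.
  have b1 := le_trans (cmod_Re _) (phiB y0); have b2 := le_trans (cmod_Im _) (phiB y0).
  move: (cross_re U y) (cross_im U y) Y1 Y2 le => yr yi Y1 Y2 le.
  have := ler_normD (p' - 2 * (- complex.Im (phi y) * yr + complex.Re (phi y) * yi))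
    (2 * (- complex.Im (phi y) * yr + complex.Re (phi y) * yi)).
  rewrite subrK => h; apply: (le_trans h).
  have := ler_normD (- complex.Im (phi y) * yr) (complex.Re (phi y) * yi).
  rewrite !normrM normrN (ger0_norm (_ : 0 <= 2 :> R))//.
  have := ler_pM (normr_ge0 _) (normr_ge0 _) b1 Y2; have := ler_pM (normr_ge0 _) (normr_ge0 _) b2 Y1.
  rewrite /kappa; move: le; lra.
apply: (le_trans h); apply: ler_pM; rewrite ?expR_ge0//.
- by rewrite addr_ge0 ?sqr_ge0//; have := Mr_mono xd; lra.
- rewrite ler_expR ler_piMr//; move: d1; lra.
- by have := Mr_le xd; lra.
Qed.

Let bform x : R := complex.Re (omega * U x 0 0 + conjc omega * U x 1 0).

Lemma bform_le x : bform x <= 2 * vnorm (U x).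
Proof.
apply: (le_trans (ler_norm _)); apply: (le_trans (cmod_Re _)); apply: (le_trans (cmodD _ _)).
rewrite !cmodM cmodJ omega1 !mul1r; have := cmod_le_vnorm (U x) 0; have := cmod_le_vnorm (U x) 1; lra.
Qed.

(** If [U] were small at [d], [near_gronwall] would make it small on all of [[0, d]], and the source
    would dominate the derivative of the boundary form. This form starts at 0, so it would exceed
    [d / 2] at [d], up to the residual already allowed for; being at most [2 |U d|], it gives
    [|U d| >= d / 4], a contradiction. *)
Lemma density_at_d : d ^+ 2 / 16 <= density U d.
Proof.
rewrite leNgt; apply/negP => small.
have dd : d ^+ 2 <= d by rewrite expr2 ler_piMl// ltW.
have usmall x : 0 <= x -> x <= d -> 2 * K * vnorm (U x) <= 1 / 2.
  move=> x0 xd; have h := near_gronwall x0 xd.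
  have : density U x <= expR kappa * (4 * d).
    by apply: (le_trans h); rewrite ler_pM2l ?expR_gt0//; move: ed small dd; lra.
  have dle : d <= (64 * expR kappa * K ^+ 2)^-1 by rewrite /d ge_min lexx orbT.
  have : d * (64 * expR kappa * K ^+ 2) <= 1 by rewrite -ler_pdivlMr// div1r.
  move=> h1 h2; have Kp : 0 < K by exact: lt_le_trans K1.
  have : K ^+ 2 * density U x <= K ^+ 2 * (expR kappa * (4 * d)) by rewrite ler_pM2l ?exprn_gt0.
  rewrite /density -exprMn => h3.
  have h4 : (K * vnorm (U x)) ^+ 2 <= (1 / 4) ^+ 2.
    by apply: (le_trans h3); move: h1; rewrite !expr2; lra.
  rewrite ler_sqr ?nnegrE ?mulr_ge0 ?vnorm_ge0 ?(ltW Kp)// in h4.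
  lra.
have [ac1 ac2] := abs_continuous_ac 0 (acU (lexx 0) (ltW d0)).
have [ac3 ac4] := abs_continuous_ac 1 (acU (lexx 0) (ltW d0)).
have acC (k : R) f : ac 0 d f -> ac 0 d (fun x => k * f x).
  move=> acf; apply: acM => //; first exact: ltW.
  by apply: (@ac_lipschitz _ _ _ _ 0) => s t _ _ _; rewrite subrr normr0 mul0r.
set o1 := complex.Re omega; set o2 := complex.Im omega.
pose L x := (o1 * complex.Re (U x 0 0) + - o2 * complex.Im (U x 0 0)) +
  (o1 * complex.Re (U x 1 0) + o2 * complex.Im (U x 1 0)).
have LE x : L x = bform x.
  by rewrite /L /bform ReD !ReM /o1 /o2; case: (omega) => a b /=; ring.
have acL : ac 0 d (fun x => L x + -1 * x).
  apply: acD; last by apply: (acC); apply: (@ac_lipschitz _ _ _ _ 1) => s t _ st _; rewrite mul1r ger0_norm// subr_ge0.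
  by apply: acD; apply: acD; exact: (acC).
have := @ac_add_nondecreasing_le R 0 d (fun x => L x + -1 * x) (fun x => 2 * Mr x) (ltW d0) acL _ _.
have L0 : L 0 = 0 by rewrite LE /bform bU.
rewrite L0 mulr0 !add0r => H.
have : 2 * Mr 0 <= L d + -1 * d + 2 * Mr d.
  apply: H; first by move=> x y _ xy _; rewrite ler_pM2l// Mr_mono.
  apply: (ae_imp (ae_and (ae_and dU eqU) dMr)) => x [[h1 h2] h3] /andP[x0 xd].
  have {}h1 := h1 x0; have {}h2 := h2 x0; have {}h3 := h3 x0.
  have [dr0 di0] := h1 0; have [dr1 di1] := h1 1.
  have DL := is_derive_add (is_derive_add (is_derive_add (is_derive_mulc o1 dr0) (is_derive_mulc (- o2) di0))
     (is_derive_add (is_derive_mulc o1 dr1) (is_derive_mulc o2 di1))) (is_derive_mulc (-1) (is_derive_id x (1 : R))).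
  have DT := is_derive_add DL (is_derive_mulc 2 h3).
  eexists; last exact: DT.
  have [q0 q1] := dirac_exprE phi x (U' x) (U x); rewrite h2 source_in ?(ltW xd)// !mxE /= in q0 q1.
  have us := usmall x (ltW x0) (ltW xd).
  have u0 := cmod_le_vnorm (U x) 0; have u1 := cmod_le_vnorm (U x) 1.
  have w0 := cmod_le_vnorm (r x) 0; have w1 := cmod_le_vnorm (r x) 1.
  have pB := phiB x0.
  pose Z0 := E%:C * U x 0 0 + (0 +i* eps) * U x 0 0 + r x 0 0 - phi x * U x 1 0.
  pose Z1 := E%:C * U x 1 0 + (0 +i* eps) * U x 1 0 + r x 1 0 - conjc (phi x) * U x 0 0.
  have v0 : U' x 0 0 = conjc omega - 'i * Z0.
    rewrite (solve_imul (esym q0)) /Z0; apply: (@eq_trans _ _ (- ('i * 'i) * conjc omega - 'i * Z0)).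
      by rewrite /Z0; ring.
    by rewrite -expr2 sqr_i opprK mul1r.
  have v1 : U' x 1 0 = omega + 'i * Z1.
    rewrite (solve_imul2 (esym q1)) /Z1; apply: (@eq_trans _ _ (- ('i * 'i) * omega + 'i * Z1)).
      by rewrite /Z1; ring.
    by rewrite -expr2 sqr_i opprK mul1r.
  have EN' : cmod E%:C <= N0 by rewrite cmodR.
  have Zb (z z' w p : R[i]) : cmod z <= vnorm (U x) -> cmod z' <= vnorm (U x) -> cmod w <= vnorm (r x) ->
      cmod p <= B -> cmod (E%:C * z + (0 +i* eps) * z + w - p * z') <= K * vnorm (U x) + vnorm (r x).
    move=> hz hz' hw hp; have := cmodD (E%:C * z + (0 +i* eps) * z + w) (- (p * z')).
    have := cmodD (E%:C * z + (0 +i* eps) * z) w; have := cmodD (E%:C * z) ((0 +i* eps) * z).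
    rewrite cmodN !cmodM cmod_ie.
    have := ler_pM (cmod_ge0 _) (cmod_ge0 _) EN' hz; have := ler_pM (cmod_ge0 _) (cmod_ge0 _) hp hz'.
    have := ler_pM (ltW e0) (cmod_ge0 _) e1 hz.
    rewrite /K; lra.
  have b0 : cmod Z0 <= K * vnorm (U x) + vnorm (r x) by exact: Zb.
  have b1 : cmod Z1 <= K * vnorm (U x) + vnorm (r x) by apply: Zb => //; rewrite cmodJ.
  have oo : complex.Re (omega * conjc omega) = 1.
    by have := cmod_sqr omega; rewrite omega1 expr1n => ->; case: (omega) => a b /=; ring.
  have val : o1 * complex.Re (U' x 0 0) + - o2 * complex.Im (U' x 0 0) +
      (o1 * complex.Re (U' x 1 0) + o2 * complex.Im (U' x 1 0)) =
      2 + complex.Re (conjc omega * ('i * Z1) - omega * ('i * Z0)).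
    have -> : 2 = 2 * complex.Re (omega * conjc omega) by rewrite oo mulr1.
    rewrite v0 v1 /o1 /o2; case: (omega) (Z0) (Z1) => [a b] [z1 z2] [z3 z4] /=; ring.
  rewrite val; have := cmodD (conjc omega * ('i * Z1)) (- (omega * ('i * Z0))).
  rewrite cmodN !cmodM cmodJ omega1 cmod_i !mul1r => hh.
  have := le_trans (cmod_Re _) hh; rewrite ler_norml => /andP[hh2 _].
  (* Here [L' >= 3 / 2 - 2 |r|], so the derivative of [L - x + 2 Mr] is at least
     [2 (|r| - 1 / 2)^2]. *)
  have := sqr_ge0 (vnorm (r x) - 1 / 2); rewrite !expr2; move: us b0 b1 hh2; lra.
move=> H2; have := bform_le d; rewrite -LE => hb.
have := Mr_le (ltW d0) => hM.
have : d / 4 <= vnorm (U d) by move: H2 hb hM ed; lra.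
have d4 : 0 <= d / 4 by rewrite divr_ge0// ltW.
move=> /(lerXn2r 2) => /(_ d4 (vnorm_ge0 _)).
by move: small; rewrite /density !expr2; lra.
Qed.

(** Running the estimate backwards from [x] to [d] gives [d ^+ 2 / 16 <= F * (density U x + eps)].
    For [eps <= c2] this leaves [density U x >= c2] on an interval of length [1 / eps]. *)
Lemma mass_lower (C : R) : 1 <= C ->
  (forall (e a b : R) (P Y1 Y2 M : R -> R), 0 <= e -> 0 <= a -> a <= b ->
    energy_system phi E e a b P Y1 Y2 M ->
    P b <= C * expR (C * e * (b - a)) * (P a + (M b - M a)) /\
    P a <= C * expR (C * e * (b - a)) * (P b + (M b - M a))) ->
  eps <= d ^+ 2 / 16 / (2 * (C * expR (3 * C))) ->
  d ^+ 2 / 16 / (2 * (C * expR (3 * C))) <= eps * N2 U.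
Proof.
move=> C1 HC; set F := C * expR (3 * C); set c2 := d ^+ 2 / 16 / (2 * F) => ec.
have C0 : 0 < C by exact: lt_le_trans C1.
have F0 : 0 < F by rewrite mulr_gt0// expR_gt0.
have c20 : 0 < c2.
  by apply: divr_gt0; [apply: divr_gt0 => //; exact: exprn_gt0|exact: mulr_gt0].
have low x : d < x <= d + eps^-1 -> c2 <= density U x.
  move=> /andP[dx xd]; have dx' := ltW dx.
  have e3 : 0 <= 3 * eps by rewrite mulr_ge0// ltW.
  have [_ h] := HC _ _ _ _ _ _ _ e3 (ltW d0) dx' (far_system dx').
  have P0 : 0 <= density U x by exact: sqr_ge0.
  have hM := Mr_le dx'; have hM0 := Mr_mono dx'.
  have hM1 : eps^-1 * Mr x - eps^-1 * Mr d <= eps.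
    rewrite -mulrBr mulrC ler_pdivrMr// -expr2//.
  have hM2 : 0 <= eps^-1 * Mr x - eps^-1 * Mr d by rewrite subr_ge0 ler_pM2l ?invr_gt0.
  have fac : C * expR (C * (3 * eps) * (x - d)) <= F.
    rewrite ler_pM2l// ler_expR; have -> : C * (3 * eps) * (x - d) = 3 * C * (eps * (x - d)) by ring.
    rewrite ler_piMr ?mulr_ge0 ?(ltW C0)// mulrC -ler_pdivlMr// div1r; lra.
  have : d ^+ 2 / 16 <= F * (density U x + eps).
    apply: (le_trans density_at_d); apply: (le_trans h); apply: ler_pM => //.
    - by rewrite mulr_ge0 ?expR_ge0// ltW.
    - exact: addr_ge0.
    - by rewrite lerD2l.
  have -> : d ^+ 2 / 16 = F * (2 * c2).
    by rewrite /c2; field; rewrite gt_eqF.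
  rewrite ler_pM2l// => h2; move: ec h2; lra.
have L2U : L2 U by case: HU.
have ei : d < d + eps^-1 by rewrite ltrDl invr_gt0.
have := le_integral_itv d0 ei (fun x => sqr_ge0 (vnorm (U x))) (ltW c20) low.
rewrite -N2_EFin// lee_fin addrAC subrr add0r => h.
by rewrite mulrC -ler_pdivrMr.
Qed.

End OneSolution.
(** [f] precedes [E]: the length [d] of the source depends only on [N0] and [B], so a single vector
    serves all energies in a bounded set. The constants [c1] and [eps1] may depend on [E]. *)
Lemma resolvent_lower : exists2 f, L2 f & forall E, `|E| <= N0 -> tame phi E ->
  exists2 c1, 0 < c1 & exists2 eps1, 0 < eps1 & forall eps u w, 0 < eps -> eps <= eps1 ->
    dirac_op phi omega u w -> N2 (lc (lc w (- (E +i* eps)) u) (- 1) f) <= eps ^+ 2 ->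
    c1 <= eps * N2 u.
Proof.
exists (source d); first exact: L2_source.
move=> E EN [C C1 HC]; set c2 := d ^+ 2 / 16 / (2 * (C * expR (3 * C))).
have C0 : 0 < C by exact: lt_le_trans C1.
have c20 : 0 < c2 by rewrite !divr_gt0 ?mulr_gt0 ?exprn_gt0 ?expR_gt0.
exists c2 => //; exists (Num.min 1 (Num.min c2 (d / 4))).
  by rewrite !lt_min ltr01 c20 divr_gt0.
move=> eps u w e0; rewrite !le_min => /and3P[e1 ec ed] [L2u L2w [U [U' [HU bU uU wU]]]].
set r := lc _ _ _ => rE.
have L2r : L2 r by apply: L2_lc; [exact: L2_lc|exact: L2_source].
have ed' : eps ^+ 2 <= d / 4 by apply: le_trans ed; rewrite expr2 ler_piMl// ltW.
have L2U : L2 U by case: HU.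
rewrite (N2_ae L2u L2U uU).
apply: (mass_lower EN e0 e1 ed' HU bU L2r rE _ C1 HC ec).
apply: (ae_imp (ae_and uU wU)) => x [h1 h2] x0.
rewrite -h2// /r /lc h1//.
have -> : E +i* eps = E%:C + (0 +i* eps) by apply/eqP; rewrite eq_complex /= addr0 add0r !eqxx.
exact: residual_eq.
Qed.

End LowerBound.
End DiracResolvent.

(** * The absolutely continuous spectrum *)

Section PoissonKernel.
Context {R : realType}.
Local Notation leb := (@lebesgue_measure R).
Local Notation T := (measurableTypeR R).
Context (nu : {finite_measure set T -> \bar R}) (K : set T) (N0 : R).
Context (N00 : 0 < N0) (mK : measurable K) (cK : closed (K : set R)).
Context (KN : K `<=` `[- N0, N0]) (nuK : nu K = 0%E).

(** The normalization is that of [eps * ||u||^2] in [approx_resolvent], including its factor 2; the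
    integral over [E] is at most [2 * pi]. *)
Definition poisson (e l E : R) : R := 2 * e / ((l - E) ^+ 2 + e ^+ 2).

Lemma poisson_ge0 (e l E : R) : 0 <= e -> 0 <= poisson e l E.
Proof. by move=> e0; rewrite /poisson divr_ge0 ?mulr_ge0 ?addr_ge0 ?sqr_ge0. Qed.

Lemma poisson_continuous (e l : R) : 0 < e -> continuous (poisson e l).
Proof.
move=> e0 x; apply: cvgM; first exact: cvg_cst.
apply: cvgV; first by rewrite gt_eqF// ltr_wpDl ?sqr_ge0// exprn_gt0.
apply: cvgD; last exact: cvg_cst.
have cB : (l - y) @[y --> x] --> l - x by apply: cvgB; [exact: cvg_cst|exact: cvg_id].
exact: (cvgM cB cB).
Qed.

Definition kern e (x : T * T) : \bar R := (poisson e x.1 x.2 * \1_K x.2)%:E.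

Lemma kern_ge0 e x : 0 <= e -> (0 <= kern e x)%E.
Proof. by move=> e0; rewrite lee_fin mulr_ge0 ?poisson_ge0. Qed.

Lemma measurable_kern e : 0 < e -> measurable_fun setT (kern e).
Proof.
move=> e0; apply/measurable_EFinP; apply: measurable_funM; last first.
  by apply: measurableT_comp; [exact: measurable_indic|exact: measurable_snd].
have -> : (fun x : T * T => poisson e x.1 x.2) = (fun t : R => poisson e 0 t) \o (fun x : T * T => x.1 - x.2).
  by apply/funext => x; rewrite /= /poisson sub0r sqrrN.
apply: measurableT_comp; first by apply: continuous_measurable_fun; exact: poisson_continuous.
by apply: measurable_funB; [exact: measurable_fst|exact: measurable_snd].
Qed.

Lemma is_derive_poisson (e l x : R) : 0 < e ->
  is_derive x 1 (fun y : R => 2 * atan (e^-1 * (y - l))) (poisson e l x).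
Proof.
move=> e0; have dl : is_derive x 1 (fun y : R => e^-1 * (y - l)) (e^-1 * (1 + 0)).
  by apply: is_derive_mulc; apply: is_derive_add.
have h := is_derive_mulc 2 (@is_derive1_comp _ atan (fun y : R => e^-1 * (y - l)) x _ _ (is_derive1_atan _) dl).
apply: (is_derive_eq h); rewrite /GRing.scale /= /poisson addr0 mulr1.
have e00 : e != 0 by rewrite gt_eqF.
have d0 : (l - x) ^+ 2 + e ^+ 2 != 0 by rewrite gt_eqF// ltr_wpDl ?sqr_ge0// exprn_gt0.
have d1 : 1 + (e^-1 * (x - l)) ^+ 2 = ((l - x) ^+ 2 + e ^+ 2) / e ^+ 2 by field.
rewrite d1 invf_div; set q := _ + e ^+ 2 in d0 *; by field; rewrite d0 e00.
Qed.

Lemma integral_poisson_le (e l : R) : 0 < e -> (\int[leb]_E kern e (l, E) <= (2 * pi)%:E)%E.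
Proof.
move=> e0; pose F y := 2 * atan (e^-1 * (y - l)) : R.
have dF (x : R) : is_derive x 1 F (poisson e l x) by exact: is_derive_poisson.
have cF : continuous F.
  by move=> x; apply: differentiable_continuous; apply/derivable1_diffP; case: (dF x).
have NN : - N0 < N0 by rewrite (lt_trans _ N00)// oppr_lt0.
have FTC : (\int[lebesgue_measure]_(x in `[(- N0)%R, N0%R]) (poisson e l x)%:E = (F N0)%:E - (F (- N0)%R)%:E)%E.
  apply: (continuous_FTC2 NN).
  - by apply: continuous_subspaceT; exact: poisson_continuous.
  - split; first by move=> x _; case: (dF x).
      by apply: cvg_at_right_filter; exact: cF.
    by apply: cvg_at_left_filter; exact: cF.
  by move=> x _; rewrite derive1E; case: (dF x).
have : ((F N0)%:E - (F (- N0)%R)%:E <= (2 * pi)%:E)%E.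
  rewrite -EFinB lee_fin /F; have := atan_ltpi2 (e^-1 * (N0 - l)).
  have := atan_gtNpi2 (e^-1 * (- N0 - l)); lra.
apply: le_trans; rewrite -FTC [leRHS]integral_mkcond.
apply: ge0_le_integral_nomeas => x _; first exact: kern_ge0 (ltW e0).
rewrite /kern /patch /= indicE; case: (boolP (x \in K)) => [|_].
  by rewrite inE => /KN xN; rewrite mem_set// mulr1.
by rewrite mulr0; case: ifP => // _; rewrite lee_fin poisson_ge0// ltW.
Qed.

Lemma integral_poisson_far (e r l : R) : 0 < e -> 0 < r -> (forall E, K E -> r <= `|l - E|) ->
  (\int[leb]_E kern e (l, E) <= (4 * N0 / r ^+ 2 * e)%:E)%E.
Proof.
move=> e0 r0 far; pose a := 2 * e / r ^+ 2.
have a0 : 0 <= a by rewrite /a divr_ge0 ?mulr_ge0 ?sqr_ge0// ltW.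
have mI : measurable (`[- N0, N0]%classic : set T) by exact: measurable_itv.
have lebI : leb (`[- N0, N0]%classic : set T) = (2 * N0)%:E.
  suff : lebesgue_measure (`[- N0, N0]%classic : set R) = (2 * N0)%:E by [].
  have NN : - N0 < N0 by rewrite (lt_trans _ N00)// oppr_lt0.
  by rewrite lebesgue_measure_itv /= lte_fin NN -EFinB; congr (_%:E); ring.
apply: (@le_trans _ _ (\int[leb]_(E in `[(- N0)%R, N0%R]) (cst a%:E E))%E); last first.
  rewrite integral_cst// (_ : (_ * _)%E = (a * (2 * N0))%:E); last first.
    by apply: (@eq_trans _ _ (mule a%:E (2 * N0)%:E)); [apply: (congr1 (mule a%:E)); exact: lebI|].
  rewrite lee_fin /a le_eqVlt; apply/orP; left; apply/eqP; field.
  by rewrite gt_eqF.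
rewrite [leRHS]integral_mkcond; apply: ge0_le_integral_nomeas => x _; first exact: kern_ge0 (ltW e0).
rewrite /kern /patch /= indicE; case: (boolP (x \in K)) => [|_]; last first.
  by rewrite mulr0; case: ifP.
rewrite inE => Kx; rewrite mem_set ?mulr1; last exact: KN.
rewrite lee_fin /poisson /a ler_wpM2l ?mulr_ge0 ?(ltW e0)// lef_pV2 ?posrE ?exprn_gt0//; last first.
  by rewrite ltr_wpDl ?sqr_ge0// exprn_gt0.
apply: ler_wpDr; first exact: sqr_ge0.
rewrite -[leRHS]real_normK ?num_real//; apply: lerXn2r; rewrite ?nnegrE ?(ltW r0)//; exact: far.
Qed.

Let e_ (n : nat) : R := n.+1%:R^-1.
Let e_gt0 n : 0 < e_ n. Proof. by rewrite invr_gt0. Qed.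

Lemma e_small (c : R) : 0 < c -> exists n0, forall n, (n0 <= n)%N -> e_ n <= c.
Proof.
move=> c0; exists (Num.truncn c^-1) => n n0n; rewrite /e_ invf_ple ?posrE//.
have /truncn_itv/andP[_ /ltW h] : 0 <= c^-1 by rewrite invr_ge0 ltW.
by apply: (le_trans h); rewrite ler_nat.
Qed.

Let H n (l : T) : \bar R := (\int[leb]_E kern (e_ n) (l, E))%E.
Let F n (E : T) : \bar R := (\int[nu]_l kern (e_ n) (l, E))%E.

Lemma integral_H_F n : (\int[nu]_l H n l = \int[leb]_E F n E)%E.
Proof.
rewrite /H /F; apply: (fubini_tonelli (kern (e_ n))); first exact: measurable_kern.
by move=> x; exact: kern_ge0 (ltW (e_gt0 n)).
Qed.

(** Dominated convergence with the constant bound [2 * pi]: as [K] is closed and [nu]-null, almost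
    every [l] has a positive distance to [K], where the kernel is of order [e]. *)
Lemma integral_H_cvg : (\int[nu]_l H n l)%E @[n --> \oo] --> 0%E.
Proof.
have mH n : measurable_fun setT (H n).
  apply: (@measurable_fun_fubini_tonelli_F _ _ _ _ _ leb (kern (e_ n))); first exact: measurable_kern.
  by move=> x; exact: kern_ge0 (ltW (e_gt0 n)).
have H0 n l : (0 <= H n l)%E by apply: integral_ge0 => E _; exact: kern_ge0 (ltW (e_gt0 n)).
have aeK (P : T -> Prop) : (forall l, ~ K l -> P l) -> {ae nu, forall l, P l}.
  by move=> HP; exists K; split => // l /= nP; apply: contrapT => nK; apply: nP; exact: HP.
have conv : {ae nu, forall l, setT l -> H n l @[n --> \oo] --> cst 0%E l}.
  apply: aeK => l nKl _.
  have oC : open (~` (K : set R)) by exact: closed_openC.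
  have /nbhs_ballP[r /= r0 Hr] := oC _ nKl.
  have far E : K E -> r <= `|l - E|.
    by move=> KE; rewrite leNgt; apply/negP => lt; apply: (Hr E) KE; rewrite /ball /=.
  have hle n := integral_poisson_far (e_gt0 n) r0 far.
  apply/fine_cvgP; split.
    by apply: nearW => n; rewrite ge0_fin_numE//; exact: le_lt_trans (hle n) (ltry _).
  apply/cvgrPdist_le => a a0; set q := 4 * N0 / r ^+ 2 in hle.
  have q0 : 0 <= q by rewrite /q divr_ge0 ?mulr_ge0 ?sqr_ge0// ltW.
  have aq : 0 < a / (q + 1) by rewrite divr_gt0// ltr_wpDl.
  have [n0 Hn0] := e_small aq; exists n0 => // n /= /Hn0 en.
  rewrite sub0r normrN ger0_norm ?fine_ge0// -lee_fin fineK; last first.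
    by rewrite ge0_fin_numE//; exact: le_lt_trans (hle n) (ltry _).
  apply: (le_trans (hle n)); rewrite lee_fin.
  move: en; rewrite ler_pdivlMr ?ltr_wpDl// => en; have := e_gt0 n; lra.
have ig : nu.-integrable setT (cst (2 * pi)%:E : T -> \bar R).
  exact: finite_measure_integrable_cst.
have bd : {ae nu, forall l, forall n, setT l -> (`|H n l| <= cst (2 * pi)%:E l)%E}.
  by apply: aeW => l n _; rewrite gee0_abs//; exact: integral_poisson_le.
have [_ _] := dominated_convergence measurableT mH (measurable_cst _) conv ig bd.
by rewrite integral_cst// mul0e.
Qed.

Lemma poisson_null (bad : set T) : leb.-negligible bad ->
  (forall E, K E -> ~ bad E -> exists2 c : R, 0 < c & exists2 e1 : R, 0 < e1 &
     forall e : R, 0 < e -> e <= e1 -> (c%:E <= \int[nu]_l (poisson e l E)%:E)%E) ->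
  leb K = 0%E.
Proof.
move=> negbad good.
have mF n : measurable_fun setT (F n).
  apply: (@measurable_fun_fubini_tonelli_G _ _ _ _ _ nu (kern (e_ n))); first exact: measurable_kern.
  by move=> x; exact: kern_ge0 (ltW (e_gt0 n)).
have F0 n E : (0 <= F n E)%E by apply: integral_ge0 => l _; exact: kern_ge0 (ltW (e_gt0 n)).
pose G j n : set T := [set E | ((e_ j)%:E <= F n E)%E].
have mG j n : measurable (G j n).
  by have := emeasurable_fun_c_infty measurableT (mF n) (e_ j)%:E; rewrite setTI.
(* A good energy lies in [S j] for large [j], since [e_ j] drops below both its lower bound and its
   threshold. Each [S j] is null, as [e_ j * leb (S j)] is at most the integral of [F n] for all
   [n >= j]. *)
pose S j : set T := \bigcap_(n in [set n | (j <= n)%N]) G j n.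
have mS j : measurable (S j) by apply: bigcap_measurable; [exists j => /=|].
have S0 j : leb (S j) = 0%E.
  have le n : (j <= n)%N -> ((e_ j)%:E * leb (S j) <= \int[nu]_l H n l)%E.
    move=> jn; have iS : (\int[leb]_E (\1_(S j) E)%:E)%E = leb (S j).
      by have := @integral_indic _ _ _ leb _ measurableT _ (mS j); rewrite setIT.
    rewrite integral_H_F -iS -ge0_integralZl_EFin//; last 2 first.
    - by apply/measurable_EFinP; exact: measurable_indic.
    - exact: ltW (e_gt0 j).
    apply: ge0_le_integral_nomeas => E _; first by rewrite mule_ge0// lee_fin// ltW.
    rewrite -EFinM indicE; case: (boolP (E \in S j)) => [|_]; last by rewrite mulr0.
    by rewrite inE mulr1 => /(_ n jn).
  have : ((e_ j)%:E * leb (S j) <= 0)%E.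
    have lim : limn (fun n => \int[nu]_l H n l)%E = 0%E by apply/cvg_lim => //; exact: integral_H_cvg.
    rewrite -lim; apply: lime_ge; first by apply/cvg_ex; exists 0%E; exact: integral_H_cvg.
    by exists j => // n /= jn; exact: le.
  rewrite pmule_rle0 ?lte_fin// => h; apply/eqP; rewrite eq_le h /=; exact: measure_ge0.
have sub : K `<=` bad `|` \bigcup_j S j.
  move=> E KE; have [bE|nbE] := pselect (bad E); [by left|right].
  have [c c0 [e1 e10 He]] := good E KE nbE.
  have m0 : 0 < Num.min c e1 by rewrite lt_min c0.
  have [n0 Hn0] := e_small m0.
  exists n0 => // n /= n0n.
  have := Hn0 n n0n; have := Hn0 n0 (leqnn _); rewrite !le_min => /andP[h1 _] /andP[_ h2].
  rewrite /G /=; apply: (@le_trans _ _ c%:E); first by rewrite lee_fin.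
  apply: (le_trans (He _ (e_gt0 n) h2)); rewrite /F /kern /= indicE mem_set//.
  by rewrite le_eqVlt; apply/orP; left; apply/eqP; apply: eq_integral => l _; rewrite mulr1.
have : leb.-negligible K.
  apply: (negligibleS sub); apply: negligibleU => //.
  by apply: negligible_bigcup => j; apply/(negligibleP _ (mS j)); exact: S0.
by move=> /(negligibleP _ mK).
Qed.

End PoissonKernel.

(** * Lebesgue decomposition and null sets of the spectral measures *)

Section AbsolutelyContinuousPart.
Context {R : realType}.
Local Open Scope complex_scope.
Local Notation leb := (@lebesgue_measure R).
Local Notation cmod := (@Normc.normc R).
Local Notation T := (measurableTypeR R).
Local Notation borel := {measure set T -> \bar R}.

(** [N] is a Lebesgue null set of maximal [m]-mass: a null set charged outside [N] could be added to
    it and exceed the supremum. Restricting [m] to [N] and to its complement gives the Lebesgue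
    decomposition. *)
Lemma maximal_null_set (m : borel) : (m setT < +oo)%E -> exists N : set T,
  [/\ measurable N, leb N = 0%E &
      forall B, measurable B -> leb B = 0%E -> m (B `&` ~` N) = 0%E].
Proof.
move=> moo.
have mfin (B : set T) : measurable B -> m B \is a fin_num.
  move=> mB; rewrite ge0_fin_numE ?measure_ge0//; apply: le_lt_trans moo.
  by apply: le_measure; rewrite ?inE.
pose Z := [set B : set T | measurable B /\ leb B = 0%E].
pose S := [set fine (m B) | B in Z].
have Z0 : Z set0 by split; [exact: measurable0|exact: measure0].
have hS : has_sup S.
  split; first by exists (fine (m set0)), set0.
  exists (fine (m setT)) => _ [B [mB _] <-]; apply: fine_le; rewrite ?mfin//.
  by apply: le_measure; rewrite ?inE.
have HN k : exists B, Z B /\ sup S - k.+1%:R^-1 < fine (m B).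
  have k0 : 0 < k.+1%:R^-1 :> R by rewrite invr_gt0.
  by have [_ [B ZB <-] lt] := sup_adherent k0 hS; exists B.
pose N_ k := sval (cid (HN k)).
have ZN k : Z (N_ k) by case: (svalP (cid (HN k))).
have Nlt k : sup S - k.+1%:R^-1 < fine (m (N_ k)) by case: (svalP (cid (HN k))).
have mN : measurable (\bigcup_k N_ k) by apply: bigcup_measurable => k _; case: (ZN k).
have N0 : leb (\bigcup_k N_ k) = 0%E.
  apply/(negligibleP _ mN); apply: negligible_bigcup => k.
  by have [mk k0] := ZN k; apply/(negligibleP _ mk).
exists (\bigcup_k N_ k); split => // B mB B0.
set N := \bigcup_k N_ k; have mBN : measurable (B `&` ~` N) by apply: measurableI => //; exact: measurableC.
have le1 : fine (m N) + fine (m (B `&` ~` N)) <= sup S.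
  apply: ub_le_sup; first exact: hS.2.
  exists (N `|` (B `&` ~` N)).
    split; first exact: measurableU.
    apply/(negligibleP _ (measurableU _ _ mN mBN)); apply: negligibleU; first exact/(negligibleP _ mN).
    apply: (@negligibleS _ _ _ _ B); first by move=> x [].
    exact/(negligibleP _ mB).
  rewrite -fineD ?mfin//; congr fine; apply: measureU => //.
  by rewrite setICA setICr setI0.
have le2 : sup S <= fine (m N).
  apply/ler_addgt0Pr => e e0; pose k := Num.truncn e^-1.
  have ke : k.+1%:R^-1 <= e.
    rewrite invf_ple ?posrE//; have /truncn_itv/andP[_ /ltW] : 0 <= e^-1 by rewrite invr_ge0 ltW.
    exact.
  have le3 : fine (m (N_ k)) <= fine (m N).
    apply: fine_le; rewrite ?mfin//; first by case: (ZN k).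
    apply: le_measure; rewrite ?inE//; first by case: (ZN k).
    exact: bigcup_sup.
  by rewrite (le_trans _ (lerD le3 ke))// -lerBlDr; exact: ltW (Nlt k).
have ge0 : 0 <= fine (m (B `&` ~` N)) by rewrite fine_ge0// measure_ge0.
have : fine (m (B `&` ~` N)) = 0 by lra.
by move=> h; rewrite -[LHS]fineK ?mfin// h.
Qed.

(** Inner regularity, applied to the bounded pieces of [B], which have finite measure. *)
Lemma compact_null (B : set T) : measurable B ->
  (forall K : set R, compact K -> K `<=` B -> leb K = 0%E) -> leb B = 0%E.
Proof.
move=> mB HK; pose D (n : nat) : set T := B `&` `[- n%:R, n%:R].
have mI (n : nat) : measurable (`[- n%:R, n%:R]%classic : set T) by exact: measurable_itv.
have mD n : measurable (D n) by exact: measurableI.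
have Doo n : (leb (D n) < +oo)%E.
  apply: (@le_lt_trans _ _ (leb (`[- n%:R, n%:R]%classic : set T))).
    by apply: le_measure; rewrite ?inE; [exact: mD|exact: mI|exact: subIsetr].
  suff : (lebesgue_measure (`[(- n%:R)%R, n%:R%R]%classic : set R) < +oo)%E by [].
  by rewrite lebesgue_measure_itv /=; case: ifP => _; rewrite -?EFinB ltry.
have D0 n : leb (D n) = 0%E.
  apply/eqP; rewrite eq_le measure_ge0 andbT; apply/lee_addgt0Pr => e e0.
  have [V [cV VD Vlt]] := lebesgue_regularity_inner (mD n) (Doo n) e0.
  have mV : measurable (V : set T).
    by apply: closed_measurable; apply: compact_closed => //; exact: Rhausdorff.
  have V0 : leb V = 0%E by apply: HK => // x /VD[].
  have DE : D n = V `|` (D n `\` V) by rewrite setDUK.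
  rewrite add0e DE measureU//; last 2 first.
  - exact: measurableD.
  - by rewrite setIDA setIC setDE -setIA setICr setI0.
  by rewrite [X in (X + _)%E]V0 add0e; exact: ltW.
have DE : B = \bigcup_n D n.
  rewrite /D -setI_bigcupr; apply/esym/setIidl => x _.
  exists (Num.truncn `|x : R|).+1 => //=; rewrite in_itv /= -ler_norml.
  by have /truncn_itv/andP[_ /ltW] := normr_ge0 (x : R).
have : leb.-negligible B.
  rewrite DE; apply: negligible_bigcup => n; apply/(negligibleP _ (mD n)); exact: D0.
by move=> /(negligibleP _ mB).
Qed.

(** Approximate resolvents with residual [e ^+ 2] put [e * N2 u] between the lower bound of
    [resolvent_lower] and the Poisson integral of [mu f], at almost every point of [K] and with the
    same [f]; then [poisson_null] applies. *)
Lemma spectral_measure_null phi (omega : R[i]) E mu (B0 : R) (K : set R) :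
  cmod omega = 1 -> (forall x, 0 < x -> cmod (phi x) <= B0) ->
  leb.-negligible [set E | ~ tame phi E] ->
  spectral_resolution (dirac_op phi omega) E mu -> compact K ->
  (forall f, L2 f -> mu f K = 0%E) -> leb K = 0%E.
Proof.
move=> omega1 phiB bad res cptK mu0.
have cK : closed K by apply: compact_closed => //; exact: Rhausdorff.
have mK : measurable (K : set T) by exact: closed_measurable.
have [N0 N00 KN] : exists2 N0 : R, 0 < N0 & K `<=` `[- N0, N0].
  have [M [Mr HM]] := compact_bounded cptK.
  exists (`|M| + 1); first by rewrite ltr_wpDl.
  move=> x Kx; rewrite /= in_itv /= -ler_norml; apply: HM => //.
  by rewrite (le_lt_trans (ler_norm _))// ltrDl.
have [f L2f low] := resolvent_lower omega1 phiB (ltW N00).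
have opL2 u w : dirac_op phi omega u w -> L2 u /\ L2 w by case.
have fin : (mu f setT < +oo)%E := mu_fin res (@measurableT _ T) L2f.
(* Restricting to the whole line only records that [mu f] is finite. *)
pose nu : {finite_measure set T -> \bar R} := mfrestr (@measurableT _ T) fin.
have nuE (F : T -> \bar R) : (\int[nu]_l F l = \int[mu f]_l F l)%E.
  apply: eq_measure_integral => A mA _.
  by rewrite /nu /= /mfrestr /mrestr setIT.
apply: (@poisson_null R nu K N0 N00 mK cK KN _ _ bad).
  by rewrite /nu /= /mfrestr /mrestr setIT mu0.
move=> x Kx /contrapT tx.
have xN : `|x : R| <= N0 by rewrite ler_norml; have := KN _ Kx; rewrite /= in_itv.
have [c c0 [e1 e10 Hlow]] := low x xN tx.
exists c => //; exists e1 => // e e0 ee1; rewrite nuE.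
have [u [w [Auw Nw Nu]]] := approx_resolvent (dirac_op0 phi omega)
  (@dirac_op_lc R phi omega) opL2 res x L2f e0 (exprn_gt0 2 e0).
have h := Hlow e u w e0 ee1 Auw Nw.
apply: (@le_trans _ _ (e%:E * (N2 u)%:E)%E); first by rewrite -EFinM lee_fin.
apply: (@le_trans _ _ (e%:E * \int[mu f]_l (2 / ((l - x) ^+ 2 + e ^+ 2))%:E)%E).
  by apply: lee_wpmul2l => //; rewrite lee_fin ltW.
rewrite -ge0_integralZl_EFin//; last 3 first.
- by move=> l _; rewrite lee_fin divr_ge0 ?addr_ge0 ?sqr_ge0.
- apply/measurable_EFinP.
  have -> : (fun l : T => 2 / ((l - x) ^+ 2 + e ^+ 2)) = (fun l => e^-1 * poisson e x l).
    apply/funext => l; rewrite /poisson (_ : (x - l) ^+ 2 = (l - x) ^+ 2); last by ring.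
    by rewrite !mulrA [e^-1 * 2]mulrC mulfVK ?gt_eqF.
  apply: measurable_funM; first exact: measurable_cst.
  by apply: continuous_measurable_fun; exact: poisson_continuous.
- exact: ltW.
rewrite le_eqVlt; apply/orP; left; apply/eqP; apply: eq_integral => l _.
by rewrite -EFinM /poisson; congr (_%:E); rewrite mulrCA mulrA.
Qed.


(** If the absolutely continuous part vanishes on [B], then [mu g] vanishes on [B] outside [N], and
    by maximality so does every [mu f]. Compact subsets of this set are then Lebesgue null, hence so
    is the set itself, and [N] is null anyway. *)
Lemma ac_essential_support phi (omega : R[i]) (B0 : R) : cmod omega = 1 ->
  (forall x, 0 < x -> cmod (phi x) <= B0) -> leb.-negligible [set E | ~ tame phi E] ->
  ac_essential_support_is_R (dirac_op phi omega).
Proof.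
move=> omega1 phiB bad m [E [mu [res [g L2g [-> dom]]]]].
have moo : (mu g setT < +oo)%E := mu_fin res (@measurableT _ T) L2g.
have [N [mN N0 HN]] := maximal_null_set moo.
have mC := measurableC mN.
have acm : (mrestr (mu g) mC : borel) `<< leb.
  by apply/null_content_dominatesP => B mB B0'; exact: HN.
exists (mrestr (mu g) mC : borel).
  split; first exact: acm.
  exists (mrestr (mu g) mN : borel); split.
    by exists N; split => //; rewrite /= /mrestr setICl measure0.
  move=> B mB; rewrite /= /mrestr -measureU; [|exact: measurableI|exact: measurableI|].
    by rewrite -setIUr setUC setUCr setIT.
  by rewrite setIACA setICl setI0.
split; first exact: acm.
apply/null_content_dominatesP => B mB mB0.
have mBN := measurableI _ _ mB mC.
have lebBN : leb (B `&` ~` N) = 0%E.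
  apply: compact_null => // K cptK KB.
  apply: (spectral_measure_null omega1 phiB bad res cptK) => f L2f.
  have mK : measurable (K : set T).
    by apply: closed_measurable; apply: compact_closed => //; exact: Rhausdorff.
  have /null_content_dominatesP := dom f L2f; apply => //.
  apply/eqP; rewrite eq_le measure_ge0 andbT -mB0 /= /mrestr.
  by apply: le_measure; rewrite ?inE.
have : leb.-negligible B.
  apply: (@negligibleS _ _ _ _ ((B `&` ~` N) `|` N)).
    by move=> x Bx; have [Nx|nNx] := pselect (N x); [right|left].
  by apply: negligibleU; [exact/(negligibleP _ mBN)|exact/(negligibleP _ mN)].
by move=> /(negligibleP _ mB).
Qed.

End AbsolutelyContinuousPart.

Unset Implicit Arguments.

Theorem theorem1p5 (R : realType) (p : nat) (alpha : R) (phi : R -> R[i])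
    (p_ge3 : (3 <= p)%N) (p_odd : odd p)
    (alpha_gt0 : 0 < alpha) (alpha_lt : alpha < 1 / (p - 2)%:R)
    (phi_WvN : wigner_von_neumann p alpha phi) :
  (hausdorff_dim
     [set E : R | exists U, dirac_solution phi E U /\ unbounded_pos U]
   <= ((p - 2)%:R * alpha)%:E)%E /\
  forall omega : R[i], Normc.normc omega = 1 ->
    ac_essential_support_is_R (dirac_op phi omega).
Proof.
have [[B phiB] cov] := wigner_von_neumann_tame p_ge3 p_odd alpha_gt0 alpha_lt phi_WvN.
have p2 : 0 < (p - 2)%:R :> R by rewrite ltr0n subn_gt0.
split; last first.
  move=> omega omega1; apply: (ac_essential_support omega1 phiB).
  (* The exponent 1 is admissible because [(p - 2) * alpha < 1]. *)
  apply: (small_covers_negligible (sigma := 1)); first by rewrite ltr01 lexx.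
  by apply: cov; rewrite mulrC -ltr_pdivlMr.
apply: small_covers_hausdorff_dim; first by rewrite mulr_ge0// ltW.
move=> sigma bs e e0; have [lo [len [h1 h2 h3]]] := cov sigma bs e e0.
exists lo, len; split => // E [U [solU unbU]]; apply: h2 => tE.
exact: tame_solution_bounded tE solU unbU.
Qed.
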